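(* There exists a numerical constant $c>0$ such that the following holds. Suppose the environment law $Q$ satisfies $\mathbb{E}_Q\big[\log\frac{1-\alpha_0}{\alpha_0}\big]=0$, $\sigma^2:=\mathrm{Var}_Q\big[\log\frac{1-\alpha_0}{\alpha_0}\big]>0$, and, for some $0<\eta_0<1/2$, $\sup\{x: Q[\alpha_0\ge x]=1\}=\sup\{x: Q[\alpha_0\le 1-x]=1\}\ge\eta_0$. Then for all integers $p\ge 2$, all $0<\rho<2$ and all $\gamma\ge 11$, there exist $c_1=c_1(Q,\gamma)>0$ and $n_0$ such that for all $n>n_0$ there exists $G_n'\subset\Omega_1$ with $Q[G_n']\ge 1-cR_p(n)$ and $$\inf_{\alpha\in G_n'}\left\{\mathbb{P}^\alpha_0\left[\frac{\mathcal{L}(\mathbb{F}_p(n),n)}{n}\ge 1-\frac{1}{(f_p(n))^{\rho/2}}\right]\right\}\ge 1-\frac{c_1}{(f_p(n))^{1-\rho/2}}.$$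
   Context: Random walk in random environment. $\alpha=(\alpha_i)_{i\in\mathbb{Z}}$ is a sequence of i.i.d. $(0,1)$-valued random variables on a probability space $(\Omega_1,\mathcal{F}_1,Q)$ (the environment); $\beta_i=1-\alpha_i$. For a fixed environment $\alpha$, $(X_n)_{n\in\mathbb{N}}$ is the Markov chain on $\mathbb{Z}$ with $\mathbb{P}^\alpha[X_n=i+1\mid X_{n-1}=i]=\alpha_i$, $\mathbb{P}^\alpha[X_n=i-1\mid X_{n-1}=i]=\beta_i$; $\mathbb{P}^\alpha_a$ is its law given $X_0=a$. $\mathbb{E}_Q$ is expectation under $Q$. For $G\subset\Omega_1$, ''$\alpha\in G$'' means $\alpha=\alpha(\omega)$ with $\omega\in G$. $\log_p$ ($p\ge2$) is the $p$-times iterated logarithm, and $n$ is always taken large enough that the iterated logarithms used are positive. $n_0$ may depend on the fixed parameters and on $Q$. Local time: $\mathcal{L}(k,T)=\sum_{i=1}^T \mathbf{1}_{\{X_i=k\}}$ and, for $V\subset\mathbb{Z}$, $\mathcal{L}(V,T)=\sum_{j\in V}\mathcal{L}(j,T)$. Potential: $\epsilon_i=\log\frac{1-\alpha_i}{\alpha_i}$, $S_0=0$, $S_k-S_j=\sum_{j+1\le i\le k}\epsilon_i$ for all integers $k>j$. Valleys: a triplet $\{M',m,M''\}$ (with $M'\le m\le M''$) is a valley if $S_{M'}=\max_{M'\le t\le m}S_t$, $S_{M''}=\max_{m\le t\le M''}S_t$, $S_m=\min_{M'\le t\le M''}S_t$ (if $m$ is not unique take the one of smallest absolute value). Its depth is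 $d([M',M''])=\min(S_{M'}-S_m,S_{M''}-S_m)$. Right refinement: take $m\le M_1<m_1\le M''$ with $S_{M_1}-S_{m_1}=\max_{m\le t'\le t''\le M''}(S_{t'}-S_{t''})$ (smallest absolute values if not unique); it yields the valleys $\{M',m,M_1\}$ and $\{M_1,m_1,M''\}$. Left refinement is defined symmetrically. Let $\gamma>0$ be a parameter and $\Gamma_n=\log n+\gamma\log_2 n$, $n>3$. A valley $\{M',m,M''\}$ contains $0$ and is of depth larger than $\Gamma_n$ if (1) $0\in[M',M'']$; (2) $d([M',M''])\ge\Gamma_n$; (3) if $m<0$, $S_{M''}-\max_{m\le t\le0}S_t\ge\gamma\log_2 n$, and if $m>0$, $S_{M'}-\max_{0\le t\le m}S_t\ge\gamma\log_2 n$. Basic valley $\{M_n',m_n,M_n\}$: let $\{M',m_n,M''\}$ be the smallest valley containing $0$ and of depth larger than $\Gamma_n$ (smallest: no other valley constructed inside it by refinement satisfies (1)-(3)). Then: if $m_n>0$, $M_n'=\sup\{l\in\mathbb{Z}_-: l<m_n,\ S_l-S_{m_n}\ge\Gamma_n,\ S_l-\max_{0\le k\le m_n}S_k\ge\gamma\log_2n\}$ and $M_n=\inf\{l\in\mathbb{Z}_+: l>m_n,\ S_l-S_{m_n}\ge\Gamma_n\}$; if $m_n<0$, $M_n'=\sup\{l\in\mathbb{Z}_-: l<m_n,\ S_l-S_{m_n}\ge\Gamma_n\}$ and $M_n=\inf\{l\in\mathbb{Z}_+: l>m_n,\ S_l-S_{m_n}\ge\Gamma_n,\ S_l-\max_{m_n\le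 k\le0}S_k\ge\gamma\log_2n\}$; if $m_n=0$, $M_n'=\sup\{l\in\mathbb{Z}_-: l<0,\ S_l-S_{m_n}\ge\Gamma_n\}$ and $M_n=\inf\{l\in\mathbb{Z}_+: l>0,\ S_l-S_{m_n}\ge\Gamma_n\}$. These objects depend on $\gamma$ and are considered for environments for which the basic valley exists. Further notation: $f_p(n)=[(\log_2n\,\log_pn)^2]$ ($[\cdot]$ integer part), $R_p(n)=(\log_{p+1}n)^{1/2}(\log_pn)^{-1/2}$, $\mathbb{F}_p(n)=\{m_n-f_p(n),\dots,m_n,\dots,m_n+f_p(n)\}$. *)

(* Defs.v *)
From HB Require Import structures.
From mathcomp Require Import all_boot all_order all_algebra.
From mathcomp Require Import all_classical all_reals all_analysis.

Set Implicit Arguments.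
Unset Strict Implicit.
Unset Printing Implicit Defensive.

Import Order.TTheory GRing.Theory Num.Theory.
Import numFieldNormedType.Exports.

Local Open Scope classical_set_scope.
Local Open Scope ring_scope.

(* Mutual independence is the product rule over all finite subfamilies. *)
Definition independent_family d (T : measurableType d) (R : realType)
    (Q : probability T R) (I : eqType) (Y : I -> T -> R) : Prop :=
  forall (s : seq I) (B : I -> set R), uniq s ->
    (forall i, measurable (B i)) ->
    (Q [set w | forall i, i \in s -> B i (Y i w)]
     = \prod_(i <- s) Q (Y i @^-1` B i))%E.

Definition same_law d (T : measurableType d) (R : realType)
    (Q : probability T R) (Y Z : T -> R) : Prop :=
  forall B : set R, measurable B -> Q (Y @^-1` B) = Q (Z @^-1` B).

Definition iid_environment d (T : measurableType d) (R : realType)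
    (Q : probability T R) (alpha : int -> {RV Q >-> R}) : Prop :=
  [/\ forall i w, 0 < alpha i w < 1,
      independent_family Q (fun i => alpha i : T -> R)
    & forall i, same_law Q (alpha i) (alpha 0)].

(* [a i] is the probability of a step from [i] to [i + 1]. *)
Definition transition (R : realType) (a : int -> R) (i j : int) : R :=
  if j == i + 1 then a i else if j == i - 1 then 1 - a i else 0.

(* The Markov property is given in product form, which avoids conditioning
   on null events. *)
Definition walk_in_environment (R : realType) (a : int -> R) (x0 : int)
    d (T : measurableType d) (P : probability T R) (X : nat -> T -> int) :
    Prop :=
  [/\ forall k x, measurable [set w | X k w = x],
      P [set w | X 0 w = x0] = 1%E
    & forall (k : nat) (x : nat -> int),
        (P [set w | forall i, (i <= k.+1)%N -> X i w = x i]
         = P [set w | forall i, (i <= k)%N -> X i w = x i]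
           * (transition a (x k) (x k.+1))%:E)%E].

(* [P a x] is the quenched law of [X] in the environment [a], started at [x]. *)
Definition quenched_laws (R : realType) d (T : measurableType d)
    (X : nat -> T -> int) (P : (int -> R) -> int -> probability T R) : Prop :=
  forall a : int -> R, (forall i, 0 < a i < 1) ->
  forall x, walk_in_environment a x (P a x) X.

Definition local_time (T : Type) (X : nat -> T -> int) (k : int) (N : nat)
    (w : T) : nat :=
  (\sum_(1 <= i < N.+1) (X i w == k))%N.

(* The sum has finite support, as at most [N] sites have been visited. *)
Definition local_time_set (R : realType) (T : Type) (X : nat -> T -> int)
    (V : set int) (N : nat) (w : T) : R :=
  \sum_(j \in V) ((local_time X j N w)%:R : R).

Definition ilog (R : realType) (p n : nat) : R := iter p (@ln R) n%:R.

Definition fscale (R : realType) (p n : nat) : int :=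
  Num.floor ((ilog R 2 n * ilog R p n) ^+ 2).

Definition Rrate (R : realType) (p n : nat) : R :=
  ilog R p.+1 n `^ (2^-1) * ilog R p n `^ (- 2^-1).

Definition Fset (R : realType) (p n : nat) (m : int) : set int :=
  [set k | m - fscale R p n <= k <= m + fscale R p n].

Definition Gamma (R : realType) (gamma : R) (n : nat) : R :=
  ilog R 1 n + gamma * ilog R 2 n.

Definition eps (R : realType) (a : int -> R) (i : int) : R :=
  ln ((1 - a i) / a i).

(* [Negz k] stands for - (k + 1), hence [S (Negz k)] is the opposite of the
   sum of [eps a i] for - k <= i <= 0. *)
Definition potential (R : realType) (a : int -> R) (k : int) : R :=
  match k with
  | Posz n => \sum_(0 <= i < n) eps a i.+1%:Z
  | Negz n => - \sum_(0 <= i < n.+1) eps a (- i%:Z)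
  end.

Lemma potentialS (R : realType) (a : int -> R) (k : int) :
  potential a (k + 1) = potential a k + eps a (k + 1).
Proof.
case: k => [n|[|n]].
- have -> : Posz n + 1 = Posz n.+1 by rewrite -PoszD addn1.
  by rewrite /= big_nat_recr.
- by rewrite /= big_geq // big_nat1 oppr0 addNr.
- have -> : Negz n.+1 + 1 = Negz n by rewrite !NegzE -[n.+2]addn1 PoszD opprD addrNK.
  by rewrite /= [in RHS]big_nat_recr //= opprD NegzE addrNK.
Qed.

Lemma potentialB (R : realType) (a : int -> R) (j : int) (n : nat) :
  potential a (j + n%:Z) - potential a j
  = \sum_(1 <= i < n.+1) eps a (j + i%:Z).
Proof.
elim: n => [|n IH].
  by rewrite addr0 subrr big_geq.
rewrite big_nat_recr //= -IH -[n.+1]addn1 PoszD addrA potentialS.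
by rewrite [LHS]addrAC.
Qed.

Definition maxS (R : realType) (S : int -> R) (i j : int) : R :=
  sup [set S t | t in [set t | i <= t <= j]].

Definition minS (R : realType) (S : int -> R) (i j : int) : R :=
  inf [set S t | t in [set t | i <= t <= j]].

Record triplet := Triplet { lft : int; bot : int; rgt : int }.

Definition pre_valley (R : realType) (S : int -> R) (V : triplet) : Prop :=
  [/\ lft V <= bot V <= rgt V,
      S (lft V) = maxS S (lft V) (bot V),
      S (rgt V) = maxS S (bot V) (rgt V)
    & S (bot V) = minS S (lft V) (rgt V)].

Definition valley (R : realType) (S : int -> R) (V : triplet) : Prop :=
  pre_valley S V /\
  forall m, pre_valley S (Triplet (lft V) m (rgt V)) -> `|bot V| <= `|m|.

Definition depth (R : realType) (S : int -> R) (V : triplet) : R :=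
  Num.min (S (lft V) - S (bot V)) (S (rgt V) - S (bot V)).

(* Ties between pairs are broken by the smallest absolute value of the first
   (peak) component, then by that of the second. *)
Definition smallest_pair (A : set (int * int)) (q : int * int) : Prop :=
  A q /\ forall q', A q' ->
    `|q.1| < `|q'.1| \/ (`|q.1| = `|q'.1| /\ `|q.2| <= `|q'.2|).

(* pairs (M1, m1) with m <= M1 < m1 <= M'' achieving the largest drop *)
Definition right_drops (R : realType) (S : int -> R) (V : triplet) :
    set (int * int) :=
  [set q | (bot V <= q.1 /\ q.1 < q.2 <= rgt V) /\
    S q.1 - S q.2 =
      sup [set S t.1 - S t.2 | t in
            [set t : int * int | bot V <= t.1 /\ t.1 <= t.2 <= rgt V]]].

(* pairs (M1', m1') with M' <= m1' < M1' <= m achieving the largest rise *)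
Definition left_rises (R : realType) (S : int -> R) (V : triplet) :
    set (int * int) :=
  [set q | (lft V <= q.2 /\ q.2 < q.1 <= bot V) /\
    S q.1 - S q.2 =
      sup [set S t.1 - S t.2 | t in
            [set t : int * int | lft V <= t.2 /\ t.2 <= t.1 <= bot V]]].

(* [refinement S V W]: [W] is constructed inside [V] by one or more successive
   right or left refinements, keeping either of the two pieces each time. *)
Inductive refinement (R : realType) (S : int -> R) (V : triplet) :
    triplet -> Prop :=
| refine_right_inner q : smallest_pair (right_drops S V) q ->
    refinement S V (Triplet (lft V) (bot V) q.1)
| refine_right_outer q : smallest_pair (right_drops S V) q ->
    refinement S V (Triplet q.1 q.2 (rgt V))
| refine_left_inner q : smallest_pair (left_rises S V) q ->
    refinement S V (Triplet q.1 (bot V) (rgt V))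
| refine_left_outer q : smallest_pair (left_rises S V) q ->
    refinement S V (Triplet (lft V) q.2 q.1)
| refine_trans W Z : refinement S V W -> refinement S W Z -> refinement S V Z.

Section BasicValley.
Variables (R : realType) (gamma : R) (n : nat) (S : int -> R).

Definition deep_valley (V : triplet) : Prop :=
  [/\ valley S V,
      lft V <= 0 <= rgt V,
      Gamma gamma n <= depth S V,
      (bot V < 0 -> gamma * ilog R 2 n <= S (rgt V) - maxS S (bot V) 0)
    & (0 < bot V -> gamma * ilog R 2 n <= S (lft V) - maxS S 0 (bot V))].

Definition smallest_deep_valley (V : triplet) : Prop :=
  deep_valley V /\ forall W, refinement S V W -> ~ deep_valley W.

Definition left_candidates (m : int) : set int :=
  [set l | [/\ l <= 0, l < m, Gamma gamma n <= S l - S m &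
    (0 < m -> gamma * ilog R 2 n <= S l - maxS S 0 m)]].

Definition right_candidates (m : int) : set int :=
  [set l | [/\ 0 <= l, m < l, Gamma gamma n <= S l - S m &
    (m < 0 -> gamma * ilog R 2 n <= S l - maxS S m 0)]].

(* The supremum and the infimum are taken in [int]; they do not exist for an
   empty set of candidates. *)
Definition basic_valley (B : triplet) : Prop :=
  [/\ exists M1 M2, smallest_deep_valley (Triplet M1 (bot B) M2),
      supremums (left_candidates (bot B)) (lft B)
    & infimums (right_candidates (bot B)) (rgt B)].

End BasicValley.

(* Main.v *)
Require Import Defs.
From HB Require Import structures.
From mathcomp Require Import all_boot all_order all_algebra.
From mathcomp Require Import all_classical all_reals all_analysis.
From mathcomp Require Import measurable_realfun.
From mathcomp Require Import ring lra zify.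
Set Implicit Arguments.
Unset Strict Implicit.
Unset Printing Implicit Defensive.
Import Order.TTheory GRing.Theory Num.Theory.
Import numFieldNormedType.Exports.
Local Open Scope classical_set_scope.
Local Open Scope ring_scope.

(* Let S be the potential.  The chain is reversible for the weights exp(-S), and
   comparing its occupation recursion with explicit supersolutions bounds the
   expected time spent outside F_p(n) before n by n times the sum over the
   valley outside F_p(n) of exp(S(m_n) - S), plus the time needed to reach m_n,
   which is governed by the largest climb met on the way.  Both are at most
   n / f_p(n) as soon as S >= S(m_n) + 5 log_2 n on the valley outside F_p(n),
   every climb between 0 and m_n is below log n - 8 log_2 n, and the valley has
   width O((log n)^2 log_(p+1) n).  Markov's inequality then gives the quenched
   estimate.

   The bad environments are estimated by optional stopping for the potential,
   whose increments are bounded, centred and independent.  With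
   x = log_p n, the path seen from a site must reach log n + gamma log_2 n on
   both sides without becoming negative, which costs O(1 / (log n)^2), and come
   below 5 log_2 n again after f_p(n) steps on one of them, which costs a further
   factor x^(-2/3).  The left and right paths are independent, and the union over
   the O((log n)^2 log_(p+1) n) sites of the valley gives
   O(x^(-2/3) log_(p+1) n) = o(R_p(n)). *)

(** * Independence of blocks of increments *)

(** The bottom m_n depends on the whole environment, so nothing is conditioned on it: the bad
    configurations are stated at every fixed site of a deterministic window, where the two one-sided
    paths use disjoint increments, and a deterministic argument shows that m_n, or the foot of a
    large climb on the way to it, would be such a site. Since F_p(n) sees the basic valley only
    through m_n, everything is done on the smallest deep valley. The obstacle is that minimality
    under refinement excludes a large climb only if condition (3) survives in the piece containing
    0. It can fail there only when the barriers on the two sides of 0 nearly agree, an event of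
    probability O(log_2 n / log n). The exponent 2/3 comes from an intermediate height r: a path
    that is low after f_p(n) steps either stayed below r all that time or came back from r, at
    relative costs r^2 / f_p(n) and log_2 n / r. The choice r = x^(2/3) log_2 n makes both x^(-2/3).
    As the total is o(R_p(n)), n_0 absorbs all constants and c = c_1 = 1. *)

Section Expectation.
Context d (T : measurableType d) (R : realType) (Q : probability T R).
Implicit Types (f g : T -> R) (A : set T).

Definition bounded_measurable f :=
  measurable_fun setT f /\ exists M : R, forall w, `|f w| <= M.

Definition mean f : R := \int[Q]_w f w.

Lemma bmI f : bounded_measurable f -> Q.-integrable setT (EFin \o f).
Proof.
move=> [mf [M fM]]; apply: measurable_bounded_integrable => //.
  by have := probability_setT Q; rewrite /= => ->; rewrite ltry.
exists M; split; first by rewrite num_real.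
move=> x Mx w _; exact: le_trans (fM w) (ltW Mx).
Qed.

Lemma bmD f g : bounded_measurable f -> bounded_measurable g ->
  bounded_measurable (fun w => f w + g w).
Proof.
move=> [mf [M fM]] [mg [N gN]]; split; first exact: measurable_funD.
by exists (M + N) => w; rewrite (le_trans (ler_normD _ _)) ?lerD.
Qed.

Lemma bmM f g : bounded_measurable f -> bounded_measurable g ->
  bounded_measurable (fun w => f w * g w).
Proof.
move=> [mf [M fM]] [mg [N gN]]; split; first exact: measurable_funM.
by exists (M * N) => w; rewrite normrM ler_pM.
Qed.

Lemma bm_cst c : bounded_measurable (fun _ => c).
Proof. by split; [exact: measurable_cst|exists `|c|]. Qed.

Lemma bm_indic A : measurable A -> bounded_measurable (\1_A : T -> R).
Proof.
move=> mA; split; first exact: measurable_indic.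
by exists 1 => w; rewrite indicE; case: (_ \in _); rewrite ?normr1 ?normr0.
Qed.

Lemma meanD f g : bounded_measurable f -> bounded_measurable g ->
  mean (fun w => f w + g w) = mean f + mean g.
Proof. by move=> bf bg; rewrite /mean RintegralD //; exact: bmI. Qed.

Lemma meanZ c f : bounded_measurable f -> mean (fun w => c * f w) = c * mean f.
Proof. by move=> bf; rewrite /mean RintegralZl //; exact: bmI. Qed.

Lemma mean_cst c : mean (fun _ => c) = c.
Proof. by rewrite /mean Rintegral_cst //= probability_setT mulr1. Qed.

Lemma ler_mean f g : bounded_measurable f -> bounded_measurable g ->
  (forall w, f w <= g w) -> mean f <= mean g.
Proof. by move=> bf bg fg; apply: le_Rintegral => //; exact: bmI. Qed.

Definition pr A : R := fine (Q A).

Lemma prE A : measurable A -> Q A = (pr A)%:E.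
Proof.
by move=> mA; rewrite /pr fineK // fin_num_measure.
Qed.

Lemma pr_ge0 A : 0 <= pr A. Proof. exact/fine_ge0/measure_ge0. Qed.

Lemma pr_le1 A : measurable A -> pr A <= 1.
Proof. by move=> mA; rewrite -lee_fin -prE // probability_le1. Qed.

Lemma le_pr A B : measurable A -> measurable B -> A `<=` B -> pr A <= pr B.
Proof.
by move=> mA mB AB; rewrite -lee_fin -!prE // le_measure // inE.
Qed.

Lemma mean_indic A : measurable A -> mean (\1_A : T -> R) = pr A.
Proof. by move=> mA; rewrite /mean /Rintegral integral_indic // setIT. Qed.

Lemma prU A B : measurable A -> measurable B -> pr (A `|` B) <= pr A + pr B.
Proof.
move=> mA mB; rewrite -lee_fin EFinD -!prE //; first exact: measureU2.
exact: measurableU.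
Qed.

Lemma prC A : measurable A -> pr (~` A) = 1 - pr A.
Proof.
move=> mA; apply: EFin_inj; rewrite EFinB -!prE ?probability_setC //.
exact: measurableC.
Qed.

(** Countable subadditivity with a uniform bound on the partial sums, so that later series estimates
    stay in [R]. *)
Lemma pr_bigcup (F : nat -> set T) (p : nat -> R) (c : R) :
  (forall k, measurable (F k)) -> (forall k, pr (F k) <= p k) ->
  (forall n, \sum_(k < n) p k <= c) -> pr (\bigcup_k F k) <= c.
Proof.
move=> mF Fp pc.
have mU : measurable (\bigcup_k F k) by exact: bigcup_measurable.
rewrite -lee_fin -prE //.
apply: (le_trans (@measure_sigma_subadditive _ _ _ Q _ _ mF mU (fun _ h => h))).
apply: lime_le.
  by apply: is_cvg_nneseries => n _ _; exact: measure_ge0.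
near=> n; rewrite big_mkord.
rewrite (eq_bigr (fun k : 'I_n => (pr (F k))%:E)) => [|i _]; last exact: prE.
rewrite sumEFin lee_fin (le_trans _ (pc n)) //.
by apply: ler_sum => i _; exact: Fp.
Unshelve. all: by end_near. Qed.

Lemma pr_bigcup_disj (F : nat -> set T) n :
  (forall k, measurable (F k)) -> trivIset setT F ->
  \sum_(k < n) pr (F k) <= pr (\bigcup_k F k).
Proof.
move=> mF tF.
have mU : measurable (\big[setU/set0]_(k < n) F k).
  by apply: bigsetU_measurable => k _.
apply: (@le_trans _ _ (pr (\big[setU/set0]_(k < n) F k))); last first.
  apply: le_pr => //; first exact: bigcup_measurable.
  exact: bigsetU_bigcup.
rewrite -lee_fin -prE // measure_bigsetU //.
by rewrite -sumEFin; apply: lee_sum => k _; rewrite -prE.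
Qed.

End Expectation.

Section Independence.
Context d (T : measurableType d) (R : realType) (Q : probability T R).
Variable e : int -> T -> R.
Hypothesis me : forall i, measurable_fun setT (e i).
Hypothesis eI : independent_family Q e.

(** A pi-system in the shape handled by [independent_family]: a duplicate-free list of coordinates
    in [J] and one Borel set per coordinate. *)
Definition cylinders (J : set int) : set (set T) :=
  [set A | exists (s : seq int) (B : int -> set R),
     [/\ uniq s, forall i, i \in s -> J i, forall i, measurable (B i) &
         A = [set w | forall i, i \in s -> B i (e i w)]]].

(** The sigma-algebra generated by the coordinates in [J], carried as a measurable type: dependence
    on these coordinates only becomes ordinary measurability. *)
Definition info (J : set int) := g_sigma_algebraType (cylinders J).

Notation "J .-event" := (measurable : set (set (info J))) (at level 2).

Lemma measurable_cyl (s : seq int) (B : int -> set R) : (forall i, measurable (B i)) ->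
  measurable [set w | forall i, i \in s -> B i (e i w)].
Proof.
move=> mB.
have -> : [set w | forall i, i \in s -> B i (e i w)] =
  \bigcap_(i in [set i | i \in s]) (e i @^-1` B i).
  by apply/seteqP; split => w /= h i; apply: h.
apply: fin_bigcap_measurable; first exact: finite_seq.
by move=> i _; rewrite -[X in measurable X]setTI; apply: me.
Qed.

Lemma cylinders_setI J : setI_closed (cylinders J).
Proof.
move=> _ _ [s [B [us sJ mB ->]]] [s' [B' [us' sJ' mB' ->]]].
exists (undup (s ++ s')), (fun i => (if i \in s then B i else setT) `&`
                       (if i \in s' then B' i else setT)); split.
- exact: undup_uniq.
- by move=> i; rewrite mem_undup mem_cat => /orP[/sJ|/sJ'].
- by move=> i; apply: measurableI; case: ifP.
- apply/seteqP; split => w /=.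
    move=> [h h'] i; rewrite mem_undup mem_cat => _; split; case: ifP => //.
      exact: h.
    exact: h'.
  move=> h; split => i si; have := h i; rewrite mem_undup mem_cat si ?orbT //=.
    by move=> /(_ isT) [].
  by move=> /(_ isT) [].
Qed.

Lemma info_sub J J' : J `<=` J' -> J.-event `<=` J'.-event.
Proof.
move=> JJ'; apply: sub_smallest2r.
- exact: smallest_sigma_algebra.
- move=> A [s [B [us sJ mB ->]]]; exists s, B; split => // i /sJ; exact: JJ'.
Qed.

Lemma info_measurable J : J.-event `<=` @measurable _ T.
Proof.
apply: smallest_sub; first exact: sigma_algebra_measurable.
move=> A [s [B [us sJ mB ->]]]; exact: measurable_cyl.
Qed.

Lemma info_coord (J : set int) i : J i ->
  measurable_fun (setT : set (info J)) (e i).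
Proof.
move=> Ji _ B mB; rewrite setTI; apply: sub_sigma_algebra.
exists [:: i], (fun _ => B); split => //.
- by move=> j; rewrite inE => /eqP ->.
- apply/seteqP; split => w /= h; first by move=> j; rewrite inE => /eqP ->.
  by apply: h; rewrite inE.
Qed.

Lemma cylinders_indep J J' A B : J `&` J' = set0 -> cylinders J A ->
  cylinders J' B -> (Q (A `&` B) = Q A * Q B)%E.
Proof.
move=> JJ' [s [C [us sJ mC ->]]] [s' [C' [us' sJ' mC' ->]]].
have dis i : i \in s -> i \notin s'.
  move=> /sJ Ji; apply/negP => /sJ' Ji'.
  by have : (J `&` J') i by []; rewrite JJ'.
rewrite !eI //.
pose D i := if i \in s then C i else C' i.
have -> : [set w | forall i, i \in s -> C i (e i w)] `&`
          [set w | forall i, i \in s' -> C' i (e i w)] =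
   [set w | forall i, i \in s ++ s' -> D i (e i w)].
  apply/seteqP; split => w /=.
    move=> [h h'] i; rewrite mem_cat /D; case: ifP => /= [si _|_]; first exact: h.
    exact: h'.
  move=> h; split => i si; have := h i; rewrite mem_cat si ?orbT /D.
    by rewrite si => /(_ isT).
  case: ifP => [/dis|_ /(_ isT) //]; by rewrite si.
rewrite eI.
- rewrite big_cat /=; congr (_ * _)%E; rewrite !big_seq; apply: eq_bigr => i si.
    by rewrite /D si.
  rewrite /D; case: ifP => // /dis; by rewrite si.
- rewrite cat_uniq us us' andbT /=; apply/hasPn => i si'.
  by apply/negP => /dis; rewrite si'.
- by move=> i; rewrite /D; case: ifP.
Qed.

(** The events independent of a fixed [B] form a lambda-system; both passes of the pi-lambda
    argument in [info_indep] rest on this. *)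
Lemma dynkin_indep (B : set T) : measurable B ->
  dynkin [set A | measurable A /\ (Q (A `&` B) = Q A * Q B)%E].
Proof.
move=> mB; split => /=.
- by split => //; rewrite setTI probability_setT mul1e.
- move=> A [mA AB]; split; first exact: measurableC.
  rewrite setIC -setDE measureD //; last by rewrite ltey_eq fin_num_measure.
  transitivity (Q B - Q A * Q B)%E; first by rewrite setIC -AB.
  rewrite probability_setC //.
  by rewrite !prE // -EFinM -!EFinB -EFinM; congr EFin; ring.
- move=> F tF FB; split; first by apply: bigcup_measurable => k _; exact: (FB k).1.
  rewrite setI_bigcupl.
  have mF k := (FB k).1.
  rewrite !measure_semi_bigcup //; last first.
    by apply: bigcup_measurable => k _; apply: measurableI.
  + exact: trivIset_setIr.
  + by move=> k; exact: measurableI.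
  + exact: bigcup_measurable.
  + rewrite (prE Q mB) muleC -nneseriesZl //.
    apply: eq_eseriesr => k _; have [_ E] := FB k.
    by rewrite -prE // muleC; exact: E.
Qed.

Lemma info_indep J J' A B : J `&` J' = set0 -> J.-event A -> J'.-event B ->
  (Q (A `&` B) = Q A * Q B)%E.
Proof.
move=> JJ'.
(* First pass: the second event is still a cylinder. The second pass removes this restriction by
   exchanging the roles of the two events. *)
have cylI I I' C D : I `&` I' = set0 -> I.-event C -> cylinders I' D ->
    (Q (C `&` D) = Q C * Q D)%E.
  move=> II' mC cD.
  have mD : measurable D by case: cD => s [E [us sJ mE ->]]; exact: measurable_cyl.
  have : <<d cylinders I >> C.
    by rewrite setI_closed_g_dynkin_g_sigma_algebra //; exact: cylinders_setI.
  move=> /(_ [set A | measurable A /\ (Q (A `&` D) = Q A * Q D)%E]) [] //.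
  split; first exact: dynkin_indep.
  move=> E cE; split; last exact: (cylinders_indep II').
  by case: cE => s [F [us sJ mF ->]]; exact: measurable_cyl.
move=> mA mB; have mA' := info_measurable mA.
have : <<d cylinders J' >> B.
  by rewrite setI_closed_g_dynkin_g_sigma_algebra //; exact: cylinders_setI.
move=> /(_ [set B : set T | @measurable _ T B /\ (Q (B `&` A) = Q B * Q A)%E]) [].
  split; first exact: dynkin_indep.
  move=> E cE; split.
    by case: cE => s [F [us sJ mF ->]]; exact: measurable_cyl.
  by rewrite setIC muleC; apply: (cylI J J').
by move=> _; rewrite setIC muleC.
Qed.

Lemma info_pr J J' A B : J `&` J' = set0 -> J.-event A -> J'.-event B ->
  pr Q (A `&` B) = pr Q A * pr Q B.
Proof.
move=> JJ' mA mB; apply: EFin_inj; rewrite EFinM -!prE; last 3 first.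
- exact: info_measurable mB.
- exact: info_measurable mA.
- by apply: measurableI; [exact: info_measurable mA|exact: info_measurable mB].
exact: info_indep JJ' mA mB.
Qed.

Lemma info_meas J f : measurable_fun (setT : set (info J)) f ->
  measurable_fun (setT : set T) (f : T -> R).
Proof.
by move=> mf _ B mB; apply: info_measurable; exact: mf measurableT _ mB.
Qed.

(** The term of index [k] tests whether (k+1)/N lies below [x], so the sum is the integer part of
    [N x]; [M * N] levels exhaust the range [0, M]. *)
Lemma layers (M N : nat) (x : R) : (0 < N)%N -> 0 <= x <= M%:R ->
  0 <= x - N%:R^-1 * \sum_(k < M * N) ((k.+1%:R <= N%:R * x)%R)%:R <= N%:R^-1.
Proof.
move=> N0 /andP[x0 xM]; set y := _ * \sum_(k < _) _.
have NR0 : 0 < N%:R :> R by rewrite ltr0n.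
have Nx0 : 0 <= N%:R * x by rewrite mulr_ge0.
have /andP[q1 q2] := truncn_itv Nx0.
set q := Num.truncn _ in q1 q2.
have -> : y = N%:R^-1 * q%:R.
  congr (_ * _).
  have qMN : (q <= M * N)%N.
    rewrite -(ler_nat R) (le_trans q1) // natrM mulrC ler_pM2r //.
  rewrite (eq_bigr (fun k : 'I_(M * N) => ((k < q)%N)%:R)) => [|k _].
    rewrite -natr_sum; congr (_%:R).
    rewrite -(big_mkord xpredT (fun k => nat_of_bool (k < q)%N)).
    rewrite (big_cat_nat _ qMN) //= [X in (_ + X)%N]big_nat_cond.
    rewrite [X in (_ + X)%N]big1 => [|i]; last first.
      by rewrite andbT => /andP[qi _]; rewrite ltnNge qi.
    rewrite addn0 big_nat_cond (eq_bigr (fun=> 1%N)) => [|i].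
      by rewrite -big_nat_cond sum_nat_const_nat muln1 subn0.
    by rewrite andbT => /andP[_ ->].
  congr (nat_of_bool _)%:R; apply/idP/idP => h.
    by rewrite -ltnS -(ltr_nat R) (le_lt_trans h).
  by rewrite (le_trans _ q1) // ler_nat.
have -> : x = N%:R^-1 * (N%:R * x) by rewrite mulKf // gt_eqF.
rewrite -mulrBr; apply/andP; split.
  by rewrite mulr_ge0 ?invr_ge0 ?(ltW NR0) // subr_ge0.
rewrite ler_piMr ?invr_ge0 ?(ltW NR0) // lerBlDr addrC natr1.
exact: ltW.
Qed.

Lemma mean_abs_le f c : bounded_measurable f -> (forall w, `|f w| <= c) ->
  `|mean Q f| <= c.
Proof.
move=> bf fc; rewrite ler_norml -(mean_cst Q (- c)) -{2}(mean_cst Q c).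
apply/andP; split; apply: ler_mean => //; try exact: bm_cst;
  by move=> w; have := fc w; rewrite ler_norml => /andP[].
Qed.

(* A bounded function is uniformly approximated by averages of indicators of
   its superlevel sets, so it suffices to know the product rule for those. *)
Lemma mean_prod_layers (f g : T -> R) :
  bounded_measurable f -> bounded_measurable g ->
  (forall c, mean Q (fun w => \1_[set w | c <= f w] w * g w)
             = pr Q [set w | c <= f w] * mean Q g) ->
  mean Q (fun w => f w * g w) = mean Q f * mean Q g.
Proof.
move=> bf bg fg.
have ml c : measurable [set w | c <= f w].
  have [mf _] := bf.
  rewrite -[X in measurable X]setTI.
  have -> : [set w | c <= f w] = f @^-1` `[c, +oo[%classic.
    by apply/seteqP; split => w /=; rewrite in_itv /= andbT.
  exact: mf.
have [mf [M0 fM0]] := bf; have [mg [C gC]] := bg.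
pose M := (Num.truncn M0).+1.
have fM w : `|f w| <= M%:R.
  by rewrite (le_trans (fM0 w)) // /M ltW // truncnS_gt.
have C0 : 0 <= C by rewrite (le_trans _ (gC point)).
(* Adding [M] moves the range of [f] into [0, 2M], where [layers] applies; [M] is subtracted again
   after truncation. *)
pose h (N : nat) w : R := N%:R^-1 * \sum_(k < (M + M) * N)
  ((k.+1%:R <= N%:R * (f w + M%:R))%R)%:R - M%:R.
pose A N k := [set w | k.+1%:R / N%:R - M%:R <= f w].
have hE N : (0 < N)%N -> h N = fun w =>
     N%:R^-1 * \sum_(k < (M + M) * N) (\1_(A N k) w : R) - M%:R.
  move=> N0; apply/funext => w; congr (_ * _ - _); apply: eq_bigr => k _.
  rewrite indicE; congr (nat_of_bool _)%:R.
  have -> : (k.+1%:R <= N%:R * (f w + M%:R)) = (k.+1%:R / N%:R - M%:R <= f w).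
    by rewrite lerBlDr ler_pdivrMr ?ltr0n // mulrC.
  by apply/idP/idP => [?|]; [exact: mem_set|rewrite inE].
have bS (P : nat -> T -> R) n : (forall k, bounded_measurable (P k)) ->
   bounded_measurable (fun w => \sum_(k < n) P k w).
  move=> bP; elim: n => [|n IH].
    by under eq_fun do rewrite big_ord0; exact: bm_cst.
  by under eq_fun do rewrite big_ord_recr /=; apply: bmD.
have mS (P : nat -> T -> R) n : (forall k, bounded_measurable (P k)) ->
   mean Q (fun w => \sum_(k < n) P k w) = \sum_(k < n) mean Q (P k).
  move=> bP; elim: n => [|n IH].
    by under eq_fun do rewrite big_ord0; rewrite mean_cst big_ord0.
  under eq_fun do rewrite big_ord_recr /=.
  by rewrite big_ord_recr /= -IH meanD //; exact: bS.
have bh N : (0 < N)%N -> bounded_measurable (h N).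
  move=> N0; rewrite hE //; apply: bmD; last exact: bm_cst.
  apply: bmM; first exact: bm_cst.
  by apply: (bS (fun k => \1_(A N k))) => k; apply: bm_indic; exact: ml.
have hg N : (0 < N)%N -> mean Q (fun w => h N w * g w) = mean Q (h N) * mean Q g.
  move=> N0; rewrite hE //.
  have bA k : bounded_measurable (\1_(A N k) : T -> R).
    by apply: bm_indic; exact: ml.
  have bAg k : bounded_measurable (fun w => (\1_(A N k) w : R) * g w).
    by apply: bmM.
  under eq_fun => w.
    rewrite mulrBl -mulrA mulr_suml -mulNr.
    over.
  rewrite meanD; last 2 first.
  - by apply: bmM; [exact: bm_cst|exact: (bS (fun k w => \1_(A N k) w * g w))].
  - by apply: bmM; [exact: bm_cst|].
  rewrite meanZ; last exact: (bS (fun k w => \1_(A N k) w * g w)).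
  rewrite meanZ // (mS (fun k w => \1_(A N k) w * g w)) //.
  rewrite meanD; last 2 first.
  - by apply: bmM; [exact: bm_cst|exact: (bS (fun k => \1_(A N k)))].
  - exact: bm_cst.
  rewrite meanZ; last exact: (bS (fun k => \1_(A N k))).
  rewrite mean_cst (mS (fun k => \1_(A N k))) // mulrDl -mulrA mulr_suml.
  congr (_ * _ + _); apply: eq_bigr => k _.
  by rewrite fg mean_indic //; exact: ml.
have err N : (0 < N)%N ->
    `|mean Q (fun w => f w * g w) - mean Q f * mean Q g| <= N%:R^-1 * (C + C).
  move=> N0.
  have hN w : `|f w - h N w| <= N%:R^-1.
    have := @layers (M + M) N (f w + M%:R) N0.
    have := fM w; rewrite ler_norml => /andP[f1 f2].
    case/(_ _)/andP => [|u v].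
      by rewrite natrD lerD2r f2 andbT -lerBlDr sub0r.
    by rewrite /h opprB addrCA addrA [M%:R + _]addrC ger0_norm.
  have bfh : bounded_measurable (fun w => f w - h N w).
    apply: bmD => //; under eq_fun do rewrite -mulN1r.
    by apply: bmM; [exact: bm_cst|exact: bh].
  have E1 : mean Q (fun w => f w * g w) =
     mean Q (fun w => (f w - h N w) * g w) + mean Q (fun w => h N w * g w).
    rewrite -(meanD Q (bmM bfh bg) (bmM (bh N N0) bg)).
    by congr mean; apply/funext => w; rewrite -mulrDl subrK.
  have E2 : mean Q f = mean Q (fun w => f w - h N w) + mean Q (h N).
    rewrite -(meanD Q bfh (bh N N0)).
    by congr mean; apply/funext => w; rewrite subrK.
  rewrite E1 E2 hg // mulrDl opprD addrACA subrr addr0.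
  rewrite (le_trans (ler_normB _ _)) // mulrDr lerD //.
    apply: mean_abs_le; first exact: bmM.
    by move=> w; rewrite normrM ler_pM.
  rewrite normrM ler_pM //; exact: mean_abs_le.
apply/eqP; rewrite -subr_eq0 -normr_le0.
apply/ler_addgt0Pl => eps0 eps0_gt0; rewrite addr0.
pose N := (Num.truncn ((C + C) / eps0)).+1.
apply: (le_trans (err N isT)).
rewrite mulrC ler_pdivrMr ?ltr0n // -ler_pdivrMl // mulrC ltW //.
exact: truncnS_gt.
Qed.

(** Two uses of [mean_prod_layers], one per function, reduce the identity to superlevel sets, for
    which it is [info_pr]. *)
Lemma info_mean J J' (f g : T -> R) : J `&` J' = set0 ->
  measurable_fun (setT : set (info J)) f ->
  measurable_fun (setT : set (info J')) g ->
  bounded_measurable f -> bounded_measurable g ->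
  mean Q (fun w => f w * g w) = mean Q f * mean Q g.
Proof.
move=> JJ' mf mg bf bg.
have lev I h c : measurable_fun (setT : set (info I)) (h : T -> R) ->
    I.-event [set w | c <= h w].
  move=> mh.
  have -> : [set w | c <= h w] = h @^-1` `[c, +oo[%classic.
    by apply/seteqP; split => w /=; rewrite in_itv /= andbT.
  by rewrite -[X in measurable X]setTI; exact: mh.
apply: mean_prod_layers => // c.
have mA := lev J f c mf; set A := [set w | _] in mA *.
have mA' := info_measurable mA.
under eq_fun do rewrite mulrC.
rewrite mean_prod_layers //; first by rewrite mean_indic // mulrC.
  exact: bm_indic.
move=> c'; have mB := lev J' g c' mg.
set B := [set w | _] in mB *.
have mB' := info_measurable mB.
have -> : (fun w => \1_B w * \1_A w) = \1_(A `&` B) :> (T -> R).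
  by apply/funext => w; rewrite setIC indicI.
rewrite !mean_indic //; last exact: measurableI.
by rewrite mulrC (info_pr JJ' mA mB).
Qed.

End Independence.

(** * Exit estimates for sums of bounded centred increments *)

Section MeasurablePredicates.
Context d (X : measurableType d) (R : realType).

Lemma meas_ex (P : nat -> X -> Prop) :
  (forall k, measurable [set w | P k w]) -> measurable [set w | exists k, P k w].
Proof.
move=> mP; have -> : [set w | exists k, P k w] = \bigcup_k [set w | P k w].
  by apply/seteqP; split => w /= [k]; [exists k|move=> _; exists k].
exact: bigcup_measurable.
Qed.

Lemma meas_all (P : nat -> X -> Prop) :
  (forall k, measurable [set w | P k w]) -> measurable [set w | forall k, P k w].
Proof.
move=> mP; have -> : [set w | forall k, P k w] = \bigcap_k [set w | P k w].
  by apply/seteqP; split => w /= h k; [move=> _; apply: h|apply: (h k)].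
exact: bigcapT_measurable.
Qed.

Lemma meas_and (P P' : X -> Prop) : measurable [set w | P w] ->
  measurable [set w | P' w] -> measurable [set w | P w /\ P' w].
Proof. exact: measurableI. Qed.

Lemma meas_imp (c : bool) (P : X -> Prop) : measurable [set w | P w] ->
  measurable [set w | c -> P w].
Proof.
case: c => mP.
  have -> : [set w | true -> P w] = [set w | P w].
    by apply/seteqP; split => w /= h; [apply: h|].
  exact: mP.
have -> : [set w : X | false -> P w] = setT by apply/seteqP; split.
exact: measurableT.
Qed.

Lemma meas_const (c : Prop) : measurable [set w : X | c].
Proof.
have [cT|cF] := pselect c.
  have -> : [set w : X | c] = setT by apply/seteqP; split.
  exact: measurableT.
have -> : [set w : X | c] = set0 by apply/seteqP; split.
exact: measurable0.
Qed.

Variables (f : X -> R) (c : R).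
Hypothesis mf : measurable_fun setT f.

Lemma meas_ge : measurable [set w | c <= f w].
Proof.
have -> : [set w | c <= f w] = setT `&` f @^-1` `[c, +oo[%classic.
  by rewrite setTI; apply/seteqP; split => w /=; rewrite in_itv /= andbT.
exact: mf.
Qed.

Lemma meas_le : measurable [set w | f w <= c].
Proof.
have -> : [set w | f w <= c] = setT `&` f @^-1` `]-oo, c]%classic.
  by rewrite setTI; apply/seteqP; split => w /=; rewrite in_itv.
exact: mf.
Qed.

Lemma meas_lt : measurable [set w | f w < c].
Proof.
have -> : [set w | f w < c] = setT `&` f @^-1` `]-oo, c[%classic.
  by rewrite setTI; apply/seteqP; split => w /=; rewrite in_itv.
exact: mf.
Qed.

End MeasurablePredicates.

Section PathPredicates.
Context (R : realType).
Implicit Types (Z : nat -> R) (u l s h x y d : R).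

(** This and the following predicates concern deterministic paths, so that one event can be read on
    the potential seen from a site, in either direction, and on a random walk. *)
Definition reach_by N u l Z :=
  exists k, [/\ (k <= N)%N, u <= Z k & forall j, (j <= k)%N -> - l <= Z j].

Definition reach u l Z := exists k, u <= Z k /\ forall j, (j <= k)%N -> - l <= Z j.

(** The obstruction to localisation, seen from a valley bottom: more than [f] steps away the path is
    still, or again, at height at most [s]. *)
Definition dip (f : nat) s h Z := exists k t,
  [/\ (f < k)%N, (k <= t)%N, Z k <= s, h <= Z t & forall j, (j <= t)%N -> 0 <= Z j].

(** A large climb on the way to a deeper point, seen from its foot: the path gains [h1] and later
    falls back to its starting level without having attained [h]. *)
Definition relapse h1 h Z := exists k t, [/\ (k <= t)%N, h1 <= Z k,
  forall j, (j <= k)%N -> 0 <= Z j, Z t <= 0 & forall j, (j <= t)%N -> Z j < h].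

(** One side of a tie: a barrier of height at least [x] and below [y], with a bottom of height at
    most [d] behind it. *)
Definition plunge x y d Z := exists k t,
  [/\ (k <= t)%N, x <= Z k, Z t <= d & forall j, (j <= t)%N -> Z j < y].

(** Applied to a path and to its negative, it bounds the length of an interval that contains no rise
    of size [h]. *)
Definition climbs h (N : nat) Z := exists i j,
  [/\ (i <= j)%N, (j <= N)%N & h <= Z j - Z i].

Definition level h Z := exists t, h <= Z t.

Context disp (X : measurableType disp) (W : nat -> X -> R).
Hypothesis mW : forall t, measurable_fun setT (W t).

Lemma meas_bnd (P : nat -> X -> Prop) k : (forall j, measurable [set w | P j w]) ->
  measurable [set w | forall j, (j <= k)%N -> P j w].
Proof. by move=> mP; apply: meas_all => j; apply: meas_imp. Qed.

Lemma meas_reach_by N u l : measurable [set w | reach_by N u l (W ^~ w)].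
Proof.
apply: meas_ex => k.
have -> : [set w | [/\ (k <= N)%N, u <= W k w & forall j, (j <= k)%N -> - l <= W j w]]
  = [set w | (k <= N)%N /\ (u <= W k w /\ forall j, (j <= k)%N -> - l <= W j w)].
  by apply/seteqP; split => w /= [] // ? [].
apply: meas_and; first exact: meas_const.
by apply: meas_and; [exact: meas_ge|apply: meas_bnd => j; exact: meas_ge].
Qed.

Lemma meas_reach u l : measurable [set w | reach u l (W ^~ w)].
Proof.
apply: meas_ex => k; apply: meas_and; first exact: meas_ge.
by apply: meas_bnd => j; exact: meas_ge.
Qed.

Lemma meas_dip f s h : measurable [set w | dip f s h (W ^~ w)].
Proof.
apply: meas_ex => k; apply: meas_ex => t.
rewrite (_ : [set w | _] = [set w | (f < k)%N /\ ((k <= t)%N /\ (W k w <= s /\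
  (h <= W t w /\ forall j, (j <= t)%N -> 0 <= W j w)))]); last first.
  by apply/seteqP; split => w /= [] // ? [] ? [] ? [].
do 2 (apply: meas_and; first exact: meas_const).
apply: meas_and; first exact: meas_le.
by apply: meas_and; [exact: meas_ge|apply: meas_bnd => j; exact: meas_ge].
Qed.

Lemma meas_relapse h1 h : measurable [set w | relapse h1 h (W ^~ w)].
Proof.
apply: meas_ex => k; apply: meas_ex => t.
rewrite (_ : [set w | _] = [set w | (k <= t)%N /\ (h1 <= W k w /\
  ((forall j, (j <= k)%N -> 0 <= W j w) /\ (W t w <= 0 /\
    forall j, (j <= t)%N -> W j w < h)))]); last first.
  by apply/seteqP; split => w /= [] // ? [] ? [] ? [].
apply: meas_and; first exact: meas_const.
apply: meas_and; first exact: meas_ge.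
apply: meas_and; first by apply: meas_bnd => j; exact: meas_ge.
by apply: meas_and; [exact: meas_le|apply: meas_bnd => j; exact: meas_lt].
Qed.

Lemma meas_plunge x y d : measurable [set w | plunge x y d (W ^~ w)].
Proof.
apply: meas_ex => k; apply: meas_ex => t.
rewrite (_ : [set w | _] = [set w | (k <= t)%N /\ (x <= W k w /\
   (W t w <= d /\ forall j, (j <= t)%N -> W j w < y))]); last first.
  by apply/seteqP; split => w /= [] // ? [] ? [].
apply: meas_and; first exact: meas_const.
apply: meas_and; first exact: meas_ge.
by apply: meas_and; [exact: meas_le|apply: meas_bnd => j; exact: meas_lt].
Qed.

Lemma meas_climbs h N : measurable [set w | climbs h N (W ^~ w)].
Proof.
apply: meas_ex => i; apply: meas_ex => j.
rewrite (_ : [set w | _] =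
  [set w | (i <= j)%N /\ ((j <= N)%N /\ h <= W j w - W i w)]); last first.
  by apply/seteqP; split => w /= [] // ? [].
do 2 (apply: meas_and; first exact: meas_const).
by apply: meas_ge; apply: measurable_funB.
Qed.

Lemma meas_level h : measurable [set w | level h (W ^~ w)].
Proof. by apply: meas_ex => t; exact: meas_ge. Qed.

End PathPredicates.

Section WalkEstimates.
Context d (T : measurableType d) (R : realType) (Q : probability T R).
Variable e : int -> T -> R.
Hypothesis me : forall i, measurable_fun setT (e i).
Hypothesis eI : independent_family Q e.
Variables b s2 : R.
Hypothesis eb : forall i w, `|e i w| <= b.
Hypothesis e0 : forall i, mean Q (e i) = 0.
Hypothesis e2 : forall i, mean Q (fun w => e i w ^+ 2) = s2.
Hypothesis s2_gt0 : 0 < s2.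

Notation "J .-event" := (measurable : set (set (info e J))) (at level 2).

(* [io] enumerates the increments used, so that the path to the left of a site,
   read with [sg = -1], has the same form as the path to its right. *)
Definition walk (sg : R) (io : nat -> int) (t : nat) (w : T) : R :=
  \sum_(k < t) sg * e (io k) w.

Definition shift (io : nat -> int) t k := io (t + k)%N.

Definition past (io : nat -> int) (t : nat) : set int :=
  [set i | exists2 k, (k < t)%N & i = io k].

Lemma walk0 sg io w : walk sg io 0 w = 0.
Proof. by rewrite /walk big_ord0. Qed.

Lemma walkS sg io t w : walk sg io t.+1 w = walk sg io t w + sg * e (io t) w.
Proof. by rewrite /walk big_ord_recr. Qed.

Lemma walkD sg io t k w :
  walk sg io (t + k) w = walk sg io t w + walk sg (shift io t) k w.
Proof.
elim: k => [|k IH]; first by rewrite addn0 walk0 addr0.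
by rewrite addnS !walkS IH addrA.
Qed.

Lemma walkN sg io t w : walk (- sg) io t w = - walk sg io t w.
Proof. by rewrite /walk -sumrN; apply: eq_bigr => k _; rewrite mulNr. Qed.

Lemma measurable_walk J sg io t : (forall k, (k < t)%N -> J (io k)) ->
  measurable_fun (setT : set (info e J)) (walk sg io t).
Proof.
move=> Jio; apply: measurable_sum => k.
apply: measurable_funM; first exact: measurable_cst.
by apply: info_coord; apply: Jio.
Qed.

Lemma measurable_walk_range J sg io t : range io `<=` J ->
  measurable_fun (setT : set (info e J)) (walk sg io t).
Proof. by move=> sJ; apply: measurable_walk => k _; apply: sJ; exists k. Qed.

Lemma past_future io t : injective io -> past io t `&` range (shift io t) = set0.
Proof.
move=> inj; apply/seteqP; split => // i [[k kt ->] [j _ /inj]].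
by move=> E; move: kt; rewrite -E ltnNge leq_addr.
Qed.

Lemma shift_inj io t : injective io -> injective (shift io t).
Proof. by move=> inj j k /inj/addnI. Qed.

Lemma b_ge0 : 0 <= b.
Proof. by rewrite (le_trans _ (eb 0 point)). Qed.

Lemma bm_coord i : bounded_measurable (e i).
Proof. by split; [exact: me|exists b]. Qed.

Section Exit.
Variables (sg : R) (io : nat -> int) (lo up : R).
Hypothesis sg2 : sg ^+ 2 = 1.
Hypothesis io_inj : injective io.
Hypothesis lo0 : lo <= 0.
Hypothesis up0 : 0 < up.

Notation W := (walk sg io).

Definition alive t := [set w | forall j, (j <= t)%N -> lo <= W j w < up].

(** The stopped walk as a martingale transform: an increment counts only while the walk is still
    inside, and the indicator in front of it depends on earlier increments alone. *)
Definition stopped t w : R :=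
  \sum_(k < t) (\1_(alive k) w : R) * (sg * e (io k) w).

Lemma alive_event t : (past io t).-event (alive t).
Proof.
apply: meas_all => j /=.
case: (leqP j t) => jt; last first.
  rewrite (_ : mkset _ = setT); first exact: measurableT.
  by apply/seteqP; split.
have mW : measurable_fun (setT : set (info e (past io t))) (W j).
  by apply: measurable_walk => k kj; exists k => //; apply: leq_trans jt.
rewrite (_ : [set w | _] = [set w | lo <= W j w /\ W j w < up]); last first.
  apply/seteqP; split => w /= h; first by apply/andP; apply: h.
  by move=> _; apply/andP.
by apply: meas_and; [exact: meas_ge|exact: meas_lt].
Qed.

Lemma alive_meas t : measurable (alive t).
Proof. by apply: (info_measurable me); exact: alive_event. Qed.

Lemma past_sub t t' : (t <= t')%N -> past io t `<=` past io t'.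
Proof. by move=> tt' i [k kt ->]; exists k => //; exact: leq_trans tt'. Qed.

Lemma stopped_event J t : past io t `<=` J ->
  measurable_fun (setT : set (info e J)) (stopped t).
Proof.
move=> sJ; apply: measurable_sum => k; apply: measurable_funM.
  apply: measurable_indic; apply: (info_sub (J := past io k)); last exact: alive_event.
  by apply: subset_trans sJ; apply: past_sub; exact: ltnW.
apply: measurable_funM; first exact: measurable_cst.
by apply: info_coord; apply: sJ; exists k.
Qed.

Lemma stoppedS t w :
  stopped t.+1 w = stopped t w + \1_(alive t) w * (sg * e (io t) w).
Proof. by rewrite /stopped big_ord_recr. Qed.

(** [k] is the first exit time cut off at [t]; this identifies the transform with the walk stopped
    on leaving [lo, up). *)
Lemma stopped_exit t w : exists k, [/\ (k <= t)%N, stopped t w = W k w,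
  forall j, (j < k)%N -> lo <= W j w < up &
  (k < t)%N -> ~~ (lo <= W k w < up)].
Proof.
elim: t => [|t [k [kt sk ak nk]]].
  by exists 0%N; split => //; rewrite /stopped big_ord0 walk0.
rewrite stoppedS indicE.
have [At|At] := boolP (w \in alive t).
  move: (At); rewrite inE /= => At'.
  have kt' : k = t.
    apply/eqP; rewrite eqn_leq kt leqNgt; apply/negP => /nk.
    by rewrite At'.
  exists t.+1; split => //; first by rewrite mul1r sk kt' walkS.
  by rewrite ltnn.
rewrite mul0r addr0; exists k; split => //; first exact: leqW.
move=> _; move: kt; rewrite leq_eqVlt => /orP[/eqP kt|]; last exact: nk.
apply/negP => Wk; move/negP: At; apply; rewrite inE /= => j.
by rewrite leq_eqVlt => /orP[/eqP ->|]; rewrite -kt // => /ak.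
Qed.

(** The walk leaves the interval by at most one increment, hence the overshoot [b]. *)
Lemma stopped_bnd t w : lo - b <= stopped t w <= up + b.
Proof.
have [k [_ -> ak _]] := stopped_exit t w.
case: k ak => [|k] ak.
  have b0 := b_ge0; rewrite walk0.
  by have l0 := lo0; have u0 := up0; apply/andP; split; lra.
have /andP[h1 h2] := ak k (leqnn _).
have sgb : `|sg * e (io k) w| <= b.
  rewrite normrM (_ : `|sg| = 1) ?mul1r //.
  by apply/eqP; rewrite -sqrp_eq1 // -normrX sg2 normr1.
rewrite walkS; move: sgb; rewrite ler_norml => /andP[? ?].
by apply/andP; split; lra.
Qed.

Lemma bm_stopped t : bounded_measurable (stopped t).
Proof.
split; first exact: info_meas (@stopped_event setT t (@subsetT _ _)).
exists (up + b - (lo - b)) => w; have b0 := b_ge0; have l0 := lo0; have u0 := up0.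
by have /andP[? ?] := stopped_bnd t w; rewrite ler_norml; apply/andP; split; lra.
Qed.

Lemma bm_step t : bounded_measurable (fun w => sg * e (io t) w).
Proof. by apply: bmM; [exact: bm_cst|exact: bm_coord]. Qed.

Lemma past_next t : past io t `&` [set io t] = set0.
Proof.
apply/seteqP; split => // i [[k kt ->] /= /io_inj E].
by move: kt; rewrite E ltnn.
Qed.

Lemma next_event t : measurable_fun (setT : set (info e [set io t]))
  (fun w => sg * e (io t) w).
Proof. by apply: measurable_funM; [exact: measurable_cst|exact: info_coord]. Qed.

Lemma mean_step t : mean Q (fun w => sg * e (io t) w) = 0.
Proof. by rewrite meanZ ?e0 ?mulr0 //; exact: bm_coord. Qed.

(** Optional stopping: survival up to time [t] is decided by earlier increments, hence independent
    of the next one, which is centred. *)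
Lemma mean_stopped t : mean Q (stopped t) = 0.
Proof.
elim: t => [|t IH].
  rewrite (_ : stopped 0 = fun _ => 0) ?mean_cst //.
  by apply/funext => w; rewrite /stopped big_ord0.
have -> : stopped t.+1 = fun w => stopped t w + \1_(alive t) w * (sg * e (io t) w).
  by apply/funext => w; rewrite stoppedS.
have bA : bounded_measurable (\1_(alive t) : T -> R).
  exact: bm_indic (alive_meas t).
rewrite meanD; [|exact: bm_stopped|by apply: bmM; [|exact: bm_step]].
rewrite IH add0r (info_mean me eI (past_next t)) ?mean_step ?mulr0 //.
- by apply: measurable_indic; exact: alive_event.
- exact: next_event.
- exact: bm_step.
Qed.

(** Second Wald identity: the cross terms vanish by independence, and each step made before the exit
    contributes [s2]. *)
Lemma mean_stopped_sq t :
  mean Q (fun w => stopped t w ^+ 2) = s2 * \sum_(k < t) pr Q (alive k).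
Proof.
elim: t => [|t IH].
  rewrite (_ : (fun w => stopped 0 w ^+ 2) = fun _ => 0).
    by rewrite mean_cst big_ord0 mulr0.
  by apply/funext => w; rewrite /stopped big_ord0 expr0n.
have bA : bounded_measurable (\1_(alive t) : T -> R).
  exact: bm_indic (alive_meas t).
have bS := bm_stopped t.
have bst := bm_step t.
pose f1 w : R := stopped t w ^+ 2.
pose f2 w : R := (2 * (\1_(alive t) w * stopped t w)) * (sg * e (io t) w).
pose f3 w : R := \1_(alive t) w * e (io t) w ^+ 2.
have bA2 : bounded_measurable (fun w => 2 * (\1_(alive t) w * stopped t w)).
  by apply: bmM; [exact: bm_cst|exact: bmM].
have bf1 : bounded_measurable f1 by exact: bmM.
have bf2 : bounded_measurable f2 by exact: bmM.
have be2 : bounded_measurable (fun w => e (io t) w ^+ 2).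
  by apply: bmM; exact: bm_coord.
have bf3 : bounded_measurable f3 by exact: bmM.
have -> : (fun w => stopped t.+1 w ^+ 2) = fun w => f1 w + (f2 w + f3 w).
  apply/funext => w; rewrite stoppedS /f1 /f2 /f3 sqrrD exprMn [(sg * _) ^+ 2]exprMn.
  rewrite sg2 mul1r -addrA; congr (_ + (_ + _)); first by ring.
  by rewrite indicE; case: (_ \in _); rewrite ?expr1n ?expr0n.
rewrite meanD //; last exact: bmD.
rewrite meanD // IH big_ord_recr /= mulrDr; congr (_ + _).
have mAt := @alive_event t.
rewrite /f2 (info_mean me eI (past_next t)) //; last 2 first.
- apply: measurable_funM; first exact: measurable_cst.
  by apply: measurable_funM; [exact: measurable_indic|exact: stopped_event].
- exact: next_event.
rewrite mean_step mulr0 add0r /f3 (info_mean me eI (past_next t)) //; last 2 first.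
- by rewrite mean_indic ?e2 1?mulrC //; exact: alive_meas.
- by apply: measurable_funX; exact: info_coord.
Qed.

Lemma pr_alive_le t :
  s2 * (t%:R * pr Q (alive t)) <= mean Q (fun w => stopped t w ^+ 2).
Proof.
rewrite mean_stopped_sq ler_pM2l // mulr_natl -[X in _ *+ X]card_ord -sumr_const.
apply: ler_sum => k _; apply: le_pr; [exact: alive_meas|exact: alive_meas|].
by move=> w /= h j jk; apply: h; apply: leq_trans jk (ltnW _).
Qed.

End Exit.
Lemma mwalk sg io t : measurable_fun (setT : set T) (walk sg io t).
Proof.
by apply: (info_meas me (J := setT)); exact: measurable_walk.
Qed.

Section Bounds.
Variables (sg : R) (io : nat -> int).
Hypothesis sg2 : sg ^+ 2 = 1.
Hypothesis io_inj : injective io.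

Notation W := (walk sg io).

Lemma stopped_reach_by N u l w : 0 <= l -> 0 < u ->
  reach_by N u l (W ^~ w) -> u <= stopped sg io (- l) u N w.
Proof.
move=> l0 u0 [k [kN uk lk]].
have [k' [k'N -> ak nk]] := stopped_exit sg io (- l) u N w.
have k'k : (k' <= k)%N.
  rewrite leqNgt; apply/negP => /ak /andP[_].
  by rewrite ltNge uk.
move: k'N; rewrite leq_eqVlt => /orP[/eqP k'N|/nk].
  by have -> : k' = k by apply/eqP; rewrite eqn_leq k'k k'N.
by rewrite lk //= -leNgt.
Qed.

(** The stopped walk is at least u on the event, at least - l - b elsewhere, and has mean zero. *)
Lemma pr_reach_by N u l : 0 <= l -> 0 < u ->
  pr Q [set w | reach_by N u l (W ^~ w)] <= (l + b) / (u + l + b).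
Proof.
move=> l0 u0; have b0 := b_ge0; set A := mkset _.
have mA : measurable A by apply: meas_reach_by; exact: mwalk.
rewrite ler_pdivlMr; last by lra.
have bA : bounded_measurable (\1_A : T -> R) by exact: bm_indic.
have lN : - l <= 0 by lra.
have : mean Q (fun w => (u + l + b) * \1_A w + - (l + b)) <= 0.
  rewrite -[X in _ <= X](mean_stopped sg2 io_inj lN u0 N).
  apply: ler_mean => [||w].
  - by apply: bmD; [apply: bmM => //; exact: bm_cst|exact: bm_cst].
  - exact: bm_stopped.
  - have := stopped_bnd io sg2 lN u0 N w => /andP[h1 h2].
    rewrite indicE; have [wA|wA] := boolP (w \in A).
      rewrite mulr1; have : u <= stopped sg io (- l) u N w.
        by apply: stopped_reach_by => //; move: wA; rewrite inE.
      lra.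
    rewrite mulr0; lra.
rewrite meanD; last 2 first.
- by apply: bmM => //; exact: bm_cst.
- exact: bm_cst.
rewrite meanZ // mean_cst mean_indic //; lra.
Qed.

Lemma pr_bigcup_le (F : nat -> set T) c : (forall k, measurable (F k)) ->
  (forall n, pr Q (\bigcup_(k < n) F k) <= c) -> pr Q (\bigcup_k F k) <= c.
Proof.
move=> mF h; rewrite seqDU_bigcup_eq.
have mS k : measurable (seqDU F k).
  rewrite /seqDU; apply: measurableD => //.
  by apply: bigsetU_measurable.
apply: (pr_bigcup (p := fun k => pr Q (seqDU F k))) => // n.
apply: le_trans (h n).
pose G k := if (k < n)%N then seqDU F k else set0.
have mG k : measurable (G k) by rewrite /G; case: ifP.
have tG : trivIset setT G.
  apply/trivIsetP => i j _ _ ij; rewrite /G.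
  case: ifP => _; last by rewrite set0I.
  case: ifP => _; last by rewrite setI0.
  by move: (trivIset_seqDU F) => /trivIsetP; apply.
rewrite (eq_bigr (fun k : 'I_n => pr Q (G k))) => [|k _]; last by rewrite /G ltn_ord.
apply: le_trans (pr_bigcup_disj Q n mG tG) _.
apply: le_pr => [||w [k _]]; try exact: bigcup_measurable.
rewrite /G; case: ifP => // kn [Fk _]; by exists k.
Qed.

Lemma pr_reach u l : 0 <= l -> 0 < u ->
  pr Q [set w | reach u l (W ^~ w)] <= (l + b) / (u + l + b).
Proof.
move=> l0 u0.
have -> : [set w | reach u l (W ^~ w)] =
   \bigcup_N [set w | reach_by N u l (W ^~ w)].
  apply/seteqP; split => w /= => [[k [h1 h2]]|[N _ [k [_ h1 h2]]]].
    by exists k => //=; exists k.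
  by exists k.
apply: pr_bigcup_le => [N|n]; first by apply: meas_reach_by; exact: mwalk.
apply: le_trans (pr_reach_by n l0 u0).
apply: le_pr.
- by apply: bigcup_measurable => k _; apply: meas_reach_by; exact: mwalk.
- by apply: meas_reach_by; exact: mwalk.
- move=> w [N /= Nn [k [kN h1 h2]]]; exists k; split => //.
  by rewrite (leq_trans kN) // ltnW.
Qed.

(** The stopped walk is at most u + b if the top was reached, below u if it is still inside, and at
    most - l after an exit at the bottom; its mean is zero. *)
Lemma pr_alive_exit t u l : 0 <= l -> 0 < u ->
  l <= (u + b + l) * pr Q [set w | reach_by t u l (W ^~ w)]
       + (u + l) * pr Q (alive sg io (- l) u t).
Proof.
move=> l0 u0; have b0 := b_ge0.
set A := mkset _; set B := alive _ _ _ _ _.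
have mA : measurable A by apply: meas_reach_by; exact: mwalk.
have mB : measurable B by exact: alive_meas.
have bA : bounded_measurable (\1_A : T -> R) by exact: bm_indic.
have bB : bounded_measurable (\1_B : T -> R) by exact: bm_indic.
have lN : - l <= 0 by lra.
have b1 : bounded_measurable (fun w => (u + b + l) * \1_A w).
  by apply: bmM => //; exact: bm_cst.
have b2 : bounded_measurable (fun w => (u + l) * \1_B w).
  by apply: bmM => //; exact: bm_cst.
have b3 : bounded_measurable (fun w => (u + b + l) * \1_A w + (u + l) * \1_B w).
  exact: bmD.
have : 0 <= mean Q (fun w => (u + b + l) * \1_A w + (u + l) * \1_B w + - l).
  rewrite -[X in X <= _](mean_stopped sg2 io_inj lN u0 t).
  apply: ler_mean => [||w].
  - exact: bm_stopped.
  - by apply: bmD => //; exact: bm_cst.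
  - have := stopped_bnd io sg2 lN u0 t w => /andP[h1 h2].
    rewrite !indicE; have [wA|wA] := boolP (w \in A).
      by case: (w \in B); rewrite !(mulr1, mulr0); lra.
    have [wB|wB] := boolP (w \in B).
      rewrite !(mulr1, mulr0).
      have [k [kt -> ak nk]] := stopped_exit sg io (- l) u t w.
      move: wB; rewrite inE => /(_ k kt) /andP[_ ?]; lra.
    rewrite !mulr0.
    have [k [kt sk ak nk]] := stopped_exit sg io (- l) u t w.
    have nWk : ~~ (- l <= W k w < u).
      move: kt; rewrite leq_eqVlt => /orP[/eqP kt|/nk //].
      apply/negP => Wk; move/negP: wB; apply; rewrite inE => j.
      by rewrite -kt leq_eqVlt => /orP[/eqP ->|/ak].
    rewrite sk add0r add0r; case: (ltP (W k w) (- l)) => [|lW]; first exact: ltW.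
    exfalso; move/negP: wA; apply; rewrite inE /=; exists k; split => //.
      by move: nWk; rewrite lW /= -leNgt.
    by move=> j; rewrite leq_eqVlt => /orP[/eqP -> //|/ak /andP[]].
rewrite meanD //; last exact: bm_cst.
rewrite meanD // !meanZ // mean_cst !mean_indic //; lra.
Qed.

Lemma pr_alive_sq t u l M : 0 <= l -> 0 < u -> u + b <= M -> l + b <= M ->
  s2 * (t%:R * pr Q (alive sg io (- l) u t)) <= M ^+ 2.
Proof.
move=> l0 u0 uM lM; have lN : - l <= 0 by lra.
have b0 := b_ge0.
apply: le_trans (pr_alive_le sg2 io_inj lN u0 t) _.
rewrite -(mean_cst Q (M ^+ 2)); apply: ler_mean => [||w].
- by apply: bmM; exact: bm_stopped.
- exact: bm_cst.
- have := stopped_bnd io sg2 lN u0 t w => /andP[h1 h2].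
  by rewrite -subr_ge0 subr_sqr mulr_ge0 //; lra.
Qed.

(** With the lower barrier at 0 the stopped walk X lies in [- b, r + b], so X^2 <= (r + b) (X + 2
    b). As X has mean zero, the second moment is linear in [r] instead of quadratic. *)
Lemma pr_alive_pos t r : 0 < r ->
  s2 * (t%:R * pr Q (alive sg io 0 r t)) <= (r + b) * (2 * b).
Proof.
move=> r0; have lN : (0 : R) <= 0 by [].
have b0 := b_ge0.
apply: le_trans (pr_alive_le sg2 io_inj lN r0 t) _.
have bS := bm_stopped io sg2 lN r0 t.
have <- : mean Q (fun w => (r + b) * (stopped sg io 0 r t w + 2 * b)) = (r + b) * (2 * b).
  rewrite meanZ; last by apply: bmD => //; exact: bm_cst.
  by rewrite meanD ?mean_cst ?mean_stopped ?add0r //; exact: bm_cst.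
apply: ler_mean => [||w].
- exact: bmM.
- by apply: bmM; [exact: bm_cst|apply: bmD => //; exact: bm_cst].
- have := stopped_bnd io sg2 lN r0 t w => /andP[h1 h2].
  nra.
Qed.

(** A strong Markov property: [seqDU P k] says that [k] is the first time at which [P] holds, which
    is decided by the increments before [k], while [C k] involves only those from [k] on. *)
Lemma first_passage (P C : nat -> set T) p :
  (forall k, (past io k).-event (P k)) ->
  (forall k, (range (shift io k)).-event (C k)) ->
  (forall k, pr Q (C k) <= p) ->
  pr Q (\bigcup_k (seqDU P k `&` C k)) <= pr Q (\bigcup_k P k) * p.
Proof.
move=> eP eC Cp.
have p0 : 0 <= p by apply: le_trans (Cp 0%N); exact: pr_ge0.
have mP k : measurable (P k) by apply: (info_measurable me); exact: eP.
have mC k : measurable (C k) by apply: (info_measurable me); exact: eC.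
have eS k : (past io k).-event (seqDU P k).
  apply: measurableD; first exact: eP.
  apply: bigsetU_measurable => j _.
  by apply: (info_sub (J := past io j)) (eP j); apply: past_sub; exact: ltnW.
have mS k : measurable (seqDU P k) by apply: (info_measurable me); exact: eS.
apply: (pr_bigcup (p := fun k => pr Q (seqDU P k) * p)) => [k|k|n].
- exact: measurableI.
- rewrite (info_pr me eI (past_future k io_inj) (eS k) (eC k)).
  by rewrite ler_wpM2l ?pr_ge0.
- rewrite -mulr_suml ler_wpM2r // seqDU_bigcup_eq.
  by apply: pr_bigcup_disj => //; exact: trivIset_seqDU.
Qed.

Lemma past_walk k j : (j <= k)%N ->
  measurable_fun (setT : set (info e (past io k))) (W j).
Proof. by move=> jk; apply: measurable_walk => i ij; exists i => //; exact: leq_trans jk. Qed.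

End Bounds.

Section CompoundBounds.
Variables (sg : R) (io : nat -> int).
Hypothesis sg2 : sg ^+ 2 = 1.
Hypothesis io_inj : injective io.

Notation W := (walk sg io).

Let sgN2 : (- sg) ^+ 2 = 1. Proof. by rewrite sqrrN. Qed.

Lemma future_reach_event (sg' : R) k u l :
  (range (shift io k)).-event [set w | reach u l (walk sg' (shift io k) ^~ w)].
Proof. by apply: meas_reach => t; exact: measurable_walk_range. Qed.

Lemma pr_future_reach (sg' : R) k u l : sg' ^+ 2 = 1 -> 0 <= l -> 0 < u ->
  pr Q [set w | reach u l (walk sg' (shift io k) ^~ w)] <= (l + b) / (u + l + b).
Proof. by move=> ?; apply: pr_reach => //; exact: shift_inj. Qed.

Lemma first_time (P : nat -> set T) k w : P k w ->
  exists j, (j <= k)%N /\ seqDU P j w.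
Proof.
elim: k {-2}k (leqnn k) => [|n IH] k kn Pk.
  exists k; split => //; split => //.
  by move: kn; rewrite leqn0 => /eqP ->; rewrite big_ord0.
have [[j jk Pj]|nP] := pselect (exists2 j, (j < k)%N & P j w).
  have [|i [ij Pi]] := IH j _ Pj; first by rewrite -ltnS (leq_trans jk).
  by exists i; split => //; rewrite (leq_trans ij) // ltnW.
exists k; split => //; split => //.
rewrite -(bigcup_mkord k) => -[j /= jk Pj]; apply: nP; by exists j.
Qed.

(** Either the path stays in [0, r) for [f] steps and must then still climb to [h], or it reaches
    [r], comes down to [s], and climbs to [h] from there. The last climb is in both cases
    independent of what precedes it, and [r] is left free to balance the two terms. *)
Lemma pr_dip f s h r : (0 < f)%N -> 0 <= s -> 0 < r -> s < h -> r < h ->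
  pr Q [set w | dip f s h (W ^~ w)] <=
  (2 * b * (r + b) / (s2 * f%:R)) * ((r + b) / (h + b))
  + b / (r + b) * ((s + b) / (h + b)).
Proof.
move=> f0 s0 r0 sh rh; have b0 := b_ge0.
pose A := alive sg io 0 r f.
pose C0 := [set w | reach (h - r) r (walk sg (shift io f) ^~ w)].
pose P k := [set w | (exists i, (i <= k)%N /\ r <= W i w) /\
   (W k w <= s /\ forall j, (j <= k)%N -> 0 <= W j w)].
pose C k := [set w | reach (h - s) s (walk sg (shift io k) ^~ w)].
have eP k : (past io k).-event (P k).
  apply: meas_and.
    apply: meas_ex => i; case: (leqP i k) => ik; last first.
      rewrite (_ : mkset _ = set0) ?measurable0 //.
      by apply/seteqP; split => // w [].
    by apply: meas_and; [exact: meas_const|apply: meas_ge; exact: past_walk].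
  apply: meas_and; first by apply: meas_le; exact: past_walk.
  apply: meas_all => j; case: (leqP j k) => jk; last first.
    rewrite (_ : mkset _ = setT) ?measurableT //.
    by apply/seteqP; split.
  by apply: meas_imp; apply: meas_ge; exact: past_walk.
have mU (F : nat -> set T) : (forall k, measurable (F k)) -> measurable (\bigcup_k F k).
  by move=> mF; exact: bigcup_measurable.
have mP k : measurable (P k) by apply: (info_measurable me); exact: eP.
have mC k : measurable (C k).
  by apply: (info_measurable me); exact: future_reach_event.
have mS k : measurable (seqDU P k `&` C k).
  by apply: measurableI => //; apply: measurableD => //; exact: bigsetU_measurable.
have mA : measurable A by exact: alive_meas.
have mC0 : measurable C0 by apply: (info_measurable me); exact: future_reach_event.
apply: (@le_trans _ _ (pr Q (A `&` C0 `|` \bigcup_k (seqDU P k `&` C k)))).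
  apply: le_pr.
  - by apply: meas_dip; exact: mwalk.
  - by apply: measurableU; [exact: measurableI|exact: mU].
  - move=> w [k [t [fk kt ks ht t0]]].
    have [Aw|nA] := pselect (A w).
      left; split => //; exists (t - f)%N.
      have ft : (f <= t)%N by rewrite (leq_trans (ltnW fk)).
      have := walkD sg io f (t - f) w; rewrite subnKC // => Et.
      have /andP[Wf0 Wfr] := Aw f (leqnn f).
      split; first by lra.
      move=> j jt; have Ej := walkD sg io f j w.
      have := t0 (f + j)%N; rewrite -(leq_subRL _ ft) => /(_ jt); lra.
    right.
    have [i [ik Wi]] : exists i, (i <= k)%N /\ r <= W i w.
      apply: contrapT => nE; apply: nA => j jf.
      rewrite t0 /=; last by rewrite (leq_trans jf) // (leq_trans _ kt) // ltnW.
      rewrite ltNge; apply/negP => Wj; apply: nE; exists j; split => //.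
      by rewrite (leq_trans jf) // ltnW.
    have Pk : P k w.
      split; first by exists i.
      by split => // j jk; apply: t0; exact: leq_trans kt.
    have [j [jk Sj]] := first_time Pk.
    exists j => //; split => //.
    have [[_ [js _]] _] := Sj.
    have jt := leq_trans jk kt.
    exists (t - j)%N; have := walkD sg io j (t - j) w; rewrite subnKC // => Et.
    split; first by lra.
    move=> l lt; have El := walkD sg io j l w.
    have := t0 (j + l)%N; rewrite -(leq_subRL _ jt) => /(_ lt); lra.
apply: le_trans (prU Q _ _) _; [exact: measurableI|exact: mU|].
apply: lerD.
  have -> : pr Q (A `&` C0) = pr Q A * pr Q C0.
    apply: (info_pr me eI (past_future f io_inj)); first exact: alive_event.
    exact: future_reach_event.
  apply: ler_pM; try exact: pr_ge0.
    have := pr_alive_pos sg2 io_inj f r0; rewrite -/A => hA.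
    rewrite ler_pdivlMr; first by nra.
    by rewrite mulr_gt0 // ltr0n.
  have -> : h + b = h - r + r + b by lra.
  by apply: pr_future_reach => //; [exact: ltW|lra].
apply: le_trans (@first_passage _ io_inj P C ((s + b) / (h + b)) eP _ _) _.
- by move=> k; exact: future_reach_event.
- move=> k; have -> : h + b = h - s + s + b by lra.
  by apply: pr_future_reach => //; lra.
rewrite ler_wpM2r ?divr_ge0 //; try lra.
have -> : b / (r + b) = (0 + b) / (r + 0 + b) by congr (_ / _); lra.
apply: le_trans (pr_reach sg2 io_inj _ r0) => //.
apply: le_pr; [exact: mU|by apply: meas_reach; exact: mwalk|].
move=> w [k _ [[i [ik Wi]] [_ W0]]]; exists i; split => // j ji.
by rewrite oppr0; apply: W0; exact: leq_trans ik.
Qed.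

(** At the first time the path has gained [h1], the walk read with opposite sign has to gain about
    [h1] before losing h - h1. *)
Lemma pr_relapse h1 h : 0 < h1 -> h1 < h ->
  pr Q [set w | relapse h1 h (W ^~ w)] <= b / (h1 + b) * ((h - h1 + b) / (h + b)).
Proof.
move=> h10 h1h; have b0 := b_ge0.
pose P k := [set w | h1 <= W k w /\ forall j, (j <= k)%N -> 0 <= W j w].
pose C k := [set w | reach h1 (h - h1) (walk (- sg) (shift io k) ^~ w)].
have eP k : (past io k).-event (P k).
  apply: meas_and; first by apply: meas_ge; exact: past_walk.
  apply: meas_all => j; case: (leqP j k) => jk; last first.
    rewrite (_ : mkset _ = setT) ?measurableT //.
    by apply/seteqP; split.
  by apply: meas_imp; apply: meas_ge; exact: past_walk.
have mP k : measurable (P k) by apply: (info_measurable me); exact: eP.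
have mC k : measurable (C k).
  by apply: (info_measurable me); exact: future_reach_event.
have mS k : measurable (seqDU P k `&` C k).
  by apply: measurableI => //; apply: measurableD => //; exact: bigsetU_measurable.
apply: (@le_trans _ _ (pr Q (\bigcup_k (seqDU P k `&` C k)))).
  apply: le_pr.
  - by apply: meas_relapse; exact: mwalk.
  - exact: bigcup_measurable.
  - move=> w [k [t [kt hk k0 Wt th]]].
    have Pk : P k w by [].
    have [j [jk Sj]] := first_time Pk.
    exists j => //; split => //.
    have [[hj _] _] := Sj.
    have jt := leq_trans jk kt.
    exists (t - j)%N; have := walkD sg io j (t - j) w; rewrite subnKC // => Et.
    rewrite !walkN; split; first by lra.
    move=> l lt; have El := walkD sg io j l w.
    have := th (j + l)%N; rewrite -(leq_subRL _ jt) walkN => /(_ lt); lra.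
apply: le_trans (@first_passage _ io_inj P C ((h - h1 + b) / (h + b)) eP _ _) _.
- by move=> k; exact: future_reach_event.
- move=> k; have -> : h + b = h1 + (h - h1) + b by lra.
  by apply: pr_future_reach => //; lra.
rewrite ler_wpM2r ?divr_ge0 //; try lra.
have -> : b / (h1 + b) = (0 + b) / (h1 + 0 + b) by congr (_ / _); lra.
apply: le_trans (pr_reach sg2 io_inj _ h10) => //.
apply: le_pr; [exact: bigcup_measurable|by apply: meas_reach; exact: mwalk|].
move=> w [k _ [hk k0]]; exists k; split => // j jk; rewrite oppr0; exact: k0.
Qed.

(** After the first visit above [x], the walk read with opposite sign gains x - z without losing
    more than y - x. The visit itself is bounded by probability 1. *)
Lemma pr_plunge x y z : z < x -> x <= y ->
  pr Q [set w | plunge x y z (W ^~ w)] <= (y - x + b) / (y - z + b).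
Proof.
move=> dx xy; have b0 := b_ge0.
pose P k := [set w | x <= W k w].
pose C k := [set w | reach (x - z) (y - x) (walk (- sg) (shift io k) ^~ w)].
have eP k : (past io k).-event (P k) by apply: meas_ge; exact: past_walk.
have mP k : measurable (P k) by apply: (info_measurable me); exact: eP.
have mC k : measurable (C k).
  by apply: (info_measurable me); exact: future_reach_event.
have mS k : measurable (seqDU P k `&` C k).
  by apply: measurableI => //; apply: measurableD => //; exact: bigsetU_measurable.
apply: (@le_trans _ _ (pr Q (\bigcup_k (seqDU P k `&` C k)))).
  apply: le_pr.
  - by apply: meas_plunge; exact: mwalk.
  - exact: bigcup_measurable.
  - move=> w [k [t [kt hk Wt th]]].
    have Pk : P k w by [].
    have [j [jk Sj]] := first_time Pk.
    exists j => //; split => //.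
    have [hj _] := Sj; rewrite /P /= in hj.
    have jt := leq_trans jk kt.
    exists (t - j)%N; have := walkD sg io j (t - j) w; rewrite subnKC // => Et.
    rewrite !walkN; split; first by lra.
    move=> l lt; have El := walkD sg io j l w.
    have := th (j + l)%N; rewrite -(leq_subRL _ jt) walkN => /(_ lt); lra.
apply: le_trans (@first_passage _ io_inj P C ((y - x + b) / (y - z + b)) eP _ _) _.
- by move=> k; exact: future_reach_event.
- move=> k; have -> : y - z + b = x - z + (y - x) + b by lra.
  by apply: pr_future_reach => //; lra.
rewrite ler_piMl ?divr_ge0 //; try lra.
by apply: pr_le1; exact: bigcup_measurable.
Qed.

(* Within a block of length [B] a symmetric exit from an interval of half-width
   [h] happens with probability at least 3/4, and upwards with probability at
   least 1/6. *)
Lemma pr_climbs h B K : b <= h -> 0 < h -> 4 * (h + b) ^+ 2 <= s2 * B%:R ->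
  pr Q [set w | ~ climbs h (K * B) (W ^~ w)] <= (5 / 6) ^+ K.
Proof.
move=> bh h0 hB; have b0 := b_ge0.
pose N k := [set w | forall j, (j < k)%N ->
  ~ reach_by B h h (walk sg (shift io (j * B)) ^~ w)].
have eN k : (past io (k * B)).-event (N k).
  apply: meas_all => j; case: (ltnP j k) => jk; last first.
    rewrite (_ : mkset _ = setT) ?measurableT //.
    by apply/seteqP; split.
  apply: meas_imp; apply: measurableC.
  apply: meas_ex => i.
  rewrite (_ : mkset _ = [set w | (i <= B)%N /\ (h <= walk sg (shift io (j * B)) i w /\
    forall l, (l <= i)%N -> - h <= walk sg (shift io (j * B)) l w)]); last first.
    by apply/seteqP; split => w /= [] // ? [].
  case: (leqP i B) => iB; last first.
    rewrite (_ : mkset _ = set0) ?measurable0 //.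
    by apply/seteqP; split => // w [].
  have mw l : (l <= B)%N -> measurable_fun (setT : set (info e (past io (k * B))))
       (walk sg (shift io (j * B)) l).
    move=> lB; apply: measurable_walk => a al; exists (j * B + a)%N => //.
    rewrite (@leq_trans (j.+1 * B)) ?leq_mul2r ?jk ?orbT //.
    by rewrite mulSn addnC ltn_add2r (leq_trans al).
  apply: meas_and; first exact: meas_const.
  apply: meas_and; first by apply: meas_ge; exact: mw.
  apply: meas_all => l; case: (leqP l i) => li; last first.
    rewrite (_ : mkset _ = setT) ?measurableT //.
    by apply/seteqP; split.
  by apply: meas_imp; apply: meas_ge; apply: mw; exact: leq_trans iB.
have mN k : measurable (N k) by apply: (info_measurable me); exact: eN.
apply: (@le_trans _ _ (pr Q (N K))).
  apply: le_pr => //.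
    by apply: measurableC; apply: meas_climbs; exact: mwalk.
  move=> w /= nc j jK [i [iB hi _]]; apply: nc.
  exists (j * B)%N, (j * B + i)%N; split; first exact: leq_addr.
    rewrite (@leq_trans (j.+1 * B)) ?leq_mul2r ?jK ?orbT //.
    by rewrite mulSn addnC leq_add2r.
  by rewrite walkD addrAC subrr add0r.
elim: K => [|K IH]; first by rewrite expr0; exact: pr_le1.
pose A := [set w | reach_by B h h (walk sg (shift io (K * B)) ^~ w)].
have eA : (range (shift io (K * B))).-event A.
  by apply: meas_reach_by => t; exact: measurable_walk_range.
have mA : measurable A by apply: (info_measurable me); exact: eA.
have -> : N K.+1 = N K `&` ~` A.
  apply/seteqP; split => w /= => [h'|[h1 h2] j].
    by split => [j jK|]; apply: h' => //; exact: ltnW.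
  by rewrite ltnS leq_eqVlt => /orP[/eqP -> //|]; exact: h1.
rewrite (info_pr me eI (past_future (K * B) io_inj) (eN K)); last exact: measurableC.
rewrite exprSr; apply: ler_pM => //; try exact: pr_ge0.
rewrite prC // lerBlDr -lerBlDl.
have sh := shift_inj (t := (K * B)%N) io_inj.
have h0' : 0 <= h by exact: ltW.
have E1 := pr_alive_exit sg2 sh B h0' h0.
have E2 := pr_alive_sq sg2 sh B h0' h0 (lexx (h + b)) (lexx (h + b)).
set q := pr Q (alive _ _ _ _ _) in E1 E2.
rewrite -/A in E1.
have q0 : 0 <= q by exact: pr_ge0.
have q4 : q <= 1 / 4.
  have : 4 * (h + b) ^+ 2 * q <= (h + b) ^+ 2.
    by apply: le_trans E2; rewrite mulrA ler_wpM2r.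
  have : 0 < (h + b) ^+ 2 by rewrite exprn_gt0 //; lra.
  nra.
have pA0 := pr_ge0 Q A.
(* As [b <= h] and q <= 1/4, [E1] gives h <= 3 h p + h / 2 for the probability p of [A], that is p
   >= 1/6. *)
rewrite -(ler_pM2r h0); nra.
Qed.

(** Recurrence. A barrier [l] far below makes an exit at the bottom unlikely, then a long time [t]
    makes survival inside unlikely; each choice costs eps0 / 2. *)
Lemma pr_not_level h : 0 < h -> pr Q [set w | ~ level h (W ^~ w)] = 0.
Proof.
move=> h0; have b0 := b_ge0; set A := mkset _.
have mA : measurable A by apply: measurableC; apply: meas_level; exact: mwalk.
apply/eqP; rewrite eq_le pr_ge0 andbT.
apply/ler_addgt0Pl => eps0 eps_gt0; rewrite addr0.
pose l := 2 * (h + b) / eps0.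
have l0 : 0 < l by rewrite divr_gt0 //; lra.
pose M := h + l + b.
pose t := (Num.truncn (M ^+ 2 * 2 / (s2 * eps0))).+1.
have tM : M ^+ 2 * 2 <= s2 * eps0 * t%:R.
  have se : 0 < s2 * eps0 by rewrite mulr_gt0.
  by rewrite [leRHS]mulrC -ler_pdivrMr // ltW // truncnS_gt.
have l0' : 0 <= l by exact: ltW.
have hM : h + b <= M by rewrite /M; lra.
have lM : l + b <= M by rewrite /M; lra.
have E1 := pr_alive_exit sg2 io_inj t l0' h0.
have E2 := pr_alive_sq sg2 io_inj t l0' h0 hM lM.
set q := pr Q (alive _ _ _ _ _) in E1 E2.
set A' := mkset _ in E1.
have mA' : measurable A' by apply: meas_reach_by; exact: mwalk.
have q0 : 0 <= q by exact: pr_ge0.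
have qe : q <= eps0 / 2.
  have M2 : 0 < M ^+ 2 by rewrite exprn_gt0 // /M; lra.
  rewrite leNgt; apply/negP => qq.
  have t0 : (0 : R) < t%:R by rewrite ltr0n.
  have : s2 * (t%:R * (eps0 / 2)) < s2 * (t%:R * q) by rewrite !ltr_pM2l.
  nra.
have AA' : pr Q A <= 1 - pr Q A'.
  rewrite -prC //; apply: le_pr => //; first exact: measurableC.
  by move=> w nl [k [_ hk _]]; apply: nl; exists k.
apply: le_trans AA' _.
have pA0 := pr_ge0 Q A'.
have le : l * eps0 = 2 * (h + b) by rewrite /l divfK // gt_eqF.
have : (h + b + l) * (1 - pr Q A') <= (h + b) + (h + l) * (eps0 / 2) by nra.
move=> E3.
rewrite -(ler_pM2l (_ : 0 < h + b + l)); last by lra.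
apply: le_trans E3 _; nra.
Qed.

End CompoundBounds.

End WalkEstimates.

(** * Valleys *)

Section Extrema.
Context (R : realType).
Implicit Types (S : int -> R).

Lemma sup_attained (A : set R) x : A x -> (forall y, A y -> y <= x) -> sup A = x.
Proof.
move=> Ax xA; apply/eqP; rewrite eq_le; apply/andP; split.
  by apply: ge_sup => //; exists x.
by apply: ub_le_sup => //; exists x.
Qed.

Lemma argmax S i j : i <= j ->
  exists t, i <= t <= j /\ forall u, i <= u <= j -> S u <= S t.
Proof.
move=> ij; have [n ->] : exists n : nat, j = i + n%:Z.
  by exists `|j - i|%N; lia.
elim: n => [|n [t [tn tm]]].
  by exists i; split => [|u ui]; [lia|rewrite (_ : u = i) //; lia].
case: (leP (S t) (S (i + n.+1%:Z))) => St.
  exists (i + n.+1%:Z); split => [|u ui]; first lia.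
  have [ui'|->] : i <= u <= i + n%:Z \/ u = i + n.+1%:Z by lia.
    exact: le_trans (tm _ ui') _.
  by [].
exists t; split => [|u ui]; first lia.
have [ui'|->] : i <= u <= i + n%:Z \/ u = i + n.+1%:Z by lia.
  exact: tm.
exact: ltW.
Qed.

Lemma argmin S i j : i <= j ->
  exists t, i <= t <= j /\ forall u, i <= u <= j -> S t <= S u.
Proof.
move=> ij; have [t [tij tm]] := argmax (fun u => - S u) ij.
by exists t; split => // u /tm; rewrite lerN2.
Qed.

Lemma maxS_eq S i j t : i <= t <= j -> (forall u, i <= u <= j -> S u <= S t) ->
  maxS S i j = S t.
Proof.
by move=> tij tm; apply: sup_attained => [|_ [u /= uij <-]]; [exists t|exact: tm].
Qed.

Lemma maxS_ub S i j u : i <= u <= j -> S u <= maxS S i j.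
Proof.
move=> uij; have ij : i <= j by lia.
by have [t [tij tm]] := argmax S ij; rewrite (maxS_eq tij tm); exact: tm.
Qed.

Lemma maxS_le S i j c : i <= j -> (forall u, i <= u <= j -> S u <= c) ->
  maxS S i j <= c.
Proof.
by move=> ij uc; have [t [tij tm]] := argmax S ij; rewrite (maxS_eq tij tm); exact: uc.
Qed.

Lemma minS_eq S i j t : i <= t <= j -> (forall u, i <= u <= j -> S t <= S u) ->
  minS S i j = S t.
Proof.
move=> tij tm; rewrite /minS /inf; apply/eqP; rewrite eqr_oppLR; apply/eqP.
apply: sup_attained => [|_ [_ [u /= uij <-] <-]].
  by exists (S t) => //; exists t.
by rewrite lerN2; exact: tm.
Qed.

Lemma pre_valleyP S a m c : pre_valley S (Triplet a m c) <->
  [/\ a <= m <= c, forall t, a <= t <= m -> S t <= S a,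
      forall t, m <= t <= c -> S t <= S c & forall t, a <= t <= c -> S m <= S t].
Proof.
split=> [[/= amc Ea Ec Em]|[amc ha hc hm]].
  split => // t tt; first by rewrite Ea maxS_ub.
    by rewrite Ec maxS_ub.
  have ac : a <= c by lia.
  have [u [uac um]] := argmin S ac.
  by rewrite Em (minS_eq uac um) um.
split => //=.
- by rewrite (maxS_eq (t := a)) //; lia.
- by rewrite (maxS_eq (t := c)) //; lia.
- by rewrite (minS_eq (t := m)).
Qed.

(** For a given top the best foot is a minimum to its left, so it suffices to maximise the height
    above the running minimum. *)
Lemma argmax_rise S a m : a <= m -> exists i j, a <= i <= j /\ j <= m /\
  forall i' j', a <= i' <= j' -> j' <= m -> S j' - S i' <= S j - S i.
Proof.
move=> am.
have [j [jam jm]] := argmax (fun t => S t - minS S a t) am.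
have aj : a <= j by lia.
have [i [iaj im]] := argmin S aj.
exists i, j; split; first lia; split; first lia.
move=> i' j' ai' j'm; rewrite -(minS_eq iaj im).
apply: le_trans (jm j' _); last lia.
have aj' : a <= j' by lia.
have [u [uaj um]] := argmin S aj'.
rewrite (minS_eq uaj um) lerD2l lerN2; apply: um; lia.
Qed.

Lemma left_risesP S V q : left_rises S V q <->
  (lft V <= q.2 /\ q.2 < q.1 <= bot V) /\
  forall i j, lft V <= i <= j -> j <= bot V -> S j - S i <= S q.1 - S q.2.
Proof.
rewrite /left_rises /=; split => -[qV qm]; split => //.
  move=> i j ai jm; rewrite qm.
  have am : lft V <= bot V by lia.
  have [i0 [j0 [h1 [h2 h3]]]] := argmax_rise S am.
  apply: (@le_trans _ _ (S j0 - S i0)); first exact: h3.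
  rewrite (@sup_attained _ (S j0 - S i0)) //.
    by exists (j0, i0) => //=; lia.
  by move=> _ [[t1 t2] /= t12 <-]; apply: h3; lia.
rewrite (@sup_attained _ (S q.1 - S q.2)) //.
  by exists q => //=; lia.
by move=> _ [[t1 t2] /= t12 <-]; apply: qm; lia.
Qed.

(** Reflection at 0 exchanges right and left refinements, and breaking ties by absolute value is
    invariant under it; statements about one side therefore transfer to the other. *)
Definition mirror S (t : int) : R := S (- t).
Definition mirrorV V := Triplet (- rgt V) (- bot V) (- lft V).

Lemma mirrorK S : mirror (mirror S) = S.
Proof. by apply/funext => t; rewrite /mirror opprK. Qed.

Lemma mirrorVK V : mirrorV (mirrorV V) = V.
Proof. by case: V => a m c; rewrite /mirrorV /= !opprK. Qed.

Lemma argmax_drop S a m : a <= m -> exists i j, a <= i <= j /\ j <= m /\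
  forall i' j', a <= i' <= j' -> j' <= m -> S i' - S j' <= S i - S j.
Proof.
move=> am; have ma : - m <= - a by lia.
have [i [j [h1 [h2 h3]]]] := argmax_rise (mirror S) ma.
exists (- j), (- i); split; first lia; split; first lia.
move=> i' j' ai jm; have := h3 (- j') (- i'); rewrite /mirror !opprK; apply; lia.
Qed.

Lemma right_dropsP S V q : right_drops S V q <->
  (bot V <= q.1 /\ q.1 < q.2 <= rgt V) /\
  forall i j, bot V <= i <= j -> j <= rgt V -> S i - S j <= S q.1 - S q.2.
Proof.
rewrite /right_drops /=; split => -[qV qm]; split => //.
  move=> i j ai jm; rewrite qm.
  have am : bot V <= rgt V by lia.
  have [i0 [j0 [h1 [h2 h3]]]] := argmax_drop S am.
  apply: (@le_trans _ _ (S i0 - S j0)); first exact: h3.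
  rewrite (@sup_attained _ (S i0 - S j0)) //.
    by exists (i0, j0) => //=; lia.
  by move=> _ [[t1 t2] /= t12 <-]; apply: h3; lia.
rewrite (@sup_attained _ (S q.1 - S q.2)) //.
  by exists q => //=; lia.
by move=> _ [[t1 t2] /= t12 <-]; apply: qm; lia.
Qed.

Lemma nat_argmin (X : Type) (A : set X) (f : X -> nat) : A !=set0 ->
  exists x, A x /\ forall y, A y -> (f x <= f y)%N.
Proof.
move=> [x0 Ax0].
have ex : exists n, `[< exists2 x, A x & f x = n >].
  by exists (f x0); apply/asboolP; exists x0.
case: (ex_minnP ex) => n /asboolP [x Ax fx] mn.
by exists x; split => // y Ay; rewrite fx; apply: mn; apply/asboolP; exists y.
Qed.

Lemma smallest_pair_ex (A : set (int * int)) : A !=set0 -> exists q, smallest_pair A q.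
Proof.
move=> A0; have [x [Ax xm]] := nat_argmin (fun q : int * int => absz q.1) A0.
pose B := [set q | A q /\ absz q.1 = absz x.1].
have B0 : B !=set0 by exists x.
have [y [[Ay yx] ym]] := nat_argmin (fun q : int * int => absz q.2) B0.
exists y; split => // z Az; have := xm z Az; rewrite leq_eqVlt => /orP[/eqP E|lt].
  by right; have := ym z (conj Az (esym E)); lia.
by left; lia.
Qed.

Lemma valley_mirror S V : valley S V -> valley (mirror S) (mirrorV V).
Proof.
have pre S' a m c : pre_valley S' (Triplet a m c) ->
    pre_valley (mirror S') (Triplet (- c) (- m) (- a)).
  move=> /pre_valleyP [h1 h2 h3 h4]; apply/pre_valleyP; split; first lia.
  - by move=> t tt; rewrite /mirror opprK; apply: h3; lia.
  - by move=> t tt; rewrite /mirror opprK; apply: h2; lia.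
  - by move=> t tt; rewrite /mirror opprK; apply: h4; lia.
case: V => a m c [] /= h1 h2; split; first exact: pre.
move=> m' /= /pre; rewrite mirrorK !opprK => /h2; lia.
Qed.

Lemma smallest_mirror S V q : smallest_pair (right_drops S V) q ->
  smallest_pair (left_rises (mirror S) (mirrorV V)) (- q.1, - q.2).
Proof.
move=> [/right_dropsP [qV qm] sm]; split.
  apply/left_risesP => /=; split; first lia.
  by move=> i j ai jm; rewrite /mirror !opprK; apply: qm; lia.
move=> q' /left_risesP /= [q'V q'm].
have : right_drops S V (- q'.1, - q'.2).
  apply/right_dropsP => /=; split; first lia.
  move=> i j ai jm; have := q'm (- j) (- i); rewrite /mirror !opprK; apply; lia.
by move=> /sm /=; lia.
Qed.

Lemma smallest_mirror' S V q : smallest_pair (left_rises S V) q ->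
  smallest_pair (right_drops (mirror S) (mirrorV V)) (- q.1, - q.2).
Proof.
move=> [/left_risesP [qV qm] sm]; split.
  apply/right_dropsP => /=; split; first lia.
  by move=> i j ai jm; rewrite /mirror !opprK; apply: qm; lia.
move=> q' /right_dropsP /= [q'V q'm].
have : left_rises S V (- q'.1, - q'.2).
  apply/left_risesP => /=; split; first lia.
  move=> i j ai jm; have := q'm (- j) (- i); rewrite /mirror !opprK; apply; lia.
by move=> /sm /=; lia.
Qed.

Lemma refinement_mirror S V W : refinement S V W ->
  refinement (mirror S) (mirrorV V) (mirrorV W).
Proof.
elim => {V W} [V q|V q|V q|V q|V W Z _ h1 _ h2].
- by move=> /smallest_mirror /refine_left_inner.
- by move=> /smallest_mirror /refine_left_outer.
- by move=> /smallest_mirror' /refine_right_inner.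
- by move=> /smallest_mirror' /refine_right_outer.
- exact: refine_trans h1 h2.
Qed.

Section Deep.
Variables (gamma : R) (n : nat).
Let w := gamma * ilog R 2 n.
Let G := Gamma gamma n.

Lemma deep_valleyP S a m c : deep_valley gamma n S (Triplet a m c) <->
  [/\ valley S (Triplet a m c), a <= 0 <= c, G <= S a - S m /\ G <= S c - S m,
      m < 0 -> forall t, m <= t <= 0 -> w <= S c - S t &
      0 < m -> forall t, 0 <= t <= m -> w <= S a - S t].
Proof.
rewrite /deep_valley /depth /=; split => -[h1 h2 h3 h4 h5]; split => //.
- by move: h3; rewrite le_min => /andP.
- move=> m0 t tt; apply: le_trans (h4 m0) _.
  by rewrite lerD2l lerN2; exact: maxS_ub.
- move=> m0 t tt; apply: le_trans (h5 m0) _.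
  by rewrite lerD2l lerN2; exact: maxS_ub.
- by rewrite le_min; apply/andP.
- move=> m0; rewrite -/w lerBrDr -lerBrDl; apply: maxS_le; first lia.
  by move=> t /(h4 m0); lra.
- move=> m0; rewrite -/w lerBrDr -lerBrDl; apply: maxS_le; first lia.
  by move=> t /(h5 m0); lra.
Qed.

Lemma deep_mirror S V : deep_valley gamma n S V ->
  deep_valley gamma n (mirror S) (mirrorV V).
Proof.
case: V => a m c /deep_valleyP [h1 h2 h3 h4 h5]; apply/deep_valleyP => /=; split.
- exact: (@valley_mirror S (Triplet a m c)).
- lia.
- by rewrite /mirror !opprK; split; case: h3.
- by move=> m0 t tt; rewrite /mirror opprK; apply: h5; lia.
- by move=> m0 t tt; rewrite /mirror opprK; apply: h4; lia.
Qed.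

Lemma smallest_deep_mirror S V : smallest_deep_valley gamma n S V ->
  smallest_deep_valley gamma n (mirror S) (mirrorV V).
Proof.
move=> [dV rV]; split; first exact: deep_mirror.
move=> W /refinement_mirror; rewrite mirrorK mirrorVK => /rV nW /deep_mirror.
by rewrite mirrorK.
Qed.

(* The only way in which condition (3) fails for both valleys of a refinement:
   the barriers on the two sides of 0 differ by less than [w].  The windows
   [[k w, (k + 2) w)] overlap, so that both barriers lie in a common one. *)
Definition tie S := exists k : nat,
  let P Z := plunge (k%:R * w) (k.+2%:R * w) ((k.+3%:R * w - G) / 2) Z in
  P (fun t : nat => S t%:Z) /\ P (fun t : nat => S (- t%:Z)).

Lemma tie_mirror S : tie (mirror S) -> tie S.
Proof.
move=> [k [h1 h2]]; exists k; split => //.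
by move: h2; rewrite /mirror; under eq_fun do rewrite opprK.
Qed.

Hypothesis w_gt0 : 0 < w.
Hypothesis G_gt0 : 0 < G.

(** With M the larger barrier, M < (k + 2) w, and averaging the two bounds w and M - G on a bottom
    gives the depth ((k + 3) w - G) / 2 of [tie]. Averaging makes the fall from the barrier grow
    with both [k] and [G]: the first is needed to sum over [k], the second to make the sum small. *)
Lemma tie_intro S (i l r m : int) : S 0 = 0 -> i <= l <= 0 -> 0 <= r <= m ->
  (forall t, i <= t <= 0 -> S t <= S l) -> (forall t, 0 <= t <= m -> S t <= S r) ->
  `|S l - S r| < w -> S i <= w -> S m <= w ->
  S i <= Num.max (S l) (S r) - G -> S m <= Num.max (S l) (S r) - G -> tie S.
Proof.
move=> S0 il rm hl hr lr iw mw iG mG.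
have l0 : 0 <= S l by rewrite -[X in X <= _]S0; apply: hl; lia.
have r0 : 0 <= S r by rewrite -[X in X <= _]S0; apply: hr; lia.
have w0 := w_gt0; have G0 := G_gt0.
set M := Num.max _ _ in iG mG.
have lM : S l <= M by rewrite le_max lexx.
have rM : S r <= M by rewrite le_max lexx orbT.
(* [k] is one less than the integer part of M / w, or 0: the lower of the two maxima exceeds M - w,
   hence is still at least k w. *)
have [k [k1 k2 k3]] : exists k : nat, [/\ k%:R * w <= S l, k%:R * w <= S r & M < k.+2%:R * w].
  move: lr; rewrite ltr_norml => /andP[lr1 lr2].
  have M0 : 0 <= M / w by rewrite divr_ge0 //; lra.
  have Ml : M - w < S l by rewrite /M; case: (leP (S l) (S r)) => _; lra.
  have Mr : M - w < S r by rewrite /M; case: (leP (S l) (S r)) => _; lra.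
  have /andP[q1 q2] := truncn_itv M0.
  move: q1 q2; rewrite ler_pdivlMr // ltr_pdivrMr //.
  case: (Num.truncn _) => [|q] q1 q2.
    by exists 0%N; split; rewrite ?mul0r //; lra.
  exists q; move: q1 q2; rewrite -!natr1 => q1 q2; split; lra.
have [r' rE] : exists r' : nat, r = r' by exists `|r|%N; move: rm; clear; lia.
have [m' mE] : exists m' : nat, m = m' by exists `|m|%N; move: rm; clear; lia.
have [l' lE] : exists l' : nat, l = - l'%:Z by exists `|l|%N; move: il; clear; lia.
have [i' iE] : exists i' : nat, i = - i'%:Z by exists `|i|%N; move: il; clear; lia.
have rm' : (r' <= m')%N by move: rm; rewrite rE mE; clear; lia.
have li' : (l' <= i')%N by move: il; rewrite lE iE; clear; lia.
have E2 : k.+2%:R = k%:R + 2 :> R by rewrite -addn2 natrD.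
have E3 : k.+3%:R = k%:R + 3 :> R by rewrite -addn3 natrD.
subst r m l i; exists k; split.
  exists r', m'; split => //.
    by move: k3; rewrite E2 E3; lra.
  move=> j jm; apply: le_lt_trans k3; apply: le_trans rM; apply: hr.
  by move: jm; clear; lia.
exists l', i'; split => //.
  by move: k3; rewrite E2 E3; lra.
move=> j jm; apply: le_lt_trans k3; apply: le_trans lM; apply: hl.
by move: jm; clear; lia.
Qed.

(* If the largest rise exceeds [G], one of the two left refinements is again
   deep, unless the maxima of [S] on the two sides of 0 nearly coincide. *)
Lemma no_large_rise S a m c : S 0 = 0 -> ~ tie S ->
  smallest_deep_valley gamma n S (Triplet a m c) ->
  forall i j, a <= i <= j -> j <= m -> S j - S i < G.
Proof.
move=> S0 nt [/deep_valleyP [[/pre_valleyP [amc ha hc hm] tb] a0c [Ga Gc] h4 h5] rV].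
have am : a <= m by lia.
suff nG : forall q, smallest_pair (left_rises S (Triplet a m c)) q -> S q.1 - S q.2 < G.
  move=> i' j' ai' j'm.
  have [i [j [aij [jm mx]]]] := argmax_rise S am.
  rewrite ltNge; apply/negP => Gij.
  have G0 := G_gt0.
  have GG := le_trans Gij (mx _ _ ai' j'm).
  have ij : i != j by apply/eqP => E; move: GG; rewrite E subrr; lra.
  have : left_rises S (Triplet a m c) !=set0.
    by exists (j, i); apply/left_risesP => /=; split => //; lia.
  move=> /smallest_pair_ex [q sq]; have qG := nG q sq.
  case: sq => /left_risesP /= [_ qm] _.
  have := qm i j aij jm; lra.
move=> [j i] sq /=; rewrite ltNge; apply/negP => Gij.
have [/left_risesP /= [[ai ijm] mx] sm] := sq.
have G0 := G_gt0; have w0 := w_gt0.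
have Sj t : i <= t <= m -> S t <= S j.
  move=> tt; have : S t - S i <= S j - S i by apply: mx; lia.
  lra.
have Si t : a <= t <= j -> S i <= S t.
  move=> tt; have : S j - S t <= S j - S i by apply: mx; lia.
  lra.
have Sja : S j <= S a by apply: ha; lia.
have Sma : S m <= S i by apply: hm; lia.
(* [j] is the peak and [i] the foot of the largest rise; 0 lies in the outer piece if 0 <= j and in
   the inner one otherwise. The piece inherits everything except possibly condition (3), whose
   failure produces a tie. *)
case: (leP 0 j) => j0.
  have [ntie|[i0 [t [tt tj]]]] : (i < 0 -> forall t, i <= t <= 0 -> w <= S j - S t) \/
      (i < 0 /\ exists t, i <= t <= 0 /\ S j - S t < w).
    have [|nn] := pselect (i < 0 -> forall t, i <= t <= 0 -> w <= S j - S t); first by left.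
    right; move/not_implyP: nn => [i0 /existsNP [t /not_implyP [tt /negP]]].
    by rewrite -ltNge => ?; split => //; exists t.
    apply: (rV (Triplet a i j)).
      exact: (refine_left_outer sq).
    apply/deep_valleyP; split => //; last 3 first.
    - lia.
    - by split; [lra|].
    - by move=> i0 t tt; apply: h5; lia.
    - split => /=.
        apply/pre_valleyP; split => //; first lia.
          by move=> t tt; apply: ha; lia.
        by move=> t tt; apply: Sj; lia.
      (* Another bottom of the outer piece gives another pair with the largest rise, so the choice
         of the smallest pair is what makes [i] the correct bottom. *)
      move=> m' /pre_valleyP [am'j _ _ hm'].
      have E : S m' = S i.
        by apply/eqP; rewrite eq_le; apply/andP; split; [apply: hm'; lia|apply: Si; lia].
      have m'j : m' != j by apply/eqP => m'E; move: Gij; rewrite -E m'E subrr; lra.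
      have : left_rises S (Triplet a m c) (j, m').
        apply/left_risesP => /=; split; first lia.
        by rewrite E.
      by move=> /sm /=; lia.
  have i0' : i <= 0 by lia.
  have [l [il lm]] := argmax S i0'.
  apply: nt; apply: (@tie_intro S i l j m) => //; first by rewrite j0; case/andP: ijm.
  - by move=> u uu; apply: Sj; lia.
  - have h := lm t tt; have h' : S l <= S j by apply: Sj; move: il ijm j0; clear; lia.
    by rewrite ltr_norml; apply/andP; split; lra.
  - have : S i <= S 0 by apply: Si; lia.
    by rewrite S0; lra.
  - have : S i <= S 0 by apply: Si; lia.
    by rewrite S0; lra.
  - have : S j <= Num.max (S l) (S j) by rewrite le_max lexx orbT.
    by lra.
  - have : S j <= Num.max (S l) (S j) by rewrite le_max lexx orbT.
    by lra.
have [ntie|[m0 [t [tt tj]]]] : (0 < m -> forall t, 0 <= t <= m -> w <= S j - S t) \/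
    (0 < m /\ exists t, 0 <= t <= m /\ S j - S t < w).
  have [|nn] := pselect (0 < m -> forall t, 0 <= t <= m -> w <= S j - S t); first by left.
  right; move/not_implyP: nn => [i0 /existsNP [t /not_implyP [tt /negP]]].
  by rewrite -ltNge => ?; split => //; exists t.
  apply: (rV (Triplet j m c)).
    exact: (refine_left_inner sq).
  apply/deep_valleyP; split => //; last 2 first.
  - lia.
  - by split; [lra|].
  - split => /=.
      apply/pre_valleyP; split => //; first lia.
        by move=> t tt; apply: Sj; lia.
      by move=> t tt; apply: hm; lia.
    (* Another bottom of the inner piece is also one of the original valley, whose own choice of
       bottom settles the tie. *)
    move=> m' /pre_valleyP [jm'c hj' hc' hm'].
    apply: tb => /=; apply/pre_valleyP; split; first lia.
    + move=> t tt; have [tm|tm] : a <= t <= m \/ m <= t <= m' by lia.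
        exact: ha.
      apply: le_trans (hj' t _) Sja; lia.
    + by [].
    + move=> t tt; apply: le_trans (hm t tt); apply: hm'; lia.
have m0' : 0 <= m by lia.
have [r [rm rmx]] := argmax S m0'.
apply: nt; apply: (@tie_intro S i j r m) => //; first by move: ijm j0; clear; lia.
- by move=> u uu; apply: Sj; lia.
- have h := rmx t tt; have h' : S r <= S j by apply: Sj; lia.
  by rewrite ltr_norml; apply/andP; split; lra.
- have : S r - S 0 <= S j - S i by apply: mx; move: rm ai ijm j0 amc a0c; clear; lia.
  have := rmx t tt; rewrite S0; lra.
- have : S m <= S 0 by apply: hm; lia.
  by rewrite S0; lra.
- have : S j <= Num.max (S j) (S r) by rewrite le_max lexx.
  by lra.
- have : S j <= Num.max (S j) (S r) by rewrite le_max lexx.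
  by lra.
Qed.

(** All that the occupation estimates retain of a smallest deep valley: pointwise inequalities
    stable under reflection, with refinement replaced by the absence of large rises before the
    bottom and large drops after it. *)
Definition basin S (a m c : int) :=
  [/\ a <= m <= c, a <= 0 <= c,
      (forall t, a <= t <= m -> S t <= S a) /\ (forall t, m <= t <= c -> S t <= S c),
      forall t, a <= t <= c -> S m <= S t &
      [/\ G <= S a - S m, G <= S c - S m,
          m < 0 -> forall t, m <= t <= 0 -> w <= S c - S t,
          0 < m -> forall t, 0 <= t <= m -> w <= S a - S t &
          (forall i j, a <= i <= j -> j <= m -> S j - S i < G) /\
          (forall i j, m <= i <= j -> j <= c -> S i - S j < G)]].

Lemma smallest_deep_basin S a m c : S 0 = 0 -> ~ tie S ->
  smallest_deep_valley gamma n S (Triplet a m c) -> basin S a m c.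
Proof.
move=> S0 nt sV; have [/deep_valleyP [[/pre_valleyP [amc ha hc hm] _] ac [Ga Gc] h4 h5] _] := sV.
split=> //; split=> //; split; first exact: (no_large_rise S0 nt sV).
move=> i j mi jc.
have /no_large_rise := smallest_deep_mirror sV.
have mS0 : mirror S 0 = 0 by rewrite /mirror oppr0.
move=> /(_ mS0 (fun t => nt (tie_mirror t)) (- j) (- i)).
by rewrite /mirror !opprK /= => h; apply: h; move: mi jc; clear; lia.
Qed.

Lemma basin_mirror S a m c : basin S a m c -> basin (mirror S) (- c) (- m) (- a).
Proof.
move=> [h1 h2 [h3 h4] h5 [h6 h7 h8 h9 [h10 h11]]]; split.
- by move: h1; clear; lia.
- by move: h2; clear; lia.
- split => t tt; rewrite /mirror opprK; [apply: h4|apply: h3]; by move: tt; clear; lia.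
- by move=> t tt; rewrite /mirror opprK; apply: h5; move: tt; clear; lia.
split; rewrite /mirror ?opprK //.
- by move=> m0 t tt; apply: h9; move: tt m0; clear; lia.
- by move=> m0 t tt; apply: h8; move: tt m0; clear; lia.
split => i j ij jc; [apply: h11|apply: h10]; by move: ij jc; clear; lia.
Qed.

Lemma smallest_pre_valley S a m c : pre_valley S (Triplet a m c) ->
  exists m', valley S (Triplet a m' c) /\ S m' = S m.
Proof.
move=> Vm.
have [x [Vx xm]] := nat_argmin (A := [set x | pre_valley S (Triplet a x c)])
  (fun x : int => absz x) (ex_intro _ m Vm).
exists x; split; first by split => //= y /xm /=; clear; lia.
move: Vm Vx => /pre_valleyP [a1 _ _ h1] /pre_valleyP [a2 _ _ h2].
by apply/eqP; rewrite eq_le h1 ?h2.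
Qed.

Lemma refinement_width S V W : refinement S V W ->
  lft V <= bot V <= rgt V ->
  [/\ lft V <= lft W, rgt W <= rgt V, lft W <= bot W <= rgt W &
      (lft V < bot V < rgt V -> lft V < lft W \/ rgt W < rgt V)].
Proof.
elim => {V W} [V q|V q|V q|V q|V W Z _ h1 _ h2].
- by move=> [/right_dropsP [h _] _] /= h'; split; move: h h'; clear; lia.
- by move=> [/right_dropsP [h _] _] /= h'; split; move: h h'; clear; lia.
- by move=> [/left_risesP [h _] _] /= h'; split; move: h h'; clear; lia.
- by move=> [/left_risesP [h _] _] /= h'; split; move: h h'; clear; lia.
move=> /h1 [a1 a2 a3 a4]; have [b1 b2 b3 b4] := h2 a3.
by split; move: a1 a2 a3 a4 b1 b2 b3; clear; lia.
Qed.

Lemma deep_nondegenerate S V : deep_valley gamma n S V -> lft V < bot V < rgt V.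
Proof.
case: V => a m c /deep_valleyP [[/pre_valleyP [h _ _ _] _] _ [Ga Gc] _ _] /=.
have G0 := G_gt0.
rewrite !lt_neqAle; case/andP: h => -> ->; rewrite !andbT.
apply/andP; split; apply/eqP => E.
  by move: Ga; rewrite E subrr; lra.
by move: Gc; rewrite E subrr; lra.
Qed.

(** A deep valley of least width works: it is nondegenerate because [G] is positive, and a
    refinement of a nondegenerate valley is strictly narrower. *)
Lemma smallest_deep_ex S V : deep_valley gamma n S V ->
  exists V', smallest_deep_valley gamma n S V'.
Proof.
move=> dV.
have [x [dx xm]] := nat_argmin (A := [set x | deep_valley gamma n S x])
  (fun x => absz (rgt x - lft x)) (ex_intro _ V dV).
exists x; split => // y rxy dy.
have nx := deep_nondegenerate dx.
have hx : lft x <= bot x <= rgt x by move: nx; clear; lia.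
have [w1 w2 w3 w4] := refinement_width rxy hx.
by have := xm y dy; have := w4 nx; move: nx w1 w2 w3; clear; rewrite /=; lia.
Qed.

Lemma int_sup_ex (A : set int) x u : A x -> (forall y, A y -> y <= u) ->
  exists z, A z /\ supremums A z.
Proof.
move=> Ax Au.
have [z [Az zm]] := nat_argmin (fun y => `|u - y|%N) (ex_intro _ x Ax).
exists z; split => //; split.
  by move=> y Ay; have := zm y Ay; have := Au y Ay; have := Au z Az; clear; lia.
by move=> y; apply.
Qed.

Lemma int_inf_ex (A : set int) x u : A x -> (forall y, A y -> u <= y) ->
  exists z, A z /\ infimums A z.
Proof.
move=> Ax Au.
have [z [Az zm]] := nat_argmin (fun y => `|y - u|%N) (ex_intro _ x Ax).
exists z; split => //; split.
  by move=> y Ay; have := zm y Ay; have := Au y Ay; have := Au z Az; clear; lia.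
by move=> y; apply.
Qed.

(** The ends of the smallest deep valley are themselves candidates, so the supremum and the infimum
    are over nonempty sets of integers bounded by the bottom. *)
Lemma basic_valley_ex S V : smallest_deep_valley gamma n S V ->
  exists B, basic_valley gamma n S B.
Proof.
case: V => a m c sV.
have [dV _] := sV; have := deep_nondegenerate dV => /= /andP[am mc].
move: dV; rewrite /deep_valley /depth /= le_min => -[_ /andP[a0 c0] /andP[Ga Gc] h4 h5].
have [l [_ ls]] := @int_sup_ex (left_candidates gamma n S m) a m
  (And4 a0 am Ga h5) (fun y h => let: And4 _ h _ _ := h in ltW h).
have [r [_ rs]] := @int_inf_ex (right_candidates gamma n S m) c m
  (And4 c0 mc Gc h4) (fun y h => let: And4 _ h _ _ := h in ltW h).
by exists (Triplet l m r); split => //=; exists a, c.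
Qed.

Lemma first_nat (P : nat -> Prop) : (exists t, P t) ->
  exists t, P t /\ forall j, (j < t)%N -> ~ P j.
Proof.
move=> [t Pt]; have [x [Px xm]] := nat_argmin (A := [set t | P t]) id (ex_intro _ t Pt).
by exists x; split => // j jx /xm; rewrite leqNgt jx.
Qed.

(** The valley lies between the first points at height (k + 2) w on each side of 0. Its bottom is at
    most 0, so it is deep enough. A failure of condition (3) puts a barrier above k w in front of
    that bottom; as k w >= G, the depth in [plunge] is positive and the failure is a plunge. *)
Lemma deep_valley_ex S (k : nat) : S 0 = 0 -> G <= k%:R * w ->
  let P Z := plunge (k%:R * w) (k.+2%:R * w) ((k.+3%:R * w - G) / 2) Z in
  ~ P (fun t : nat => S t%:Z) -> ~ P (fun t : nat => S (- t%:Z)) ->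
  level (k.+2%:R * w) (fun t : nat => S t%:Z) ->
  level (k.+2%:R * w) (fun t : nat => S (- t%:Z)) ->
  exists V, deep_valley gamma n S V.
Proof.
move=> S0 Gk P nR nL /first_nat [r [Hr fr]] /first_nat [l [Hl fl]].
have w0 := w_gt0; have G0 := G_gt0.
have E2 : k.+2%:R = k%:R + 2 :> R by rewrite -addn2 natrD.
have E3 : k.+3%:R = k%:R + 3 :> R by rewrite -addn3 natrD.
have ltr t : (t < r)%N -> S t%:Z < k.+2%:R * w by move=> /fr /negP; rewrite -ltNge.
have ltl t : (t < l)%N -> S (- t%:Z) < k.+2%:R * w by move=> /fl /negP; rewrite -ltNge.
have lr : - l%:Z <= r%:Z by clear; lia.
have [m0 [m0lr m0m]] := argmin S lr.
have neg t : - l%:Z <= t <= 0 -> t != - l%:Z -> S t < k.+2%:R * w.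
  move=> tt tl; rewrite (_ : t = - `|t|%N%:Z); last by move: tt; clear; lia.
  by apply: ltl; move: tt tl; clear; lia.
have pos t : 0 <= t <= r%:Z -> t != r%:Z -> S t < k.+2%:R * w.
  move=> tt tl; rewrite (_ : t = `|t|%N%:Z); last by move: tt; clear; lia.
  by apply: ltr; move: tt tl; clear; lia.
have m00 : S m0 <= 0 by rewrite -[leRHS]S0; apply: m0m; clear; lia.
have H0 : 0 < k.+2%:R * w by rewrite mulr_gt0 // ltr0n.
have m0l : m0 != - l%:Z by apply/eqP => E; move: Hl; rewrite -E; lra.
have m0r : m0 != r%:Z by apply/eqP => E; move: Hr; rewrite -E; lra.
have all t : - l%:Z <= t <= r%:Z -> t != - l%:Z -> t != r%:Z -> S t < k.+2%:R * w.
  move=> tt t1 t2; have [tn|tp] : t <= 0 \/ 0 <= t by clear; lia.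
    by apply: neg => //; move: tt tn; clear; lia.
  by apply: pos => //; move: tt tp; clear; lia.
have /smallest_pre_valley [m [Vm Sm]] : pre_valley S (Triplet (- l%:Z) m0 r%:Z).
  apply/pre_valleyP; split => //.
    move=> t tt; have [->//|tl] := eqVneq t (- l%:Z).
    apply: le_trans Hl; apply/ltW/all => //; first by move: tt m0lr; clear; lia.
    by apply/eqP => E; move: tt m0lr m0r; rewrite E; clear; lia.
  move=> t tt; have [->//|tl] := eqVneq t r%:Z.
  apply: le_trans Hr; apply/ltW/all => //; first by move: tt m0lr; clear; lia.
  by apply/eqP => E; move: tt m0lr m0l; rewrite E; clear; lia.
have mlr : - l%:Z <= m <= r%:Z by case: Vm => /pre_valleyP [].
have ml : m != - l%:Z by apply/eqP => E; move: Hl; rewrite -E Sm; lra.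
have mr : m != r%:Z by apply/eqP => E; move: Hr; rewrite -E Sm; lra.
exists (Triplet (- l%:Z) m r%:Z); apply/deep_valleyP; split => //.
- by clear; lia.
- by rewrite Sm; split; lra.
- move=> mn t tt; rewrite leNgt; apply/negP => lt; apply: nL.
  exists `|t|%N, `|m|%N; split.
  + by move: tt mn; clear; lia.
  + rewrite (_ : - `|t|%N%:Z = t); last by move: tt; clear; lia.
    by move: Hr; rewrite E2; lra.
  + rewrite (_ : - `|m|%N%:Z = m); last by move: mn; clear; lia.
    by rewrite Sm E3; lra.
  + by move=> j jm; apply: ltl; move: jm mlr ml mn; clear; lia.
- move=> mn t tt; rewrite leNgt; apply/negP => lt; apply: nR.
  exists `|t|%N, `|m|%N; split.
  + by move: tt mn; clear; lia.
  + rewrite (_ : `|t|%N%:Z = t); last by move: tt; clear; lia.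
    by move: Hl; rewrite E2; lra.
  + rewrite (_ : `|m|%N%:Z = m); last by move: mn; clear; lia.
    by rewrite Sm E3; lra.
  + by move=> j jm; apply: ltr; move: jm mlr mr mn; clear; lia.
Qed.

End Deep.
End Extrema.

(** * Occupation times of the quenched chain *)

Section QuenchedWalk.
Context (R : realType) (a : int -> R).
Hypothesis a01 : forall x, 0 < a x < 1.
Implicit Types (f g : int -> R) (x y : int).

(** The transition operator: [iter k step f x] stands for the expectation of f at time [k] from [x].
    The estimates are made for this operator and are linked to the law of a chain only
    afterwards. *)
Definition step f x : R := a x * f (x + 1) + (1 - a x) * f (x - 1).

Lemma step_le f g : (forall x, f x <= g x) -> forall x, step f x <= step g x.
Proof.
move=> fg x; have /andP[? ?] := a01 x; rewrite /step.
by rewrite lerD // ler_wpM2l //; lra.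
Qed.

Lemma iter_step_le k f g : (forall x, f x <= g x) ->
  forall x, iter k step f x <= iter k step g x.
Proof. by move=> fg; elim: k => //= k IH; exact: step_le. Qed.

Lemma iter_stepD k f g x :
  iter k step (fun y => f y + g y) x = iter k step f x + iter k step g x.
Proof. by elim: k x => //= k IH x; rewrite /step !IH; ring. Qed.

Lemma iter_stepZ k (c : R) f x : iter k step (fun y => c * f y) x = c * iter k step f x.
Proof. by elim: k x => //= k IH x; rewrite /step !IH; ring. Qed.

Lemma iter_step_cst k (c : R) x : iter k step (fun=> c) x = c.
Proof. by elim: k x => //= k IH x; rewrite /step !IH; ring. Qed.

Lemma iter_step_sum k n (f : nat -> int -> R) x :
  iter k step (fun y => \sum_(i < n) f i y) x = \sum_(i < n) iter k step (f i) x.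
Proof.
elim: n => [|n IH].
  rewrite big_ord0 -[RHS](iter_step_cst k 0 x); congr (iter k step _ x).
  by apply/funext => y; rewrite big_ord0.
rewrite big_ord_recr /= -IH -iter_stepD; congr (iter k step _ x).
by apply/funext => y; rewrite big_ord_recr.
Qed.

Definition site y x : R := (x == y)%:R.

Lemma iter_step_ge0 k f x : (forall y, 0 <= f y) -> 0 <= iter k step f x.
Proof. by move=> f0; rewrite -[leLHS](iter_step_cst k 0 x); exact: iter_step_le. Qed.

Lemma iter_site_le1 k x y : iter k step (site y) x <= 1.
Proof.
rewrite -[leRHS](iter_step_cst k 1 x); apply: iter_step_le => z.
by rewrite /site; case: eqP.
Qed.

Lemma step_site y x :
  step (site y) x = a (y - 1) * site (y - 1) x + (1 - a (y + 1)) * site (y + 1) x.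
Proof.
rewrite /step /site.
have -> : (x + 1 == y) = (x == y - 1) by apply/eqP/eqP; clear; lia.
have -> : (x - 1 == y) = (x == y + 1) by apply/eqP/eqP; clear; lia.
by case: eqP => [->|_]; case: eqP => [->|_]; rewrite ?mulr0.
Qed.

Lemma iter_siteS k y x : iter k.+1 step (site y) x =
  a (y - 1) * iter k step (site (y - 1)) x
  + (1 - a (y + 1)) * iter k step (site (y + 1)) x.
Proof.
rewrite iterSr -!iter_stepZ -iter_stepD; congr (iter k step _ x).
by apply/funext => z; rewrite step_site.
Qed.

Variable r : int -> R.
Hypothesis r_gt0 : forall x, 0 < r x.
Hypothesis ar : forall x, a x * r x = (1 - a x) * r (x - 1).

(** [r x] is the resistance of the edge between x and x + 1, so [mu x] is the total conductance at
    [x]. Keeping [r] abstract lets the reflected environment be treated by the same lemmas. *)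
Definition mu x : R := (r x)^-1 + (r (x - 1))^-1.

Lemma mu_gt0 x : 0 < mu x.
Proof. by rewrite addr_gt0 ?invr_gt0. Qed.

Lemma mu_right x : mu x * a x = (r x)^-1.
Proof.
have r1 := r_gt0 x; have r2 := r_gt0 (x - 1); rewrite /mu.
have -> : a x = r (x - 1) / (r x + r (x - 1)).
  apply: (canRL (mulfK _)); first by rewrite gt_eqF // addr_gt0.
  by rewrite mulrDr ar; ring.
by field; rewrite !gt_eqF // addr_gt0.
Qed.

Lemma mu_left x : mu x * (1 - a x) = (r (x - 1))^-1.
Proof. by rewrite mulrBr mulr1 mu_right /mu addrAC subrr add0r. Qed.

Lemma reversible k x y : mu x * iter k step (site y) x = mu y * iter k step (site x) y.
Proof.
elim: k x y => [|k IH] x y /=.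
  by rewrite /site eq_sym; case: eqP => [->|]; rewrite ?mulr0.
rewrite -[step (iter k step (site x)) y]/(iter k.+1 step (site x) y) iter_siteS.
rewrite {1}/step mulrDr !mulrA mu_right mu_left.
have e1 : (r x)^-1 = mu (x + 1) * (1 - a (x + 1)) by rewrite mu_left addrK.
have e2 : (r (x - 1))^-1 = mu (x - 1) * a (x - 1) by rewrite mu_right.
have E1 : (r x)^-1 * iter k step (site y) (x + 1) =
    (1 - a (x + 1)) * (mu y * iter k step (site (x + 1)) y).
  by rewrite e1 mulrAC IH mulrC.
have E2 : (r (x - 1))^-1 * iter k step (site y) (x - 1) =
    a (x - 1) * (mu y * iter k step (site (x - 1)) y).
  by rewrite e2 mulrAC IH mulrC.
by rewrite E1 E2; ring.
Qed.

Lemma kernel_le k x y : iter k step (site y) x <= mu y / mu x.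
Proof.
rewrite ler_pdivlMr ?mu_gt0 // mulrC reversible ler_piMr ?(ltW (mu_gt0 _)) //.
exact: iter_site_le1.
Qed.

Definition outside l b x : R := (~~ (l <= x <= b))%:R.

(** A nearest-neighbour chain outside [l, b] must have visited [l] or [b] before; the right-hand
    side is the expected number of such visits. *)
Lemma exit_le l b k x : l <= x <= b -> iter k step (outside l b) x <=
  \sum_(i < k.+1) iter i step (fun y => site l y + site b y) x.
Proof.
elim: k x => [|k IH] x xlb.
  by rewrite big_ord1 /= /outside xlb /site addr_ge0.
have p0 y : 0 <= site l y + site b y by rewrite /site addr_ge0.
have [xe|xe] := boolP ((x == l) || (x == b)).
  apply: (@le_trans _ _ 1).
    rewrite -[leRHS](iter_step_cst k.+1 1 x); apply: iter_step_le => y.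
    by rewrite /outside; case: (_ <= _ <= _).
  rewrite big_ord_recl /= -[leLHS]addr0 lerD //.
    by move: xe; rewrite /site => /orP[] ->; [rewrite lerDl|rewrite lerDr].
  by apply: sumr_ge0 => i _; apply: (iter_step_ge0 i.+1).
rewrite [leLHS]/= big_ord_recl -[leLHS]add0r lerD //; first exact: p0.
rewrite (eq_bigr (fun i : 'I_k.+1 =>
   step (iter i step (fun y => site l y + site b y)) x)) //.
have -> : \sum_(i < k.+1) step (iter i step (fun y => site l y + site b y)) x =
  step (fun z => \sum_(i < k.+1) iter i step (fun y => site l y + site b y) z) x.
  exact: esym (iter_step_sum 1 k.+1
    (fun i => iter i step (fun y => site l y + site b y)) x).
have /andP[? ?] := a01 x.
rewrite /step lerD // ler_wpM2l //; try lra; apply: IH;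
  by move: xlb xe; clear; lia.
Qed.

(** The expected sum of [g] along the chain at times 1 to [n]; time 0 is left out, as in
    [local_time]. *)
Fixpoint occ g (n : nat) x : R :=
  if n is n'.+1 then step (fun y => g y + occ g n' y) x else 0.

Lemma occE g n x : occ g n x = \sum_(i < n) iter i.+1 step g x.
Proof.
elim: n x => [|n IH] x; first by rewrite big_ord0.
rewrite [occ _ _ _]/= big_ord_recl [LHS](iter_stepD 1) /=; congr (_ + _).
have -> : occ g n = fun x => \sum_(i < n) iter i.+1 step g x by apply/funext.
exact: (iter_step_sum 1 n (fun i => iter i.+1 step g)).
Qed.

Lemma occ_ge0 g n x : (forall y, 0 <= g y) -> 0 <= occ g n x.
Proof.
by move=> g0; rewrite occE sumr_ge0 // => j _; exact: (iter_step_ge0 _.+1).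
Qed.

Lemma occ_mono g n k x : (forall y, 0 <= g y) -> (k <= n)%N -> occ g k x <= occ g n x.
Proof.
move=> g0 kn; rewrite !occE -(subnKC kn) big_split_ord /= lerDl.
by apply: sumr_ge0 => i _; exact: (iter_step_ge0 _.+1).
Qed.

Lemma occ_le_n g n x : (forall y, g y <= 1) -> occ g n x <= n%:R.
Proof.
move=> g1; rewrite occE -[X in X%:R](card_ord n) -sumr_const.
by apply: ler_sum => i _; rewrite -[leRHS](iter_step_cst i.+1 1 x); exact: iter_step_le.
Qed.

(** Starting from the bottom, reversibility bounds the probability of being at y at any time by mu y
    / mu m. Inside [l, b] this is summed over the sites; being outside is charged to earlier visits
    to the two ends. *)
Lemma occ_bottom g n (l m b : int) (L : nat) (d d' : R) : l <= m -> m <= b ->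
  (forall y, 0 <= g y <= 1) -> b + 1 = l + L%:Z ->
  0 <= d -> (forall y, l <= y <= b -> g y * mu y <= d * mu m) ->
  mu l <= d' * mu m -> mu b <= d' * mu m ->
  occ g n m <= n%:R * (L%:R * d + n.+1%:R * (d' + d')).
Proof.
move=> lm mb g01 bL d0 gd ld bd.
have lmb : l <= m <= b by rewrite lm.
have mum := mu_gt0 m.
have pd y c : mu y <= c * mu m -> forall k, iter k step (site y) m <= c.
  by move=> yc k; rewrite (le_trans (kernel_le k m y)) // ler_pdivrMr.
have d'0 : 0 <= d'.
  by move: ld; have := mu_gt0 l; rewrite -(pmulr_lge0 d' mum); lra.
rewrite occE -[X in X%:R * _](card_ord n) mulr_natl -sumr_const.
apply: ler_sum => k _.
pose gin y : R := \sum_(i < L) g (l + i%:Z) * site (l + i%:Z) y.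
apply: (@le_trans _ _ (iter k.+1 step (fun y => gin y + outside l b y) m)).
  apply: iter_step_le => y; rewrite /outside.
  have gin0 : 0 <= gin y.
    apply: sumr_ge0 => i _; rewrite mulr_ge0 //; first by case/andP: (g01 (l + i%:Z)).
  case: (boolP (l <= y <= b)) => [yl|_]; last first.
    by rewrite -[leLHS]add0r lerD //; case/andP: (g01 y).
  have iL : (`|y - l| < L)%N by move: yl bL; clear; lia.
  have E : l + `|y - l|%N%:Z = y by move: yl; clear; lia.
  rewrite addr0 /gin (bigD1 (Ordinal iL)) //= E /site eqxx mulr1 lerDl.
  by apply: sumr_ge0 => i _; rewrite mulr_ge0 //; case/andP: (g01 (l + i%:Z)).
rewrite iter_stepD lerD //.
  rewrite (iter_step_sum k.+1 L (fun i y => g (l + i%:Z) * site (l + i%:Z) y)).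
  rewrite -[X in X%:R * _](card_ord L) mulr_natl -sumr_const.
  apply: ler_sum => i _; rewrite iter_stepZ.
  have yl : l <= l + i%:Z <= b by have := ltn_ord i; move: bL; clear; lia.
  apply: le_trans (ler_wpM2l _ (kernel_le _ _ _)) _.
    by case/andP: (g01 (l + i%:Z)).
  by rewrite mulrA ler_pdivrMr //; exact: gd.
apply: le_trans (exit_le _ lmb) _.
apply: (@le_trans _ _ (\sum_(i < k.+2) (d' + d'))).
  by apply: ler_sum => i _; rewrite iter_stepD lerD //; exact: pd.
have dd : 0 <= d' + d' by exact: addr_ge0.
rewrite sumr_const card_ord -[leLHS]mulr_natl; apply: ler_wpM2r => //.
by rewrite ler_nat ltnS; exact: ltn_ord.
Qed.

(* [H] has [step H = H - 1] and [q] is harmonic in the interior, so the right-hand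
   side is a supersolution of the recursion defining [occ]. *)
Lemma occ_hit g n (l : int) (M i0 : nat) (eta rho theta : R) :
  (forall y, 0 <= g y <= 1) -> (i0 < M)%N ->
  0 < eta -> (forall y, eta <= a y) -> 0 <= rho -> 0 <= theta ->
  (forall k j, (0 < k <= j)%N -> (j < M)%N -> r (l + j%:Z) <= rho * r (l + k%:Z)) ->
  (forall j, (i0 <= j < M)%N -> r (l + j%:Z) <= theta * r l) ->
  occ g n (l + i0%:Z) <=
  occ g n (l + M%:Z) + M%:R * (M%:R * (rho / eta)) + n%:R * (M%:R * theta).
Proof.
move=> g01 iM eta0 aeta rho0 theta0 hrho htheta.
have g0 y : 0 <= g y by case/andP: (g01 y).
have g1 y : g y <= 1 by case/andP: (g01 y).
(* [D] solves a_j D_j - (1 - a_j) D_(j-1) = 1 with D_0 = 0, so its sum [H] decreases by one on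
   average at each interior step; [q i] is the probability of hitting [l] before l + M from l +
   i. *)
pose D (j : nat) : R := \sum_(k < j) (a (l + k.+1%:Z))^-1 * (r (l + j%:Z) / r (l + k.+1%:Z)).
pose H i : R := \sum_(i <= j < M) D j.
pose Z : R := \sum_(0 <= j < M) r (l + j%:Z).
pose q i : R := (\sum_(i <= j < M) r (l + j%:Z)) / Z.
have Z0 : 0 < Z.
  rewrite /Z big_ltn ?(leq_ltn_trans _ iM) // ltr_pwDl // sumr_ge0 // => j _.
  exact: ltW.
have apos y : 0 < a y by case/andP: (a01 y).
have D0 j : 0 <= D j.
  apply: sumr_ge0 => k _; rewrite mulr_ge0 ?invr_ge0 ?(ltW (apos _)) //.
  by rewrite divr_ge0 // ltW.
have H0 i : 0 <= H i by apply: sumr_ge0.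
have q0 i : 0 <= q i.
  by rewrite divr_ge0 ?(ltW Z0) //; apply: sumr_ge0 => j _; exact: ltW.
have HS i : (i < M)%N -> H i = D i + H i.+1 by move=> ?; rewrite /H big_ltn.
have qS i : (i < M)%N -> q i = r (l + i%:Z) / Z + q i.+1.
  by move=> ?; rewrite /q big_ltn // mulrDl.
have DS i : a (l + i.+1%:Z) * D i.+1 - (1 - a (l + i.+1%:Z)) * D i = 1.
  rewrite /D big_ord_recr /= mulrDr divff ?gt_eqF // mulr1 mulfV ?gt_eqF //.
  rewrite addrAC -[RHS]add0r; congr (_ + _); apply/eqP; rewrite subr_eq0; apply/eqP.
  rewrite !mulr_sumr; apply: eq_bigr => k _.
  have := ar (l + i.+1%:Z).
  rewrite (_ : l + i.+1%:Z - 1 = l + i%:Z); last by clear; lia.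
  set ak := (a _)^-1; set rk := r (l + k.+1%:Z) => E.
  transitivity (a (l + i.+1%:Z) * r (l + i.+1%:Z) * (ak / rk)); first by ring.
  by rewrite E; ring.
have main k i : (k <= n)%N -> (i <= M)%N ->
    occ g k (l + i%:Z) <= occ g n (l + M%:Z) + H i + n%:R * q i.
  elim: k i => [|k IH] i kn iM'.
    have V0 : 0 <= occ g n (l + M%:Z) by exact: occ_ge0.
    by rewrite [occ _ 0 _]/=; apply: addr_ge0; [exact: addr_ge0|exact: mulr_ge0].
  move: iM'; rewrite leq_eqVlt => /orP[/eqP ->|iM'].
    have -> : H M = 0 by rewrite /H big_geq.
    have -> : q M = 0 by rewrite /q big_geq // mul0r.
    by rewrite mulr0 !addr0; exact: occ_mono.
  (* At the end [l] there is no recursion: q = 1 there, and n q absorbs the trivial bound [n] on the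
     occupation. *)
  case: i iM' => [|i] iM'.
    apply: (le_trans (occ_le_n _ _ g1)).
    have -> : q 0%N = 1 by rewrite /q divff // gt_eqF.
    by rewrite mulr1 -[leLHS]add0r lerD ?ler_nat //; apply: addr_ge0 => //; exact: occ_ge0.
  have a1 := a01 (l + i.+1%:Z); case/andP: a1 => a1 a2.
  have x1 : l + i.+1%:Z + 1 = l + i.+2%:Z by clear; lia.
  have x2 : l + i.+1%:Z - 1 = l + i%:Z by clear; lia.
  rewrite /= /step x1 x2.
  have I1 := IH i.+2 (ltnW kn) iM'; have I2 := IH i (ltnW kn) (ltnW (ltnW iM')).
  have J1 := g1 (l + i.+2%:Z); have J2 := g1 (l + i%:Z).
  set A := a _ in a1 a2 *; set V := occ g n _ in I1 I2 *.
  have K1 : A * (g (l + i.+2%:Z) + occ g k (l + i.+2%:Z)) <=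
    A * (1 + (V + H i.+2 + n%:R * q i.+2)) by rewrite ler_wpM2l ?lerD // ltW.
  have K2 : (1 - A) * (g (l + i%:Z) + occ g k (l + i%:Z)) <=
    (1 - A) * (1 + (V + H i + n%:R * q i)) by rewrite ler_wpM2l ?lerD //; lra.
  apply: (le_trans (lerD K1 K2)).
  have E1 := HS i.+1 iM'; have E2 := HS i (ltnW iM').
  have F1 := qS i.+1 iM'; have F2 := qS i (ltnW iM').
  have E3 := DS i; rewrite -/A in E3.
  have E4 : A * (r (l + i.+1%:Z) / Z) = (1 - A) * (r (l + i%:Z) / Z).
    by rewrite !mulrA ar x2.
  rewrite F2 E2 F1 E1.
  set h := H i.+2; set p := q i.+2; set R1 := r (l + i.+1%:Z) / Z in E4 *.
  set R0 := r (l + i%:Z) / Z in E4 *; set D1 := D i.+1 in E3 *.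
  set Di := D i in E3 *.
  rewrite le_eqVlt; apply/orP; left; apply/eqP.
  transitivity (V + (D1 + h) + n%:R * (R1 + p)
    + (1 - (A * D1 - (1 - A) * Di)) - n%:R * (A * R1 - (1 - A) * R0)); first ring.
  by rewrite E3 E4; ring.
have re0 : 0 <= rho / eta by rewrite divr_ge0 // ltW.
apply: (le_trans (main n i0 (leqnn n) (ltnW iM))).
rewrite -!addrA lerD2l lerD //.
  rewrite /H (le_trans (_ : _ <= \sum_(i0 <= j < M) (M%:R * (rho / eta)))) //.
    rewrite !big_nat; apply: ler_sum => j /andP[i0j jM].
    rewrite (le_trans (_ : _ <= \sum_(k < j) (rho / eta))) //.
      apply: ler_sum => k _; rewrite [leLHS]mulrC ler_pM ?invr_ge0 ?divr_ge0 //.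
      - exact: ltW.
      - exact: ltW.
      - exact: ltW.
      - by rewrite ler_pdivrMr //; apply: hrho; rewrite //= ltn_ord.
      - by rewrite lef_pV2 ?posrE.
    rewrite sumr_const card_ord -[leLHS]mulr_natl ler_wpM2r ?divr_ge0 ?(ltW eta0) //.
    by rewrite ler_nat ltnW.
  rewrite sumr_const_nat -[leLHS]mulr_natl ler_wpM2r ?(mulr_ge0 _ re0) //.
  by rewrite ler_nat leq_subr.
rewrite ler_wpM2l // /q ler_pdivrMr //.
apply: (@le_trans _ _ (M%:R * (theta * r l))).
  rewrite (le_trans (_ : _ <= \sum_(i0 <= j < M) (theta * r l))) //.
    by rewrite !big_nat; apply: ler_sum => j; exact: htheta.
  rewrite sumr_const_nat -[leLHS]mulr_natl ler_wpM2r ?mulr_ge0 ?(ltW (r_gt0 l)) //.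
  by rewrite ler_nat leq_subr.
rewrite mulrA ler_wpM2l ?mulr_ge0 //.
rewrite /Z big_ltn ?(leq_ltn_trans _ iM) // addr0 lerDl sumr_ge0 // => j _.
exact: ltW.
Qed.

End QuenchedWalk.

Lemma occ_mirror (R : realType) (a : int -> R) g n x :
  occ (fun y => 1 - a (- y)) (fun y => g (- y)) n x = occ a g n (- x).
Proof.
elim: n x => //= n IH x; rewrite /step !IH.
have -> : - (x + 1) = - x - 1 by rewrite opprD.
have -> : - (x - 1) = - x + 1 by rewrite opprB addrC.
by ring.
Qed.

(** * From the transition operator to the law of the chain *)

Section ChainLaw.
Context (R : realType) (a : int -> R) (x0 : int).
Hypothesis a01 : forall x, 0 < a x < 1.
Context d (T : measurableType d) (P : probability T R) (X : nat -> T -> int).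
Hypothesis wX : walk_in_environment a x0 P X.

Let mX k x : measurable [set u | X k u = x].
Proof. by case: wX. Qed.

Lemma meas_X (k : nat) (A : set int) : measurable [set u | A (X k u)].
Proof.
have -> : [set u | A (X k u)] = \bigcup_x [set u | X k u = x /\ A x].
  apply/seteqP; split => u /= => [Au|[x _ [-> //]]].
  by exists (X k u).
apply: countable_bigcupT_measurable => // x.
by apply: meas_and => //; exact: meas_const.
Qed.

Lemma meas_path k (c : nat -> int) : measurable [set u | forall i, (i <= k)%N -> X i u = c i].
Proof.
have -> : [set u | forall i, (i <= k)%N -> X i u = c i] =
   \bigcap_(i in [set i | (i <= k)%N]) [set u | X i u = c i].
  by apply/seteqP; split => u /= h i; [apply: h|apply: (h i)].
by apply: bigcap_measurable => //; exists 0%N.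
Qed.

(* Only the lower bound is needed, so the null set of paths with other jumps
   can be ignored. *)
Lemma path_law_ge j k (c : nat -> int) (A : set int) :
  pr P [set u | forall i, (i <= k)%N -> X i u = c i] * iter j (step a) \1_A (c k) <=
  pr P [set u | (forall i, (i <= k)%N -> X i u = c i) /\ A (X (k + j)%N u)].
Proof.
elim: j k c => [|j IH] k c.
  rewrite /= indicE addn0; have [cA|cA] := boolP (c k \in A).
    rewrite mulr1; apply: le_pr; first exact: meas_path.
      by apply: measurableI; [exact: meas_path|exact: meas_X].
    move=> u /= h; split => //; rewrite h //; move: cA; by rewrite inE.
  by rewrite mulr0; exact: pr_ge0.
pose c' y i := if (i <= k)%N then c i else y : int.
have cE y : [set u | forall i, (i <= k.+1)%N -> X i u = c' y i] =
    [set u | forall i, (i <= k)%N -> X i u = c i] `&` [set u | X k.+1 u = y].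
  apply/seteqP; split => u /= => [h|[h1 h2] i].
    split => [i ik|]; first by rewrite h ?leqW // /c' ik.
    by rewrite h // /c' ltnn.
  rewrite /c' leq_eqVlt => /orP[/eqP ->|ik]; first by rewrite ltnn.
  by rewrite -ltnS ik; apply: h1; rewrite -ltnS.
have mc y : pr P [set u | forall i, (i <= k.+1)%N -> X i u = c' y i] =
    pr P [set u | forall i, (i <= k)%N -> X i u = c i] * transition a (c k) y.
  have [_ _ /(_ k (c' y))] := wX.
  have -> : c' y k = c k by rewrite /c' leqnn.
  have -> : c' y k.+1 = y by rewrite /c' ltnn.
  rewrite (_ : [set u | forall i, (i <= k)%N -> X i u = c' y i] =
    [set u | forall i, (i <= k)%N -> X i u = c i]); last first.
    by apply/seteqP; split => u /= h i ik; have := h i ik; rewrite /c' ik.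
  have p1 := prE P (meas_path k.+1 (c' y)); have p2 := prE P (meas_path k c).
  by rewrite p1 p2 -EFinM => -[].
have I1 := IH k.+1 (c' (c k + 1)); have I2 := IH k.+1 (c' (c k - 1)).
rewrite !mc /c' ltnn !addSnnS in I1 I2.
have t1 : transition a (c k) (c k + 1) = a (c k) by rewrite /transition eqxx.
have t2 : transition a (c k) (c k - 1) = 1 - a (c k).
  rewrite /transition eqxx; case: eqP => // E; exfalso; move: E; clear; lia.
rewrite t1 in I1; rewrite t2 in I2.
set L := pr P _ in I1 I2 *.
rewrite -/(c' (c k + 1)) in I1; rewrite -/(c' (c k - 1)) in I2.
rewrite /= /step mulrDr !mulrA; apply: le_trans (lerD I1 I2) _.
set B1 := mkset _; set B2 := mkset _; set B := mkset _.
have mB y : measurable [set u | (forall i, (i <= k.+1)%N -> X i u = c' y i) /\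
    A (X (k + j.+1)%N u)].
  by apply: measurableI; [exact: meas_path|exact: meas_X].
have dB : [disjoint B1 & B2].
  apply/eqP; rewrite -subset0 => u [[h1 _] [h2 _]].
  have := h1 k.+1 (leqnn _); rewrite h2 // ltnn; clear; lia.
have : pr P (B1 `|` B2) <= pr P B.
  apply: le_pr.
  - by apply: measurableU; exact: mB.
  - by apply: measurableI; [exact: meas_path|exact: meas_X].
  - move=> u [] [h1 h2]; split => // i ik; have := h1 i (leqW ik);
    by rewrite ik.
apply: le_trans.
have mB1 : measurable B1 by exact: (mB (c k + 1)).
have mB2 : measurable B2 by exact: (mB (c k - 1)).
have mB12 : measurable (B1 `|` B2) by exact: measurableU.
rewrite -lee_fin EFinD -(prE P mB1) -(prE P mB2) -(prE P mB12).
by rewrite measureU //; apply/eqP.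
Qed.

Lemma law_ge j (A : set int) : iter j (step a) \1_A x0 <= pr P [set u | A (X j u)].
Proof.
have := path_law_ge j 0 (fun=> x0) A; rewrite add0n.
have -> : [set u | forall i, (i <= 0)%N -> X i u = x0] = [set u | X 0%N u = x0].
  apply/seteqP; split => u /= h; first exact: h.
  by move=> i; rewrite leqn0 => /eqP ->.
have P1 : P [set u | X 0%N u = x0] = 1%E by case: wX.
have -> : pr P [set u | X 0%N u = x0] = 1 by rewrite /pr P1.
rewrite mul1r => /le_trans; apply; apply: le_pr.
- by apply: measurableI; [exact: (meas_path 0 (fun=> x0))|exact: meas_X].
- exact: meas_X.
- by move=> u [].
Qed.

Lemma local_time_setE (F : set int) N u : finite_set F ->
  local_time_set R X F N u = \sum_(i < N) (\1_F (X i.+1 u) : R).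
Proof.
move=> finF; rewrite /local_time_set fsbig_finite //=.
under eq_bigr => j _ do rewrite /local_time natr_sum.
rewrite exchange_big /= big_add1 /= big_mkord; apply: eq_bigr => i _.
rewrite indicE.
have [XF|XF] := boolP (X i.+1 u \in F).
  have XF' : X i.+1 u \in finmap.enum_fset (fset_set F).
    by have := in_fset_set finF (X i.+1 u); rewrite XF.
  rewrite (bigD1_seq _ XF') ?finmap.fset_uniq //=.
  rewrite eqxx big1 ?addr0 // => j.
  by rewrite eq_sym => /negbTE ->.
rewrite big_seq big1 // => j; rewrite in_fset_set // => jF.
by case: eqP => // E; move: XF; rewrite E jF.
Qed.

Lemma local_time_law (F : set int) N (delta : R) : finite_set F -> (0 < N)%N -> 0 < delta ->
  ((1 - occ a (\1_(~` F)) N x0 / (N%:R * delta))%:E <=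
   P [set u | (1 - delta <= local_time_set R X F N u / N%:R)%R])%E.
Proof.
move=> finF N0 d0.
have NR : 0 < N%:R :> R by rewrite ltr0n.
have bI (A : set int) i : bounded_measurable (fun u => \1_A (X i u) : R).
  have -> : (fun u => \1_A (X i u) : R) = \1_[set u | A (X i u)].
    by apply/funext => u; rewrite !indicE; congr (nat_of_bool _)%:R; apply/idP/idP;
      rewrite !inE.
  by apply: bm_indic; exact: meas_X.
have mI (A : set int) i : mean P (fun u => \1_A (X i u) : R) = pr P [set u | A (X i u)].
  rewrite -mean_indic; last exact: meas_X.
  by congr mean; apply/funext => u; rewrite !indicE; congr (nat_of_bool _)%:R;
    apply/idP/idP; rewrite !inE.
pose M u : R := \sum_(i < N) \1_(~` F) (X i.+1 u).
have bM n : bounded_measurable (fun u => \sum_(i < n) (\1_(~` F) (X i.+1 u) : R)).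
  elim: n => [|n IH].
    by under eq_fun do rewrite big_ord0; exact: bm_cst.
  by under eq_fun do rewrite big_ord_recr /=; apply: bmD.
have mM n : mean P (fun u => \sum_(i < n) (\1_(~` F) (X i.+1 u) : R)) =
    \sum_(i < n) pr P [set u | (~` F) (X i.+1 u)].
  elim: n => [|n IH].
    by under eq_fun do rewrite big_ord0; rewrite mean_cst big_ord0.
  under eq_fun do rewrite big_ord_recr /=.
  by rewrite (meanD P (bM n) (bI (~` F) n.+1)) (mI (~` F) n.+1) IH big_ord_recr.
(* The law is only bounded from below; since the two iterates sum to 1, a lower bound for [F] is an
   upper bound for its complement. *)
have cF i : pr P [set u | (~` F) (X i u)] <= iter i (step a) (\1_(~` F)) x0.
  have -> : [set u | (~` F) (X i u)] = ~` [set u | F (X i u)] by [].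
  rewrite prC; last exact: meas_X.
  have := law_ge i F.
  have <- : iter i (step a) \1_F x0 + iter i (step a) \1_(~` F) x0 = 1.
    rewrite -iter_stepD -[RHS](iter_step_cst a i 1 x0); congr (iter i (step a) _ x0).
    apply/funext => y; rewrite !indicE in_setC; case: (y \in F); by rewrite ?addr0 ?add0r.
  lra.
have LM u : local_time_set R X F N u = N%:R - M u.
  apply/eqP; rewrite eq_sym subr_eq eq_sym local_time_setE // -big_split /=.
  rewrite -[X in _ == X%:R](card_ord N) -sumr_const; apply/eqP; apply: eq_bigr => i _.
  by rewrite !indicE in_setC; case: (_ \in F); rewrite ?addr0 ?add0r.
set A := mkset _.
have AE : A = [set u | M u <= N%:R * delta].
  apply/seteqP; split => u; rewrite /A /= LM lerBlDr -lerBlDl ?mulrBl ?divff ?gt_eqF //.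
    rewrite opprB addrCA subrr addr0 ler_pdivrMr //; by rewrite mulrC.
  by rewrite opprB addrCA subrr addr0 ler_pdivrMr // mulrC.
have mA : measurable A by rewrite AE; apply: meas_le; case: (bM N).
rewrite (prE P mA) lee_fin.
suff : pr P (~` A) <= occ a (\1_(~` F)) N x0 / (N%:R * delta) by rewrite prC //; lra.
rewrite ler_pdivlMr ?mulr_gt0 //.
apply: (@le_trans _ _ (mean P M)).
  have mA' : measurable (~` A) by exact: measurableC.
  rewrite -(mean_indic P mA') mulrC -meanZ; last exact: bm_indic.
  apply: ler_mean => [||u].
  - by apply: bmM; [exact: bm_cst|apply: bm_indic; exact: measurableC].
  - exact: bM.
  - rewrite indicE in_setC; have [uA|uA] := boolP (u \in A).
      by rewrite mulr0; apply: sumr_ge0.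
    rewrite mulr1 ltW // ltNge; apply/negP => h; move/negP: uA; apply.
    by rewrite inE AE.
rewrite /M mM occE; apply: ler_sum => i _; exact: cF.
Qed.

End ChainLaw.

(** * Occupation of a valley *)

Section GoodPotential.
Context (R : realType).
Implicit Types (S : int -> R).

Definition right_path S (i : int) (t : nat) : R := S (i + t%:Z) - S i.
Definition left_path S (i : int) (t : nat) : R := S (i - t%:Z) - S i.

(** Each forbidden pair couples one path from a site with the opposite one, so that its probability
    factorises; all sites of [-N, N] are covered because the relevant site depends on [S]. The last
    two conditions confine the valley to the window. *)
Definition good_potential (G h1 s : R) (f N : nat) S :=
  [/\ forall i, - N%:Z <= i <= N%:Z ->
        ~ (reach G 0 (left_path S i) /\ dip f s G (right_path S i)) /\
        ~ (reach G 0 (right_path S i) /\ dip f s G (left_path S i)),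
      forall i, - N%:Z <= i <= N%:Z ->
        ~ (reach h1 0 (left_path S i) /\ relapse h1 G (right_path S i)) /\
        ~ (reach h1 0 (right_path S i) /\ relapse h1 G (left_path S i)),
      climbs G N (right_path S 0) /\ climbs G N (fun t => - right_path S 0 t) &
      climbs G N (left_path S 0) /\ climbs G N (fun t => - left_path S 0 t)].

Lemma right_mirror S i : right_path (mirror S) i = left_path S (- i).
Proof. by apply/funext => t; rewrite /right_path /left_path /mirror opprD. Qed.

Lemma left_mirror S i : left_path (mirror S) i = right_path S (- i).
Proof.
apply/funext => t; rewrite /right_path /left_path /mirror.
by congr (S _ - _); rewrite opprB addrC.
Qed.

Lemma good_mirror G h1 s f N S :
  good_potential G h1 s f N S -> good_potential G h1 s f N (mirror S).
Proof.
move=> [h2 h3 [h4 h5] [h6 h7]]; split.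
- move=> i iN; rewrite right_mirror left_mirror; have [] := h2 (- i) => //.
  by move: iN; clear; lia.
- move=> i iN; rewrite right_mirror left_mirror; have [] := h3 (- i) => //.
  by move: iN; clear; lia.
- by rewrite right_mirror oppr0.
- by rewrite left_mirror oppr0.
Qed.

Variables (gamma : R) (n : nat).
Let w := gamma * ilog R 2 n.
Let G := Gamma gamma n.
Variables (h1 s b eta : R) (f N : nat) (S : int -> R) (a r : int -> R).
Hypothesis h1_gt0 : 0 < h1.
Hypothesis goodS : good_potential G h1 s f N S.
Hypothesis a01 : forall x, 0 < a x < 1.
Hypothesis eta_gt0 : 0 < eta.
Hypothesis a_eta : forall x, eta <= a x.
Hypothesis r_gt0 : forall x, 0 < r x.
Hypothesis ar : forall x, a x * r x = (1 - a x) * r (x - 1).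
Hypothesis rS : forall x, expR (S x - b) <= r x <= expR (S x + b).
Hypothesis Sb : forall x, `|S x - S (x - 1)| <= b.

Variables (l m c : int).
Hypothesis bas : basin gamma n S l m c.
Hypothesis m_ge0 : 0 <= m.

Let lmc : l <= m <= c. Proof. by case: bas. Qed.
Let l0c : l <= 0 <= c. Proof. by case: bas. Qed.
Let Sl t : l <= t <= m -> S t <= S l. Proof. by case: bas => _ _ [h _] _ _; exact: h. Qed.
Let Sm t : l <= t <= c -> S m <= S t. Proof. by case: bas => _ _ _ h _; exact: h. Qed.
Let lG : G <= S l - S m. Proof. by case: bas => _ _ _ _ []. Qed.
Let cG : G <= S c - S m. Proof. by case: bas => _ _ _ _ []. Qed.
Let rise i j : l <= i <= j -> j <= m -> S j - S i < G.
Proof. by case: bas => _ _ _ _ [_ _ _ _ [h _]]; exact: h. Qed.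
Let barrier t : 0 < m -> 0 <= t <= m -> w <= S l - S t.
Proof. by case: bas => _ _ _ _ [_ _ _ h _]; move=> *; exact: h. Qed.

(** The left path of 0 has a drop of size [G] within [N] steps, that is a rise of the potential in
    [-N, 0]; a left end beyond the window would put it inside the valley, before the bottom. *)
Lemma basin_left : - N%:Z <= l.
Proof.
have [_ _ _ [_ [i [j [ij jN]]]]] := goodS.
rewrite /left_path !sub0r => Gij; rewrite leNgt; apply/negP => lN.
suff : S (- i%:Z) - S (- j%:Z) < G by lra.
by apply: rise; move: ij jN lN m_ge0; clear; lia.
Qed.

Lemma basin_climb : exists i j : nat, [/\ (i <= j <= N)%N, m < j%:Z & G <= S j%:Z - S i%:Z].
Proof.
have [_ _ [[i [j [ij jN Gij]]] _] _] := goodS.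
move: Gij; rewrite /right_path !add0r => Gij; exists i, j; split; first by rewrite ij.
  rewrite ltNge; apply/negP => jm.
  suff : S j%:Z - S i%:Z < G by lra.
  by apply: rise; move: ij jN jm l0c; clear; lia.
by lra.
Qed.

Lemma basin_bottom_le : m <= N%:Z.
Proof. by have [i [j [ijN mj _]]] := basin_climb; move: ijN mj; clear; lia. Qed.

(** The end [c] is not shown to lie in the window. It is replaced by the first point at height [G]
    above the bottom, which does, by the climb of [basin_climb]. *)
Lemma basin_right_end : exists u : nat, [/\ m + u%:Z <= c, m + u%:Z <= N%:Z,
  G <= S (m + u%:Z) - S m & reach G 0 (right_path S m)].
Proof.
have [|u [uG fu]] := @first_nat (fun u : nat => G <= S (m + u%:Z) - S m).
  exists `|c - m|%N; rewrite (_ : m + `|c - m|%N%:Z = c) //.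
  by move: lmc; clear; lia.
have uc : m + u%:Z <= c.
  rewrite leNgt; apply/negP => cu; apply: (fu `|c - m|%N).
    by move: cu lmc; clear; lia.
  rewrite (_ : m + `|c - m|%N%:Z = c) //; by move: lmc; clear; lia.
exists u; split => //.
  have [i [j [ijN mj Gij]]] := basin_climb.
  rewrite leNgt; apply/negP => uN; apply: (fu `|j%:Z - m|%N).
    by move: ijN mj uN; clear; lia.
  rewrite (_ : m + `|j%:Z - m|%N%:Z = j%:Z); last by move: mj; clear; lia.
  have : S m <= S i%:Z by apply: Sm; move: l0c ijN mj uN uc; clear; lia.
  by lra.
exists u; split => // j ju; rewrite oppr0 /right_path subr_ge0; apply: Sm.
by move: lmc ju uc; clear; lia.
Qed.

Lemma basin_left_end : exists u : nat, [/\ l <= m - u%:Z,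
  G <= S (m - u%:Z) - S m & reach G 0 (left_path S m)].
Proof.
have lE : m - `|m - l|%N%:Z = l by move: lmc; clear; lia.
exists `|m - l|%N; rewrite lE; split => //.
exists `|m - l|%N; rewrite /left_path lE; split => // j jml.
by rewrite oppr0 subr_ge0; apply: Sm; move: jml lmc; clear; lia.
Qed.

(** Improves the bound [G] on rises to [h1]. From the foot of the largest rise the potential gains
    [h1] on both sides without passing below the foot, and on the right it comes back to that level
    at [m]; this is a forbidden relapse. *)
Lemma basin_small_rise i j : l <= i <= j -> j <= m -> S j - S i < h1.
Proof.
move=> lij jm; have lm : l <= m by case/andP: lmc.
have [i0 [j0 [li0 [j0m mx]]]] := argmax_rise S lm.
apply: le_lt_trans (mx _ _ lij jm) _; rewrite ltNge; apply/negP => hij.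
have [_ h3 _ _] := goodS.
have i0j0 : i0 < j0.
  rewrite lt_neqAle; apply/andP; split; last by case/andP: li0.
  by apply/eqP => E; move: hij; rewrite E subrr; have := h1_gt0; lra.
have Sj0 t : i0 <= t <= m -> S t <= S j0.
  move=> tt; have : S t - S i0 <= S j0 - S i0.
    by apply: mx; move: tt li0; clear; lia.
  lra.
have Si0 t : l <= t <= j0 -> S i0 <= S t.
  move=> tt; have : S j0 - S t <= S j0 - S i0.
    by apply: mx; move: tt j0m; clear; lia.
  lra.
have [|h3' _] := h3 i0.
  by have := basin_left; have := basin_bottom_le; move: li0 j0m; clear; lia.
apply: h3'; split.
  exists `|i0 - l|%N; rewrite /left_path; split.
    rewrite (_ : i0 - `|i0 - l|%N%:Z = l); last by move: li0; clear; lia.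
    have : S j0 <= S l by apply: Sl; move: li0 j0m; clear; lia.
    lra.
  move=> j1 j1l; rewrite oppr0 subr_ge0; apply: Si0.
  by move: j1l li0; clear; lia.
exists `|j0 - i0|%N, `|m - i0|%N; rewrite /right_path; split.
- by move: li0 j0m; clear; lia.
- by rewrite (_ : i0 + `|j0 - i0|%N%:Z = j0) //; move: li0; clear; lia.
- by move=> k kj; rewrite subr_ge0; apply: Si0; move: kj li0; clear; lia.
- rewrite (_ : i0 + `|m - i0|%N%:Z = m); last by move: li0 j0m; clear; lia.
  by rewrite subr_le0; apply: Sm; move: li0 j0m lmc; clear; lia.
- move=> k km; apply: rise; move: km li0 j0m; clear; lia.
Qed.

(** A low site farther than [f] from the bottom would be a dip of the right path, while the left
    path reaches [G]: a forbidden pair. *)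
Lemma basin_far y : S y - S m <= s -> (exists u : nat, [/\ m + u%:Z <= c,
    G <= S (m + u%:Z) - S m & m <= y <= m + u%:Z]) -> y <= m + f%:Z.
Proof.
move=> ys [u [uc uG mu]]; rewrite leNgt; apply/negP => fy.
have [h2 _ _ _] := goodS.
have [|h2' _] := h2 m.
  by have := basin_left; have := basin_bottom_le; move: lmc; clear; lia.
apply: h2'; split; first by have [? []] := basin_left_end.
exists `|y - m|%N, u; rewrite /right_path; split => //.
- by move: fy mu; clear; lia.
- by move: fy mu; clear; lia.
- by rewrite (_ : m + `|y - m|%N%:Z = y) //; move: mu; clear; lia.
- by move=> j ju; rewrite subr_ge0; apply: Sm; move: ju uc lmc; clear; lia.
Qed.

Lemma basin_far_left y : S y - S m <= s -> (exists u : nat, [/\ l <= m - u%:Z,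
    G <= S (m - u%:Z) - S m & m - u%:Z <= y <= m]) -> m - f%:Z <= y.
Proof.
move=> ys [u [uc uG mu]]; rewrite leNgt; apply/negP => fy.
have [h2 _ _ _] := goodS.
have [|_ h2'] := h2 m.
  by have := basin_left; have := basin_bottom_le; move: lmc; clear; lia.
apply: h2'; split; first by have [? []] := basin_right_end.
exists `|y - m|%N, u; rewrite /left_path; split => //.
- by move: fy mu; clear; lia.
- by move: fy mu; clear; lia.
- by rewrite (_ : m - `|y - m|%N%:Z = y) //; move: mu; clear; lia.
- by move=> j ju; rewrite subr_ge0; apply: Sm; move: ju uc lmc; clear; lia.
Qed.

(** Each of the two conductances at y costs 2 b against exp(- S y), and one at [m] costs b. The
    slack in [rS] accommodates the reflected resistances, which are shifted by one edge. *)
Lemma mu_ratio y : mu r y <= 2 * expR (3 * b) * expR (S m - S y) * mu r m.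
Proof.
have inv x : (r x)^-1 <= expR (b - S x).
  have /andP[h _] := rS x; rewrite -[b - S x]opprB expRN lef_pV2 ?posrE //.
  exact: expR_gt0.
have mm : expR (- b - S m) <= mu r m.
  have /andP[_ h] := rS m.
  apply: (@le_trans _ _ (r m)^-1); last by rewrite /mu lerDl invr_ge0 ltW.
  by rewrite -opprD addrC expRN lef_pV2 ?posrE ?expR_gt0.
have h2 := Sb y; move: h2; rewrite ler_norml => /andP[h2 h2'].
have b0 : 0 <= b by have := Sb y; apply: le_trans.
have e2 : (r (y - 1))^-1 <= expR (2 * b - S y).
  by apply: (le_trans (inv _)); rewrite ler_expR; lra.
have e1 : (r y)^-1 <= expR (2 * b - S y).
  by apply: (le_trans (inv _)); rewrite ler_expR; lra.
apply: (@le_trans _ _ (2 * expR (3 * b) * expR (S m - S y) * expR (- b - S m))).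
  rewrite -mulrA -expRD -mulrA -expRD.
  rewrite (_ : 3 * b + _ = 2 * b - S y); last by ring.
  by rewrite /mu; lra.
by apply: ler_wpM2l => //; rewrite !mulr_ge0 ?expR_ge0.
Qed.

Let C := 2 * expR (3 * b).

(** In order: time at valley sites outside the target set, time after leaving through an end, time
    to travel from 0 to [m], and the loss [n] if the far end is hit before [m]. *)
Definition occ_bound : R := n%:R * ((2 * N + 1)%:R * (C * expR (- s))
     + n.+1%:R * (C * expR (- G) + C * expR (- G)))
   + ((2 * N)%:R * ((2 * N)%:R * (expR (2 * b + h1) / eta)) + n%:R * ((2 * N)%:R * expR (2 * b - w))).

Lemma occ_basin :
  occ a (fun y => (~~ (m - f%:Z <= y <= m + f%:Z))%:R) n 0 <= occ_bound.
Proof.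
set g := fun y : int => _.
have g01 y : 0 <= g y <= 1 by rewrite /g ler0n lern1 leq_b1.
have C0 : 0 <= C by rewrite mulr_ge0 ?expR_ge0.
have Cd y (e : R) : e <= S y - S m -> mu r y <= C * expR (- e) * mu r m.
  move=> ey; apply: le_trans (mu_ratio y) _; rewrite ler_wpM2r ?(ltW (mu_gt0 r_gt0 _)) //.
  by rewrite ler_wpM2l // ler_expR; lra.
have [u [uc uN uG _]] := basin_right_end.
have [v [vl vG _]] := basin_left_end.
have bN := basin_left.
have bottom : occ a g n m <= n%:R * ((2 * N + 1)%:R * (C * expR (- s))
     + n.+1%:R * (C * expR (- G) + C * expR (- G))).
  have LE : m + u%:Z + 1 = m - v%:Z + (u + v + 1)%N%:Z by clear; lia.
  have mv : m - v%:Z <= m by clear; lia.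
  have mu' : m <= m + u%:Z by clear; lia.
  apply: le_trans (occ_bottom (r := r) a01 r_gt0 ar n mv mu' g01 LE
     (_ : 0 <= C * expR (- s)) _ (Cd _ G vG) (Cd _ G uG)) _.
  - by rewrite mulr_ge0 ?expR_ge0.
  - move=> y yy; rewrite /g; case: (boolP (m - f%:Z <= y <= m + f%:Z)) => yf.
      by rewrite mul0r !mulr_ge0 ?expR_ge0 // ltW // mu_gt0.
    rewrite mul1r; apply: Cd; rewrite leNgt; apply/negP => ys.
    move/negP: yf; apply; apply/andP; split.
      case: (leP m y) => ym; first by move: ym; clear; lia.
      apply: (basin_far_left (ltW ys)); exists v; split => //.
      by move: yy ym; clear; lia.
    case: (leP y m) => ym; first by move: ym; clear; lia.
    apply: (basin_far (ltW ys)); exists u; split => //.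
    by move: yy ym; clear; lia.
  - apply: ler_wpM2l => //; apply: lerD => //.
    apply: ler_wpM2r; first by rewrite mulr_ge0 ?expR_ge0.
    by rewrite ler_nat; move: bN vl uN; clear; lia.
rewrite /occ_bound; move: m_ge0; rewrite le_eqVlt => /orP[/eqP m0|m0].
  rewrite {1}m0; apply: (le_trans bottom).
  by rewrite lerDl addr_ge0 ?mulr_ge0 ?invr_ge0 ?expR_ge0 ?(ltW eta_gt0).
have lE0 : l + `|l|%N%:Z = 0 by move: l0c; clear; lia.
have lEm : l + `|m - l|%N%:Z = m by move: lmc; clear; lia.
have iM : (`|l| < `|m - l|)%N by move: l0c m0; clear; lia.
have := @occ_hit _ _ a01 _ r_gt0 ar g n l `|m - l|%N `|l|%N eta (expR (2 * b + h1))
   (expR (2 * b - w)) g01 iM eta_gt0 a_eta (expR_ge0 _) (expR_ge0 _).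
rewrite lE0 lEm => hit.
have MN : (`|m - l| <= 2 * N)%N.
  by have := basin_bottom_le; move: bN l0c lmc; clear; lia.
have rr x y (e : R) : S x - S y <= e -> r x <= expR (2 * b + e) * r y.
  move=> xy; have /andP[_ hx] := rS x; have /andP[hy _] := rS y.
  apply: (le_trans hx); apply: (@le_trans _ _ (expR (2 * b + e) * expR (S y - b))).
    by rewrite -expRD ler_expR; lra.
  by rewrite ler_wpM2l ?expR_ge0.
apply: (le_trans (hit _ _)).
- move=> k j kj jM; apply: rr; apply: ltW; apply: basin_small_rise.
    by move: kj jM lmc; clear; lia.
  by move: kj jM lmc; clear; lia.
- move=> j jM; apply: rr; rewrite -opprB lerN2; apply: barrier => //.
  by move: jM l0c lmc; clear; lia.
rewrite -addrA lerD // lerD //.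
  have re0 : 0 <= expR (2 * b + h1) / eta by rewrite divr_ge0 ?expR_ge0 // ltW.
  apply: ler_pM; rewrite ?(mulr_ge0 _ re0) ?ler_nat //.
  by apply: ler_wpM2r; rewrite ?ler_nat.
by rewrite ler_wpM2l // ler_wpM2r ?expR_ge0 ?ler_nat.
Qed.

End GoodPotential.

Section Environment.
Context (R : realType) (a : int -> R) (eta : R).
Hypothesis eta_gt0 : 0 < eta.
Hypothesis a_eta : forall x, eta <= a x <= 1 - eta.

Let S := potential a.
Definition osc : R := ln (1 - eta) - ln eta.

Let a01 x : 0 < a x < 1.
Proof. by have := eta_gt0; have := a_eta x => /andP[? ?] ?; apply/andP; split; lra. Qed.

Lemma eps_ln x : eps a x = ln (1 - a x) - ln (a x).
Proof. by have /andP[? ?] := a01 x; rewrite /eps ln_div ?posrE //; lra. Qed.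

Lemma eps_le x : `|eps a x| <= osc.
Proof.
have /andP[h1 h2] := a01 x; have /andP[h3 h4] := a_eta x; have h5 := eta_gt0.
have k1 : ln eta <= ln (a x) by rewrite ler_ln ?posrE.
have k2 : ln eta <= ln (1 - a x) by rewrite ler_ln ?posrE; lra.
have k3 : ln (a x) <= ln (1 - eta) by rewrite ler_ln ?posrE; lra.
have k4 : ln (1 - a x) <= ln (1 - eta) by rewrite ler_ln ?posrE; lra.
by rewrite eps_ln /osc ler_norml; apply/andP; split; lra.
Qed.

Lemma potential_pred x : S x = S (x - 1) + eps a x.
Proof. by have := potentialS a (x - 1); rewrite subrK. Qed.

Lemma potential0 : S 0 = 0.
Proof. by rewrite /S /= big_geq. Qed.

Lemma detailed_balance x : a x * expR (S x) = (1 - a x) * expR (S (x - 1)).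
Proof.
have /andP[h1 h2] := a01 x.
rewrite potential_pred expRD /eps lnK; last by rewrite posrE divr_gt0 //; lra.
by field; rewrite gt_eqF.
Qed.

Lemma occ_environment gamma n h1 s f N l m c : 0 < h1 ->
  good_potential (Gamma gamma n) h1 s f N S -> basin gamma n S l m c ->
  occ a (fun y => (~~ (m - f%:Z <= y <= m + f%:Z))%:R) n 0
  <= occ_bound gamma n h1 s osc eta N.
Proof.
move=> h0 gS bS.
have osc0 : 0 <= osc by apply: le_trans (eps_le 0).
have Sb x : `|S x - S (x - 1)| <= osc by rewrite potential_pred addrC addKr eps_le.
case: (leP 0 m) => m0.
  apply: (occ_basin (r := fun x => expR (S x)) h0 gS a01 eta_gt0 _ _ _ _ Sb bS m0).
  - by move=> x; case/andP: (a_eta x).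
  - by move=> x; exact: expR_gt0.
  - exact: detailed_balance.
  - by move=> x; rewrite !ler_expR; apply/andP; split; lra.
have mir : occ a (fun y => (~~ (m - f%:Z <= y <= m + f%:Z))%:R) n 0 =
  occ (fun y => 1 - a (- y)) (fun y => (~~ (- m - f%:Z <= y <= - m + f%:Z))%:R) n 0.
  have := occ_mirror a (fun y => (~~ (m - f%:Z <= y <= m + f%:Z))%:R : R) n 0.
  rewrite oppr0 => <-; congr (occ _ _ n 0); apply/funext => y; congr (nat_of_bool (~~ _))%:R.
  by apply/idP/idP; clear; lia.
rewrite mir.
(* Reflection sends the edge between x and x + 1 to the one between - x - 1 and - x, whose
   resistance is exp(S(- x - 1)). *)
apply: (occ_basin (r := fun x => expR (S (- x - 1))) h0 (good_mirror gS) _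
    eta_gt0 _ _ _ _ _ (basin_mirror bS)).
- by move=> x; have /andP[? ?] := a01 (- x); apply/andP; split; lra.
- by move=> x; have /andP[? ?] := a_eta (- x); lra.
- by move=> x; exact: expR_gt0.
- move=> x; have := detailed_balance (- x).
  have -> : - (x - 1) - 1 = - x by clear; lia.
  by move=> <-; congr (_ * _); lra.
- move=> x; rewrite !ler_expR /mirror; have := Sb (- x).
  by rewrite ler_norml => /andP[? ?]; apply/andP; split; lra.
- move=> x; rewrite /mirror; have := Sb (- x + 1); rewrite addrK distrC.
  by rewrite (_ : - (x - 1) = - x + 1) //; clear; lia.
- by move: m0; clear; lia.
Qed.

End Environment.

(** * Bad environments *)

Section GoodEvent.
Context d (T : measurableType d) (R : realType) (Q : probability T R).
Variable e : int -> T -> R.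
Hypothesis me : forall i, measurable_fun setT (e i).
Hypothesis eI : independent_family Q e.
Variables b s2 : R.
Hypothesis eb : forall i w, `|e i w| <= b.
Hypothesis e0 : forall i, mean Q (e i) = 0.
Hypothesis e2 : forall i, mean Q (fun w => e i w ^+ 2) = s2.
Hypothesis s2_gt0 : 0 < s2.

(** From site [i] the right path uses the increments i + 1, i + 2, ... and the left path uses i, i -
    1, ...; the sets are disjoint, so the two paths are independent. *)
Definition right_index (i : int) (k : nat) : int := i + k.+1%:Z.
Definition left_index (i : int) (k : nat) : int := i - k%:Z.
Definition right_walk i := walk e 1 (right_index i).
Definition left_walk i := walk e (- 1) (left_index i).

Lemma right_index_inj i : injective (right_index i).
Proof. by move=> j k; rewrite /right_index; clear; lia. Qed.

Lemma left_index_inj i : injective (left_index i).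
Proof. by move=> j k; rewrite /left_index; clear; lia. Qed.

Lemma left_right_disjoint i :
  range (left_index i) `&` range (right_index i) = set0.
Proof.
apply/seteqP; split => // x [[j _ <-] [k _]]; rewrite /left_index /right_index.
by clear; lia.
Qed.

Let sq1 : (1 : R) ^+ 2 = 1. Proof. by rewrite expr1n. Qed.
Let sqN1 : (- 1 : R) ^+ 2 = 1. Proof. by rewrite sqrrN expr1n. Qed.

(** Measurability is assumed over every measurable type because it is applied to the sigma-algebras
    generated by the increments on each side. *)
Lemma pr_left_right i (PL PR : (nat -> R) -> Prop) :
  (forall disp (X : measurableType disp) (W : nat -> X -> R),
     (forall t, measurable_fun setT (W t)) -> measurable [set w | PL (W ^~ w)]) ->
  (forall disp (X : measurableType disp) (W : nat -> X -> R),
     (forall t, measurable_fun setT (W t)) -> measurable [set w | PR (W ^~ w)]) ->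
  pr Q [set w | PL (left_walk i ^~ w) /\ PR (right_walk i ^~ w)] =
  pr Q [set w | PL (left_walk i ^~ w)] * pr Q [set w | PR (right_walk i ^~ w)].
Proof.
move=> mL mR; apply: (info_pr me eI (left_right_disjoint i)).
  by apply: mL => t; exact: measurable_walk_range.
by apply: mR => t; exact: measurable_walk_range.
Qed.

Lemma pr_ex_lt (N : nat) (F : nat -> set T) c : 0 <= c ->
  (forall k, measurable (F k)) -> (forall k, pr Q (F k) <= c) ->
  pr Q [set w | exists k, (k < N)%N /\ F k w] <= N%:R * c.
Proof.
move=> c0 mF Fc.
have -> : [set w | exists k, (k < N)%N /\ F k w] =
    \bigcup_k [set w | (k < N)%N /\ F k w].
  by apply/seteqP; split => w /= [k]; [exists k|move=> _; exists k].
apply: (pr_bigcup (p := fun k => if (k < N)%N then c else 0)) => [k|k|n].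
- exact: (meas_and (meas_const _ _) (mF k)).
- case: ifP => kN.
    rewrite (_ : mkset _ = F k) //.
    by apply/seteqP; split => w //= [].
  rewrite (_ : mkset _ = set0) ?/pr ?measure0 //.
  by apply/seteqP; split => w //= [].
- rewrite -big_mkcond /= (_ : N%:R * c = \sum_(k < N) c); last first.
    by rewrite sumr_const card_ord mulr_natl.
  rewrite -(big_mkord (fun k => (k < N)%N) (fun=> c)) -(big_mkord xpredT (fun=> c)).
  case: (leqP n N) => nN.
    rewrite (big_cat_nat _ nN) //= big_mkcond /= [leLHS]big_nat [X in _ <= X + _]big_nat.
    rewrite -[leLHS]addr0 lerD ?sumr_ge0 //.
    by apply: ler_sum => k _; case: ifP.
  rewrite (big_cat_nat _ (ltnW nN)) //= [X in _ + X]big_nat_cond [X in _ + X]big1 ?addr0.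
    by rewrite big_mkcond /=; apply: ler_sum => k _; case: ifP.
  by move=> k /andP[/andP[Nk _]]; rewrite ltnNge Nk.
Qed.

Variables (gamma : R) (n : nat).
Let w := gamma * ilog R 2 n.
Let G := Gamma gamma n.
Variables (h1 s r : R) (f B K k0 : nat).
Let N := (K * B)%N.

Hypothesis w_gt0 : 0 < w.
Hypothesis b_le_w : b <= w.
Hypothesis wG : 3 * w < G.
Hypothesis h1_gt0 : 0 < h1.
Hypothesis h1_lt : h1 < G.
Hypothesis s_ge0 : 0 <= s.
Hypothesis s_lt : s < G.
Hypothesis r_gt0 : 0 < r.
Hypothesis r_lt : r < G.
Hypothesis f_gt0 : (0 < f)%N.
Hypothesis HB : 4 * (G + b) ^+ 2 <= s2 * B%:R.
Hypothesis k0G : G <= k0%:R * w.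

Definition dip_rate : R := (2 * b * (r + b) / (s2 * f%:R)) * ((r + b) / (G + b))
  + b / (r + b) * ((s + b) / (G + b)).
Definition reach_rate h : R := b / (h + b).
Definition relapse_rate : R := b / (h1 + b) * ((G - h1 + b) / (G + b)).
(** Union bound: two mirror-image dips and two relapses at each of 2N + 1 sites, 36 w/G for ties
    plus 6 w/G on each side for the plunges at [k0], and four missing climbs. *)
Definition bad_rate : R :=
  (2 * N + 1)%:R * (2 * (reach_rate G * dip_rate))
  + (2 * N + 1)%:R * (2 * (reach_rate h1 * relapse_rate))
  + 48 * (w / G) + 4 * (5 / 6) ^+ K.

Let b0 : 0 <= b. Proof. exact: b_ge0 eb. Qed.
Let G0 : 0 < G. Proof. by have := w_gt0; have := wG; lra. Qed.

Definition shifted (k : nat) : int := k%:Z - N%:Z.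

Definition bad_dip i v :=
  (reach G 0 (left_walk i ^~ v) /\ dip f s G (right_walk i ^~ v)) \/
  (reach G 0 (right_walk i ^~ v) /\ dip f s G (left_walk i ^~ v)).
Definition bad_relapse i v :=
  (reach h1 0 (left_walk i ^~ v) /\ relapse h1 G (right_walk i ^~ v)) \/
  (reach h1 0 (right_walk i ^~ v) /\ relapse h1 G (left_walk i ^~ v)).

Definition tie_plunge (k : nat) (Z : nat -> R) :=
  plunge (k%:R * w) (k.+2%:R * w) ((k.+3%:R * w - G) / 2) Z.

Lemma meas_or (P P' : T -> Prop) : measurable [set v | P v] ->
  measurable [set v | P' v] -> measurable [set v | P v \/ P' v].
Proof. exact: measurableU. Qed.

Lemma mW_left i t : measurable_fun setT (left_walk i t).
Proof. exact: mwalk. Qed.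
Lemma mW_right i t : measurable_fun setT (right_walk i t).
Proof. exact: mwalk. Qed.

Lemma pr_left_right_le i PL PR cL cR :
  (forall disp (X : measurableType disp) (W : nat -> X -> R),
     (forall t, measurable_fun setT (W t)) -> measurable [set w | PL (W ^~ w)]) ->
  (forall disp (X : measurableType disp) (W : nat -> X -> R),
     (forall t, measurable_fun setT (W t)) -> measurable [set w | PR (W ^~ w)]) ->
  (forall sg io, sg ^+ 2 = 1 -> injective io -> pr Q [set v | PL (walk e sg io ^~ v)] <= cL) ->
  (forall sg io, sg ^+ 2 = 1 -> injective io -> pr Q [set v | PR (walk e sg io ^~ v)] <= cR) ->
  let E := [set v | (PL (left_walk i ^~ v) /\ PR (right_walk i ^~ v)) \/
           (PL (right_walk i ^~ v) /\ PR (left_walk i ^~ v))] in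
  measurable E /\ pr Q E <= 2 * (cL * cR).
Proof.
move=> mL mR hL hR E.
have m1 : measurable [set v | PL (left_walk i ^~ v) /\ PR (right_walk i ^~ v)].
  by apply: meas_and; [apply: mL; exact: mW_left|apply: mR; exact: mW_right].
have m2 : measurable [set v | PL (right_walk i ^~ v) /\ PR (left_walk i ^~ v)].
  by apply: meas_and; [apply: mL; exact: mW_right|apply: mR; exact: mW_left].
split; first exact: meas_or.
apply: le_trans (prU Q m1 m2) _; rewrite mulr_natl mulr2n lerD //.
  rewrite pr_left_right //; apply: ler_pM; try exact: pr_ge0.
    by apply: hL => //; exact: left_index_inj.
  by apply: hR => //; exact: right_index_inj.
rewrite (_ : mkset _ = [set v | PR (left_walk i ^~ v) /\ PL (right_walk i ^~ v)]).
  rewrite pr_left_right // mulrC; apply: ler_pM; try exact: pr_ge0.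
    by apply: hL => //; exact: right_index_inj.
  by apply: hR => //; exact: left_index_inj.
by apply/seteqP; split => v [].
Qed.

Lemma bad_dip_rate i : measurable [set v | bad_dip i v] /\
  pr Q [set v | bad_dip i v] <= 2 * (reach_rate G * dip_rate).
Proof.
apply: pr_left_right_le.
- by move=> disp X W mW; exact: meas_reach.
- by move=> disp X W mW; exact: meas_dip.
- move=> sg io sg2 inj; rewrite /reach_rate.
  have := pr_reach me eI eb e0 sg2 inj (lexx 0) G0; rewrite add0r addr0; apply.
- move=> sg io sg2 inj.
  exact: (pr_dip me eI eb e0 e2 s2_gt0 sg2 inj f_gt0 s_ge0 r_gt0 s_lt r_lt).
Qed.

Lemma bad_relapse_rate i : measurable [set v | bad_relapse i v] /\
  pr Q [set v | bad_relapse i v] <= 2 * (reach_rate h1 * relapse_rate).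
Proof.
apply: pr_left_right_le.
- by move=> disp X W mW; exact: meas_reach.
- by move=> disp X W mW; exact: meas_relapse.
- move=> sg io sg2 inj; rewrite /reach_rate.
  have := pr_reach me eI eb e0 sg2 inj (lexx 0) h1_gt0; rewrite add0r addr0; apply.
- move=> sg io sg2 inj.
  exact: (pr_relapse me eI eb e0 sg2 inj h1_gt0 h1_lt).
Qed.

(** The window has width 2 w and overshoot [b <= w], against a fall of ((k + 1) w + G) / 2. *)
Lemma pr_tie_plunge k sg io : sg ^+ 2 = 1 -> injective io ->
  pr Q [set v | tie_plunge k (walk e sg io ^~ v)] <= 6 / (k%:R + 1 + G / w).
Proof.
move=> sg2 inj; have w0 := w_gt0; have bw := b_le_w; have b0' := b0; have hwG := wG.
have E2 : k.+2%:R = k%:R + 2 :> R by rewrite -addn2 natrD.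
have E3 : k.+3%:R = k%:R + 3 :> R by rewrite -addn3 natrD.
have kw : 0 <= k%:R * w by rewrite mulr_ge0 // ltW.
have c1 : (k.+3%:R * w - G) / 2 < k%:R * w by rewrite E3; lra.
have c2 : k%:R * w <= k.+2%:R * w by rewrite E2; lra.
apply: le_trans (pr_plunge me eI eb e0 sg2 inj c1 c2) _.
rewrite E2 E3.
have G0' := G0.
have p1 : 0 < (k%:R + 1) * w + G by rewrite mulrDl mul1r; lra.
have -> : 6 / (k%:R + 1 + G / w) = 3 * w / (((k%:R + 1) * w + G) / 2).
  have kk : 0 <= k%:R :> R by [].
  have q0 : 0 < k%:R + 1 + G / w.
    by rewrite ltr_wpDl ?divr_gt0 // addr_ge0.
  by field; rewrite ?gt_eqF //.
rewrite ler_pM //; try lra.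
- rewrite invr_ge0; lra.
- rewrite lef_pV2 ?posrE; try lra.
Qed.

(** The two sides are independent, so each term is at most 36 / (k + 1 + q)^2 with q = G / w; this
    is dominated by a telescoping difference of total at most 36 / q. *)
Lemma tie_rate : pr Q [set v | exists k, tie_plunge k (right_walk 0 ^~ v) /\
    tie_plunge k (left_walk 0 ^~ v)] <= 36 * (w / G).
Proof.
have G0' := G0; have w0 := w_gt0.
pose q := G / w; have q0 : 0 < q by rewrite divr_gt0.
have -> : [set v | exists k, tie_plunge k (right_walk 0 ^~ v) /\
    tie_plunge k (left_walk 0 ^~ v)] =
  \bigcup_k [set v | tie_plunge k (left_walk 0 ^~ v) /\
    tie_plunge k (right_walk 0 ^~ v)].
  by apply/seteqP; split => v /= => [[k [h1' h2]]|[k _ [h1' h2]]]; exists k.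
apply: (pr_bigcup (p := fun k => 36 * ((k%:R + q)^-1 - (k.+1%:R + q)^-1))) => [k|k|m].
- by apply: meas_and; apply: meas_plunge; [exact: mW_left|exact: mW_right].
- rewrite pr_left_right; [|by move=> *; exact: meas_plunge..].
  have k0' : 0 <= k%:R :> R by [].
  have kq : 0 < k%:R + q by lra.
  have kq1 : 0 < k%:R + 1 + q by lra.
  apply: (@le_trans _ _ (6 / (k%:R + 1 + q) * (6 / (k%:R + 1 + q)))).
    apply: ler_pM; try exact: pr_ge0; apply: pr_tie_plunge => //.
      exact: left_index_inj.
    exact: right_index_inj.
  rewrite (_ : k.+1%:R = k%:R + 1 :> R); last by rewrite natr1.
  have -> : (k%:R + q)^-1 - (k%:R + 1 + q)^-1 = (k%:R + q)^-1 * (k%:R + 1 + q)^-1.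
    by field; rewrite !gt_eqF.
  rewrite mulrACA (_ : 6 * 6 = 36 :> R) ?ler_pM2l ?ltr0n //; last by ring.
  rewrite ler_pM2r ?invr_gt0 // lef_pV2 ?posrE //; lra.
- rewrite -mulr_sumr ler_pM2l ?ltr0n //.
  rewrite -(big_mkord xpredT (fun k => (k%:R + q)^-1 - (k.+1%:R + q)^-1)).
  rewrite (telescope_sumr_eq (fun k => - (k%:R + q)^-1)) // => [|k _].
    rewrite add0r -invf_div -/q opprK addrC gerBl invr_ge0.
    by rewrite addr_ge0 // ltW.
  by rewrite opprK addrC.
Qed.

Lemma prU_le (A A' : set T) x y : measurable A /\ pr Q A <= x ->
  measurable A' /\ pr Q A' <= y -> measurable (A `|` A') /\ pr Q (A `|` A') <= x + y.
Proof.
move=> [mA Ax] [mA' Ay]; split; first exact: measurableU.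
by apply: le_trans (prU Q mA mA') _; exact: lerD.
Qed.

(** Stated for any [S] with the prescribed paths: the walks are built from clipped increments, which
    agree with those of the potential only almost surely. *)
Lemma good_event : exists E : set T, [/\ measurable E, 1 - bad_rate <= pr Q E &
  forall v, E v -> forall S, S 0 = 0 ->
    (forall i, right_path S i = right_walk i ^~ v) ->
    (forall i, left_path S i = left_walk i ^~ v) ->
    [/\ good_potential G h1 s f N S, ~ tie gamma n S &
        exists V, deep_valley gamma n S V]].
Proof.
have G0' := G0; have w0 := w_gt0; have b0' := b0; have bw := b_le_w; have hwG := wG.
have bG : b <= G by lra.
have rg0 h : 0 < h -> 0 <= reach_rate h.
  by move=> h0; rewrite divr_ge0 // addr_ge0 // ltW.
have sG0 := s_ge0; have rG0 := r_gt0; have h10 := h1_gt0; have h1G := h1_lt.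
have dr0 : 0 <= dip_rate.
  rewrite /dip_rate addr_ge0 // mulr_ge0 // divr_ge0 ?mulr_ge0 ?(ltW s2_gt0) //; lra.
have rr0 : 0 <= relapse_rate.
  by rewrite /relapse_rate mulr_ge0 // divr_ge0 //; lra.
have B1 : let A := [set v | exists k, (k < 2 * N + 1)%N /\ bad_dip (shifted k) v] in
    measurable A /\ pr Q A <= (2 * N + 1)%:R * (2 * (reach_rate G * dip_rate)).
  split.
    apply: meas_ex => k; apply: meas_and; first exact: meas_const.
    by case: (bad_dip_rate (shifted k)).
  apply: (pr_ex_lt _ (F := fun k => [set v | bad_dip (shifted k) v])) => [|k|k].
  - by apply: mulr_ge0 => //; apply: mulr_ge0 => //; exact: rg0.
  - by case: (bad_dip_rate (shifted k)).
  - by case: (bad_dip_rate (shifted k)).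
have B2 : let A := [set v | exists k, (k < 2 * N + 1)%N /\ bad_relapse (shifted k) v] in
    measurable A /\ pr Q A <= (2 * N + 1)%:R * (2 * (reach_rate h1 * relapse_rate)).
  split.
    apply: meas_ex => k; apply: meas_and; first exact: meas_const.
    by case: (bad_relapse_rate (shifted k)).
  apply: (pr_ex_lt _ (F := fun k => [set v | bad_relapse (shifted k) v])) => [|k|k].
  - by apply: mulr_ge0 => //; apply: mulr_ge0 => //; exact: rg0.
  - by case: (bad_relapse_rate (shifted k)).
  - by case: (bad_relapse_rate (shifted k)).
have B3 : let A := [set v | exists k, tie_plunge k (right_walk 0 ^~ v) /\
    tie_plunge k (left_walk 0 ^~ v)] in measurable A /\ pr Q A <= 36 * (w / G).
  split; last exact: tie_rate.
  apply: meas_ex => k; apply: meas_and; apply: meas_plunge.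
    exact: mW_right.
  exact: mW_left.
have B4 sg io : sg ^+ 2 = 1 -> injective io ->
    let A := [set v | ~ climbs G N (walk e sg io ^~ v)] in
    measurable A /\ pr Q A <= (5 / 6) ^+ K.
  move=> sg2 inj; split.
    by apply: measurableC; apply: meas_climbs => t; exact: mwalk.
  exact: (pr_climbs me eI eb e0 e2 s2_gt0 sg2 inj K bG G0 HB).
have B5 sg io : sg ^+ 2 = 1 -> injective io ->
    let A := [set v | tie_plunge k0 (walk e sg io ^~ v)] in
    measurable A /\ pr Q A <= 6 * (w / G).
  move=> sg2 inj; split; first by apply: meas_plunge => t; exact: mwalk.
  apply: le_trans (pr_tie_plunge k0 sg2 inj) _.
  rewrite ler_pM2l ?ltr0n // -[leRHS]invf_div lef_pV2 ?posrE ?divr_gt0 //.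
    by rewrite lerDr addr_ge0.
  by rewrite ltr_wpDl ?divr_gt0 // addr_ge0.
have B6 sg io : sg ^+ 2 = 1 -> injective io ->
    let A := [set v | ~ level (k0.+2%:R * w) (walk e sg io ^~ v)] in
    measurable A /\ pr Q A <= 0.
  move=> sg2 inj; split.
    by apply: measurableC; apply: meas_level => t; exact: mwalk.
  by rewrite (pr_not_level me eI eb e0 e2 s2_gt0 sg2 inj) // mulr_gt0 // ltr0n.
have rI := @right_index_inj 0; have lI := @left_index_inj 0.
have sqNN1 : (- - 1 : R) ^+ 2 = 1 by rewrite opprK.
(* The nesting fixes the later choices of [left] and [right]: dips, relapses, ties, four climbs, two
   plunges at [k0], two unreached levels. *)
have := prU_le B1 (prU_le B2 (prU_le B3 (prU_le (prU_le (prU_le (B4 _ _ sq1 rI) (B4 _ _ sqN1 rI))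
  (prU_le (B4 _ _ sqN1 lI) (B4 _ _ sqNN1 lI))) (prU_le (prU_le (B5 _ _ sq1 rI) (B5 _ _ sqN1 lI))
   (prU_le (B6 _ _ sq1 rI) (B6 _ _ sqN1 lI)))))).
set Bad := _ `|` _ => -[mBad Badle].
exists (~` Bad); split; first exact: measurableC.
  rewrite prC // lerD2l lerN2; apply: (le_trans Badle).
  by rewrite /bad_rate; lra.
move=> v nB S S0 rS lS.
have sh (i : int) : - N%:Z <= i <= N%:Z -> exists k, (k < 2 * N + 1)%N /\ i = shifted k.
  by move=> iN; exists `|(i + N%:Z)%R|%N; rewrite /shifted; move: iN; clear; lia.
have rE : (fun t : nat => S t%:Z) = right_walk 0 ^~ v.
  by rewrite -rS /right_path; apply/funext => t; rewrite S0 subr0 add0r.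
have lE : (fun t : nat => S (- t%:Z)) = left_walk 0 ^~ v.
  by rewrite -lS /left_path; apply/funext => t; rewrite S0 subr0 sub0r.
have climb sg io : ~ [set v | ~ climbs G N (walk e sg io ^~ v)] v ->
    climbs G N (walk e sg io ^~ v) by move=> /contrapT.
have neg io t sg : - walk e sg io t v = walk e (- sg) io t v by rewrite walkN.
split.
- split.
  + move=> i /sh [k [kN ->]]; rewrite rS lS.
    by split => h; apply: nB; left; exists k; split => //; [left|right].
  + move=> i /sh [k [kN ->]]; rewrite rS lS.
    by split => h; apply: nB; right; left; exists k; split => //; [left|right].
  + rewrite rS; split; last (rewrite /right_walk; under eq_fun do rewrite neg);
      apply: climb => h; apply: nB; do 3 right; left; left; [by left|by right].
  + rewrite lS; split; last (rewrite /left_walk; under eq_fun do rewrite neg);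
      apply: climb => h; apply: nB; do 3 right; left; right; [by left|by right].
- move=> [k]; rewrite /= rE lE => h; apply: nB; right; right; left; by exists k.
- apply: (@deep_valley_ex _ gamma n w_gt0 G0 S k0 S0 k0G); rewrite ?rE ?lE.
  + by move=> h; apply: nB; do 4 right; left; left.
  + by move=> h; apply: nB; do 4 right; left; right.
  + by apply: contrapT => h; apply: nB; do 4 right; right; left.
  + by apply: contrapT => h; apply: nB; do 4 right; right; right.
Qed.

End GoodEvent.

(** * Asymptotics *)
Section Growth.
Context (R : realType).

Lemma exp_dominates (C : R) k :
  exists X : R, forall t, X <= t -> C * t ^+ k <= expR t.
Proof.
exists (1 + `|C| * (k.+1)`!%:R) => t Xt.
have F0 : 0 < (k.+1)`!%:R :> R by rewrite ltr0n fact_gt0.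
have CF0 : 0 <= `|C| * (k.+1)`!%:R by rewrite mulr_ge0 // ltW.
have t1 : 1 <= t by lra.
have t0 : 0 <= t by lra.
apply: le_trans (le_trans _ (expR_ge1Dxn k t0)); last first.
  apply: (@ler_wpDl _ _ 1) => //; exact: lexx.
rewrite ler_pdivlMr // exprS mulrAC ler_wpM2r ?exprn_ge0 //.
apply: le_trans (_ : `|C| * (k.+1)`!%:R <= _); last by lra.
by rewrite ler_wpM2r ?ler_norm // ltW.
Qed.

Lemma ilogS p n : ilog R p.+1 n = ln (ilog R p n).
Proof. by []. Qed.

Lemma ilog_large p (A : R) : exists n0, forall n, (n0 < n)%N -> A <= ilog R p n.
Proof.
elim: p A => [|p IH] A.
  exists (Num.truncn A) => n nA; apply/ltW; apply: lt_le_trans (truncnS_gt _) _.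
  by rewrite ler_nat.
have [n0 n0P] := IH (expR A); exists n0 => n /n0P h.
by rewrite ilogS -[A]expRK ler_ln ?posrE ?expR_gt0 // (lt_le_trans (expR_gt0 A)).
Qed.

Lemma ilogK p n : 0 < ilog R p n -> expR (ilog R p.+1 n) = ilog R p n.
Proof. by move=> h; rewrite ilogS lnK. Qed.

Lemma ilog_le2 p : (2 <= p)%N ->
  exists n0, forall n, (n0 < n)%N -> ilog R p n <= ilog R 2 n.
Proof.
elim: p => // p IH; rewrite leq_eqVlt => /orP[/eqP <-|/IH [n0 n0P]].
  by exists 0%N.
have [n1 n1P] := ilog_large p 1.
exists (maxn n0 n1) => n; rewrite gtn_max => /andP[/n0P h /n1P h1].
apply: le_trans h; rewrite ilogS ltW // ln_sublinear //; lra.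
Qed.

End Growth.

Section BadRate.
Context (R : realType).
Variables (b s2 gamma : R) (n : nat).
Hypothesis b_ge0 : 0 <= b.
Hypothesis s2_gt0 : 0 < s2.
Hypothesis gamma_ge0 : 0 <= gamma.
Let L := ilog R 2 n.
Let y := ilog R 1 n.
Let G := Gamma gamma n.
Variables (z : R) (f B K : nat).
Hypothesis z_ge1 : 1 <= z.
Hypothesis zL : z ^+ 6 <= L.
Hypothesis bL : b <= L.
Hypothesis LLy : L ^+ 2 <= y.
Hypothesis Ly : (16 + gamma) * L <= y.
Hypothesis fP : (L * z ^+ 6) ^+ 2 / 2 <= f%:R.
Hypothesis B_gt0 : (0 < B)%N.
Hypothesis BP : B%:R <= 4 * (G + b) ^+ 2 / s2 + 1.
Hypothesis K_gt0 : (0 < K)%N.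
Hypothesis KP : (5 / 6) ^+ K <= (z ^+ 6)^-1.

(** The number of sites is O(K g^2) with g = G + b. Reaching about [G] on both sides costs 1/g^2,
    which cancels it; a dip costs a further z^(-4), and a relapse a further L/g. Ties and missing
    climbs are no larger. *)
Lemma bad_rate_le :
  bad_rate b s2 gamma n (y - 8 * L) (5 * L) (L * z ^+ 4) f B K <=
  (6 * b * (4 / s2 + 1) * (16 * b / s2 + 6 * b)
   + 24 * b ^+ 2 * (4 / s2 + 1) * (9 + gamma) + 48 * gamma + 4)
  * (K%:R / z ^+ 4).
Proof.
have b0 := b_ge0; have s20 := s2_gt0; have g0 := gamma_ge0.
have z1 := z_ge1; have z0 : 0 < z by lra.
have z41 : 1 <= z ^+ 4 by rewrite exprn_ege1.
have z40 : 0 < z ^+ 4 by lra.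
have z46 : z ^+ 4 <= z ^+ 6 by rewrite ler_weXn2l.
have zL' := zL; have bL' := bL; have LLy' := LLy; have Ly' := Ly.
have L1 : 1 <= L by lra.
have L0 : 0 < L by lra.
have gL : 0 <= gamma * L by rewrite mulr_ge0 // ltW.
have y16 : 16 * L + gamma * L <= y by rewrite -mulrDl.
have GE : G = y + gamma * L by [].
pose g := G + b.
have g1 : 1 <= g by rewrite /g; lra.
have g0' : 0 < g by lra.
pose c0 := 4 / s2 + 1.
have c00 : 0 <= c0 by rewrite addr_ge0 // divr_ge0 // ltW.
have k1 : 1 <= K%:R :> R by rewrite ler1n.
have N3 : (2 * (K * B) + 1)%:R <= 3 * K%:R * c0 * g ^+ 2 :> R.
  have BB : B%:R <= c0 * g ^+ 2.
    apply: le_trans BP _; rewrite -/g /c0 [leRHS]mulrDl mul1r.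
    by rewrite -mulrA (mulrC (g ^+ 2)) mulrA lerD2l exprn_ege1.
  apply: (@le_trans _ _ (3 * K%:R * B%:R)).
    by rewrite -!natrM ler_nat; move: B_gt0 K_gt0; clear; nia.
  by rewrite -[leRHS]mulrA ler_wpM2l // mulr_ge0.
have f0 : 0 < f%:R :> R.
  apply: lt_le_trans fP; rewrite divr_gt0 // exprn_gt0 // mulr_gt0 //; lra.
have Lz : L <= L * z ^+ 4 by rewrite ler_peMr // ltW.
have Lz0 : 0 < L * z ^+ 4 by lra.
have dip : dip_rate b s2 gamma n (5 * L) (L * z ^+ 4) f
    <= (16 * b / s2 + 6 * b) / z ^+ 4 / g.
  rewrite /dip_rate -/G -/g mulrA (mulrA _ _ g^-1) -mulrDl.
  rewrite ler_pM2r ?invr_gt0 // [leRHS]mulrDl lerD //.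
    have -> : 2 * b * (L * z ^+ 4 + b) / (s2 * f%:R) * (L * z ^+ 4 + b) =
       2 * b / s2 * ((L * z ^+ 4 + b) ^+ 2 / f%:R).
      by field; rewrite !gt_eqF.
    have -> : 16 * b / s2 / z ^+ 4 = 2 * b / s2 * (8 / z ^+ 4).
      by field; rewrite !gt_eqF.
    rewrite ler_wpM2l ?divr_ge0 ?mulr_ge0 ?(ltW s20) //.
    rewrite ler_pdivrMr //.
    apply: le_trans (_ : 8 / z ^+ 4 * ((L * z ^+ 6) ^+ 2 / 2) <= _); last first.
      by rewrite ler_wpM2l ?divr_ge0 // ltW.
    have -> : 8 / z ^+ 4 * ((L * z ^+ 6) ^+ 2 / 2) = (2 * (L * z ^+ 4)) ^+ 2.
      by field; rewrite gt_eqF.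
    rewrite lerXn2r ?nnegrE ?mulr_ge0 ?addr_ge0 //; lra.
  have -> : 6 * b / z ^+ 4 = b / (L * z ^+ 4) * (6 * L).
    by field; rewrite !gt_eqF.
  apply: ler_pM.
  - by rewrite divr_ge0 // addr_ge0 // ltW.
  - lra.
  - rewrite ler_wpM2l // lef_pV2 ?posrE //; lra.
  - lra.
have dip0 : 0 <= dip_rate b s2 gamma n (5 * L) (L * z ^+ 4) f.
  have h1 : 0 <= L * z ^+ 4 + b by lra.
  have h2 : 0 <= 5 * L + b by lra.
  rewrite /dip_rate -/G -/g; apply: addr_ge0; apply: mulr_ge0.
  - by apply: divr_ge0; repeat apply: mulr_ge0 => //; exact: ltW.
  - by apply: divr_ge0 => //; exact: ltW.
  - exact: divr_ge0.
  - by apply: divr_ge0 => //; exact: ltW.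
have rG : reach_rate b G = b / g by [].
have rh : reach_rate b (y - 8 * L) <= 2 * (b / g).
  rewrite /reach_rate mulrCA ler_wpM2l // -[2 / g]invf_div lef_pV2 ?posrE /g; try lra.
have rh0 : 0 <= reach_rate b (y - 8 * L) by rewrite divr_ge0 //; lra.
(* Since L^2 <= y <= g and z^4 <= L. *)
have L4 : L / g <= (z ^+ 4)^-1.
  rewrite ler_pdivrMr // mulrC ler_pdivlMr //.
  apply: le_trans (_ : L * L <= _); last by rewrite -expr2 /g; lra.
  by rewrite ler_pM2l //; lra.
have Kz : (z ^+ 4)^-1 <= K%:R / z ^+ 4.
  by rewrite ler_peMl // invr_ge0 ltW.
have z4i : 0 < (z ^+ 4)^-1 by rewrite invr_gt0.
have bg0 : 0 <= b / g by rewrite divr_ge0 // ltW.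
have T1 : (2 * (K * B) + 1)%:R *
   (2 * (reach_rate b G * dip_rate b s2 gamma n (5 * L) (L * z ^+ 4) f)) <=
   6 * b * c0 * (16 * b / s2 + 6 * b) * (K%:R / z ^+ 4).
  have -> : 6 * b * c0 * (16 * b / s2 + 6 * b) * (K%:R / z ^+ 4) =
    3 * K%:R * c0 * g ^+ 2 * (2 * (b / g * ((16 * b / s2 + 6 * b) / z ^+ 4 / g))).
    by rewrite /c0; field; rewrite !gt_eqF.
  rewrite rG; apply: ler_pM => //; first by repeat apply: mulr_ge0 => //.
  by rewrite ler_pM2l // ler_wpM2l.
have T2 : (2 * (K * B) + 1)%:R *
   (2 * (reach_rate b (y - 8 * L) * relapse_rate b gamma n (y - 8 * L))) <=
   24 * b ^+ 2 * c0 * (9 + gamma) * (K%:R / z ^+ 4).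
  have rr : relapse_rate b gamma n (y - 8 * L) <=
      2 * (b / g) * ((9 + gamma) * (z ^+ 4)^-1).
    rewrite /relapse_rate; apply: ler_pM => //.
      by rewrite divr_ge0 // ?(ltW g0') // /G -/G GE; lra.
    rewrite -/G -/g; apply: (@le_trans _ _ ((9 + gamma) * (L / g))).
      rewrite mulrA ler_pM2r ?invr_gt0 // GE mulrDl; lra.
    by rewrite ler_wpM2l //; lra.
  have rr0 : 0 <= relapse_rate b gamma n (y - 8 * L).
    rewrite /relapse_rate mulr_ge0 // divr_ge0 // -/G -/g ?(ltW g0') // GE; lra.
  have -> : 24 * b ^+ 2 * c0 * (9 + gamma) * (K%:R / z ^+ 4) =
    3 * K%:R * c0 * g ^+ 2 *
    (2 * (2 * (b / g) * (2 * (b / g) * ((9 + gamma) * (z ^+ 4)^-1)))).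
    by rewrite /c0; field; rewrite !gt_eqF.
  apply: ler_pM => //; first by repeat apply: mulr_ge0 => //.
  by rewrite ler_pM2l //; apply: ler_pM.
have T3 : 48 * (gamma * L / G) <= 48 * gamma * (K%:R / z ^+ 4).
  rewrite -[leRHS]mulrA ler_pM2l // -mulrA ler_wpM2l //.
  apply: le_trans Kz.
  rewrite ler_pdivrMr; last by rewrite GE; lra.
  rewrite mulrC ler_pdivlMr //.
  apply: le_trans (_ : L * L <= _); last by rewrite -expr2 GE; lra.
  by rewrite ler_pM2l //; lra.
have T4 : 4 * (5 / 6) ^+ K <= 4 * (K%:R / z ^+ 4) :> R.
  rewrite ler_pM2l //; apply: le_trans KP _; apply: le_trans Kz.
  by rewrite lef_pV2 ?posrE //; lra.
rewrite [leRHS]mulrDl [X in _ <= X + _]mulrDl [X in _ <= X + _ + _]mulrDl.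
by rewrite /bad_rate -/L -/G !lerD.
Qed.
End BadRate.

(** The constant is fixed before [n] and the scales, so that the threshold for [n] may depend on
    it. *)
Lemma bad_rate_ex (R : realType) (b s2 gamma : R) :
  0 <= b -> 0 < s2 -> 0 <= gamma ->
  exists2 C, 0 <= C & forall n (z : R) (f B K : nat),
    let L := ilog R 2 n in
    let y := ilog R 1 n in
    1 <= z -> z ^+ 6 <= L -> b <= L -> L ^+ 2 <= y -> (16 + gamma) * L <= y ->
    (L * z ^+ 6) ^+ 2 / 2 <= f%:R ->
    (0 < B)%N -> B%:R <= 4 * (Gamma gamma n + b) ^+ 2 / s2 + 1 ->
    (0 < K)%N -> (5 / 6) ^+ K <= (z ^+ 6)^-1 ->
    bad_rate b s2 gamma n (y - 8 * L) (5 * L) (L * z ^+ 4) f B K <=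
    C * (K%:R / z ^+ 4).
Proof.
move=> b0 s0 g0; eexists; last by move=> *; exact: bad_rate_le.
have h1 : 0 <= 4 / s2 + 1 by rewrite addr_ge0 // divr_ge0 // ltW.
have h2 : 0 <= 16 * b / s2 + 6 * b.
  by rewrite addr_ge0 // ?divr_ge0 ?mulr_ge0 // ltW.
by rewrite !addr_ge0 // !mulr_ge0 ?sqr_ge0 // addr_ge0.
Qed.

Section OccBound.
Context (R : realType).

(** In powers of y = log n: N is O(y^3), exp(- s) = y^(-5), exp(h1) = n y^(-8) and exp(- G) <=
    y^(-11) / n. Each of the four terms is then n times O(y^(-2)), hence at most a quarter of n / f
    because f <= y. *)
Lemma occ_bound_le (gamma b eta : R) (n f N : nat) :
  let y := ilog R 1 n in
  let L := ilog R 2 n in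
  11 <= gamma -> 0 < eta -> 1 <= L -> 1 <= y ->
  16 * (2 * expR (3 * b)) <= y -> 4 * (expR (2 * b) / eta) <= y ->
  4 * expR (2 * b) <= y ->
  (0 < f)%N -> f%:R <= y -> (2 * N + 1)%:R <= y ^+ 3 ->
  occ_bound gamma n (y - 8 * L) (5 * L) b eta N <= n%:R / f%:R.
Proof.
move=> y L g11 eta0 L1 y1 A1 A2 A3 f0 fy Ny.
have y0 : 0 < y by lra.
have fp : 0 < f%:R :> R by rewrite ltr0n.
have n1 : 1 <= n%:R :> R.
  rewrite ler1n; case: n @y {L L1 y1 A1 A2 A3 fy Ny y0} (y0) => //.
  by rewrite /ilog /= ln0 // ltxx.
have n0 : 0 < n%:R :> R by lra.
have Ey : expR y = n%:R by rewrite /y /ilog /= lnK.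
have EL : expR L = y by rewrite /L /ilog /= lnK.
have y40 : 0 < y ^+ 4 by rewrite exprn_gt0.
have EsE k : expR (- (k%:R * L)) = (y ^+ k)^-1 by rewrite expRN expRM_natl EL.
have Ew : expR (- (gamma * L)) <= (y ^+ 11)^-1.
  by rewrite -EsE ler_expR lerN2 ler_wpM2r //; lra.
have EG : expR (- Gamma gamma n) <= n%:R^-1 * (y ^+ 11)^-1.
  rewrite /Gamma opprD expRD -/y -/L expRN Ey ler_wpM2l // invr_ge0 ltW //.
have Eh : expR (2 * b + (y - 8 * L)) = expR (2 * b) * n%:R * (y ^+ 8)^-1.
  by rewrite -EsE -Ey -!expRD addrA.
have Ewb : expR (2 * b - gamma * L) <= expR (2 * b) * (y ^+ 11)^-1.
  by rewrite expRD ler_pM2l ?expR_gt0.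
have small k : 0 <= k -> 4 * k <= y -> k * (y ^+ 2)^-1 <= (4 * f%:R)^-1.
  move=> k0 ky; rewrite ler_pdivrMr ?exprn_gt0 // mulrC ler_pdivlMr ?mulr_gt0 //.
  by rewrite mulrA (mulrC k) expr2 ler_pM // mulr_ge0 //.
have yk k : (2 <= k)%N -> (y ^+ k)^-1 <= (y ^+ 2)^-1.
  by move=> k2; rewrite lef_pV2 ?posrE ?exprn_gt0 // ler_weXn2l.
have M0 : 0 <= (2 * N)%:R :> R /\ (2 * N)%:R <= y ^+ 3.
  by split => //; apply: le_trans Ny; rewrite ler_nat leq_addr.
set C := 2 * expR (3 * b).
have C0 : 0 < C by rewrite mulr_gt0 ?expR_gt0.
have D0 : 0 < expR (2 * b) by rewrite expR_gt0.
have De0 : 0 < expR (2 * b) / eta by rewrite divr_gt0.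
have A1' : 16 * C <= y by [].
have yi k : 0 < (y ^+ k)^-1 by rewrite invr_gt0 exprn_gt0.
have T1 : (2 * N + 1)%:R * (C * expR (- (5 * L))) <= (4 * f%:R)^-1.
  apply: le_trans (_ : C * (y ^+ 2)^-1 <= _); last by apply: small; lra.
  rewrite EsE mulrCA ler_pM2l // ler_pdivrMr ?exprn_gt0 //.
  by rewrite mulrC (_ : y ^+ 5 = y ^+ 3 * y ^+ 2) ?mulfK ?gt_eqF ?exprn_gt0 // -exprD.
have T2 : n.+1%:R * (C * expR (- Gamma gamma n) + C * expR (- Gamma gamma n)) <= (4 * f%:R)^-1.
  apply: le_trans (_ : 4 * C * (y ^+ 2)^-1 <= _); last by apply: small; lra.
  have n2 : n.+1%:R <= 2 * n%:R :> R by rewrite -natr1; lra.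
  apply: (@le_trans _ _ (2 * n%:R * (2 * C * (n%:R^-1 * (y ^+ 2)^-1)))).
    apply: ler_pM => //; first by rewrite addr_ge0 // mulr_ge0 ?expR_ge0 // ltW.
    rewrite -mulrDr -mulrA mulrCA ler_pM2l // mulrDl mul1r.
    by rewrite lerD // (le_trans EG) // ler_pM2l ?invr_gt0 // yk.
  by rewrite le_eqVlt; apply/orP; left; apply/eqP; field; rewrite !gt_eqF.
have T3 : (2 * N)%:R * ((2 * N)%:R * (expR (2 * b + (y - 8 * L)) / eta)) <= n%:R * (4 * f%:R)^-1.
  apply: le_trans (_ : n%:R * (expR (2 * b) / eta * (y ^+ 2)^-1) <= _); last first.
    by rewrite ler_pM2l // small // ltW.
  have [M1 M2] := M0.
  rewrite mulrA Eh; apply: le_trans (_ : (y ^+ 3 * y ^+ 3) * (expR (2 * b) * n%:R / y ^+ 8 / eta) <= _).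
    rewrite ler_wpM2r ?ler_pM // divr_ge0 ?(ltW eta0) //.
    by rewrite divr_ge0 ?exprn_ge0 ?(ltW y0) // mulr_ge0 // ltW.
  by rewrite le_eqVlt; apply/orP; left; apply/eqP; field; rewrite !gt_eqF.
have T4 : (2 * N)%:R * expR (2 * b - gamma * L) <= (4 * f%:R)^-1.
  apply: le_trans (_ : expR (2 * b) * (y ^+ 2)^-1 <= _); last by apply: small; lra.
  have [M1 M2] := M0.
  apply: (@le_trans _ _ (y ^+ 3 * (expR (2 * b) * (y ^+ 11)^-1))).
    by apply: ler_pM => //; exact: expR_ge0.
  rewrite mulrCA ler_pM2l // ler_pdivrMr ?exprn_gt0 // mulrC.
  rewrite ler_pdivlMr ?exprn_gt0 // -exprD ler_weXn2l //.
rewrite /occ_bound -/C -/L.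
have -> : n%:R / f%:R = n%:R * ((4 * f%:R)^-1 + (4 * f%:R)^-1) +
    (n%:R * (4 * f%:R)^-1 + n%:R * (4 * f%:R)^-1) :> R.
  by field; rewrite gt_eqF.
by apply: lerD; [rewrite ler_pM2l // lerD|rewrite lerD // ler_pM2l].
Qed.
End OccBound.

Section Asymptotics.
Context (R : realType).

Lemma floor_half (v : R) : 2 <= v ->
  let f := `|Num.floor v|%N in
  [/\ Num.floor v = f%:Z, v / 2 <= f%:R & f%:R <= v].
Proof.
move=> v2 f.
have fE : Num.floor v = f%:Z by rewrite /f gez0_abs // floor_ge0; lra.
have fR : f%:R = (Num.floor v)%:~R :> R by rewrite fE.
split=> //; first by have := floorD1_gt v; rewrite intrD -fR; lra.
by rewrite fR; apply: ge_floor.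
Qed.

Lemma ex_natS (v : R) : 0 <= v ->
  exists m, [/\ (0 < m)%N, v <= m%:R & m%:R <= v + 1].
Proof.
move=> v0; exists (Num.truncn v).+1; split=> //; first exact/ltW/truncnS_gt.
by rewrite -[leLHS]natr1 lerD2r truncn_le.
Qed.

(** [B] is O(y^2), and the number [K] of blocks is at most a multiple of [L], negligible against
    [y]. *)
Lemma horizon_le (s2 y g k L : R) (K B : nat) :
  0 < s2 -> 1 <= y -> 0 <= g <= 2 * y -> 0 <= k * L ->
  (0 < K)%N -> (0 < B)%N -> B%:R <= 4 * g ^+ 2 / s2 + 1 -> K%:R <= k * L ->
  12 * (4 / s2 + 1) * k * L <= y -> (2 * (K * B) + 1)%:R <= y ^+ 3.
Proof.
move=> s20 y1 /andP[g0 gy] kL0 K0 B0 B2 KL KLy.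
apply: (@le_trans _ _ (3 * K%:R * B%:R)).
  rewrite -!natrM ler_nat -mulnA addnC (mulnDl 1 2) mul1n leq_add2r.
  by rewrite muln_gt0 K0.
have BB : B%:R <= 4 * (4 / s2 + 1) * y ^+ 2.
  apply: (le_trans B2).
  have h : g ^+ 2 <= 4 * y ^+ 2.
    rewrite (_ : 4 * y ^+ 2 = (2 * y) ^+ 2); last by ring.
    by rewrite lerXn2r ?nnegrE //; lra.
  have yy : 1 <= y ^+ 2 by rewrite exprn_ege1.
  apply: (@le_trans _ _ (4 * (4 * y ^+ 2) / s2 + 1)).
    by rewrite lerD2r ler_pM2r ?invr_gt0 // ler_pM2l.
  rewrite (_ : 4 * (4 / s2 + 1) * y ^+ 2 = 4 * (4 * y ^+ 2) / s2 + 4 * y ^+ 2).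
    by lra.
  by field; rewrite gt_eqF.
apply: (@le_trans _ _ (3 * (k * L) * (4 * (4 / s2 + 1) * y ^+ 2))).
  by rewrite ler_pM ?mulr_ge0 // ler_pM2l.
rewrite (_ : 3 * (k * L) * _ = 12 * (4 / s2 + 1) * k * L * y ^+ 2); last by ring.
by rewrite exprS ler_wpM2r // sqr_ge0.
Qed.

Lemma eventual_scales (A C D : R) p : (2 <= p)%N ->
  exists n0, forall n, (n0 < n)%N ->
  let u := ilog R p.+1 n in
  let L := ilog R 2 n in
  [/\ 1 <= u, expR u = ilog R p n, C * u <= expR (u / 6),
      ilog R p n <= L &
      [/\ 1 <= L, A <= L, expR L = ilog R 1 n, D * L <= ilog R 1 n &
          L ^+ 4 <= ilog R 1 n]].
Proof.
move=> p2.
have [X1 X1P] := exp_dominates (6 * C) 1.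
have [X2 X2P] := exp_dominates D 1.
have [X3 X3P] := exp_dominates (1 : R) 4.
have [n1 n1P] := ilog_large p.+1 (1 + `|X1| * 6).
have [n2 n2P] := ilog_large 2 (1 + `|A| + `|X2| + `|X3|).
have [n3 n3P] := ilog_le2 R p2.
exists (maxn n1 (maxn n2 n3)) => n; rewrite !gtn_max => /and3P[/n1P un /n2P Ln /n3P xL].
have pos k : 1 <= ilog R k.+1 n -> expR (ilog R k.+1 n) = ilog R k n.
  by move=> k1; rewrite ilogK // ltNge; apply/negP => /ln0; move: k1; rewrite ilogS => + E; rewrite E; lra.
have aX1 := normr_ge0 X1; have aX2 := normr_ge0 X2; have aX3 := normr_ge0 X3.
have aA := normr_ge0 A.
have lX1 := ler_norm X1; have lX2 := ler_norm X2; have lX3 := ler_norm X3.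
have lA := ler_norm A.
have u1 : 1 <= ilog R p.+1 n by lra.
have L1 : 1 <= ilog R 2 n by lra.
have xE := pos _ u1; have LE := pos _ L1.
split => //; last split => //; first 2 [lra].
- have := X1P (ilog R p.+1 n / 6); rewrite expr1 => h.
  have -> : C * ilog R p.+1 n = 6 * C * (ilog R p.+1 n / 6) by field.
  by apply: h; lra.
- by have := X2P (ilog R 2 n); rewrite expr1 LE; apply; lra.
- by have := X3P (ilog R 2 n); rewrite mul1r LE; apply; lra.
Qed.

Lemma asymptotics (b s2 gamma eta : R) p :
  0 <= b -> 0 < s2 -> 11 <= gamma -> 0 < eta -> (2 <= p)%N ->
  exists n0, forall n, (n0 < n)%N ->
  let w := gamma * ilog R 2 n in
  let G := Gamma gamma n in
  exists (f : nat) (h1 s r : R) (B K k0 : nat),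
  [/\ fscale R p n = f%:Z /\ (0 < f)%N,
      [/\ 0 < w, b <= w & 3 * w < G],
      [/\ 0 < h1 < G, 0 <= s < G & 0 < r < G],
      4 * (G + b) ^+ 2 <= s2 * B%:R /\ G <= k0%:R * w &
      bad_rate b s2 gamma n h1 s r f B K <= Rrate R p n /\
      occ_bound gamma n h1 s b eta (K * B) <= n%:R / f%:R].
Proof.
move=> b0 s20 g11 eta0 p2.
have [c0 c0E] : exists c0, c0 = 4 / s2 + 1 by eexists.
have c00 : 0 < c0 by rewrite c0E addr_gt0 // divr_gt0.
have l0 : 0 < ln (6 / 5) :> R by rewrite ln_gt0 //; lra.
(* K of order u / ln(6/5) blocks give (5/6)^K <= exp(- u) = 1 / x; rounding up is covered by the
   extra 1, as u >= 1. *)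
have [k kE] : exists k, k = (ln (6 / 5 : R))^-1 + 1 by eexists.
have k1 : 1 <= k by rewrite kE lerDr invr_ge0 ltW.
have [|C3 C30 badP] := @bad_rate_ex _ b s2 gamma b0 s20; first by lra.
(* [D] adds up all the factors that y / L has to exceed, so that one threshold serves every
   comparison below. *)
have [D DE] : exists D, D = 16 + 3 * gamma + 12 * c0 * k + 16 * (2 * expR (3 * b)) +
  4 * (expR (2 * b) / eta) + 4 * expR (2 * b) by eexists.
have [n0 n0P] := eventual_scales b (C3 * k) D p2.
exists n0 => n /n0P.
have [u uE] : exists u, u = ilog R p.+1 n by eexists.
have [x xE] : exists x, x = ilog R p n by eexists.
have [L LE] : exists L, L = ilog R 2 n by eexists.
have [y yE] : exists y, y = ilog R 1 n by eexists.
cbv zeta; rewrite -uE -xE -LE -yE => -[u1 ux uz xL [L1 bL _ DL L4y]].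
have x0 : 0 < x by rewrite -ux expR_gt0.
have y0 : 0 < y by apply: lt_le_trans L4y; rewrite exprn_gt0 //; lra.
(* [z ^+ 6] is [ilog R p n]; the bad events have total probability of order
   [u / z ^+ 4], to be compared with [Rrate R p n = sqrt u / z ^+ 3]. *)
have [z zE] : exists z, z = expR (u / 6) by eexists.
rewrite -zE in uz.
have z6 : z ^+ 6 = x by rewrite -ux zE -expRM_natl; congr expR; field.
have z1 : 1 <= z by rewrite zE -[leLHS]expR0 ler_expR; lra.
have z0 : 0 < z by lra.
have LLy : L ^+ 2 <= y by apply: le_trans L4y; rewrite ler_weXn2l.
have E2 : 0 < expR (2 * b) by rewrite expR_gt0.
have E3 : 0 < expR (3 * b) by rewrite expR_gt0.
have Ee : 0 < expR (2 * b) / eta by rewrite divr_gt0.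
have ck0 : 0 < 12 * c0 * k by rewrite !mulr_gt0 //; lra.
have DLe a : a <= D -> a * L <= y by move=> aD; apply: le_trans DL; rewrite ler_wpM2r //; lra.
have De a : 0 <= a -> a <= D -> a <= y.
  by move=> a0 aD; apply: le_trans (DLe _ aD); rewrite ler_peMr.
have Ly : (16 + gamma) * L <= y.
  by apply: DLe; rewrite DE; move: g11 ck0 E2 E3 Ee; clear; lra.
have KLy : 12 * c0 * k * L <= y.
  by apply: DLe; rewrite DE; move: g11 ck0 E2 E3 Ee; clear; lra.
have y16 : 16 * L + 3 * (gamma * L) <= y.
  rewrite mulrA -mulrDl; apply: DLe; rewrite DE.
  by move: g11 ck0 E2 E3 Ee; clear; lra.
have A1 : 16 * (2 * expR (3 * b)) <= y.
  by apply: De; rewrite ?DE; move: g11 ck0 E2 E3 Ee; clear; lra.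
have A2 : 4 * (expR (2 * b) / eta) <= y.
  by apply: De; rewrite ?DE; move: g11 ck0 E2 E3 Ee; clear; lra.
have A3 : 4 * expR (2 * b) <= y.
  by apply: De; rewrite ?DE; move: g11 ck0 E2 E3 Ee; clear; lra.
clear n0P DE DLe De DL.
have gL : 11 * L <= gamma * L by rewrite ler_wpM2r //; lra.
have GE : Gamma gamma n = y + gamma * L by rewrite yE LE.
have x2 : 2 <= x by rewrite -ux; apply: le_trans (expR_ge1Dx _); lra.
have Lx2 : 2 <= L * x.
  by apply: (le_trans x2); rewrite ler_peMl // ltW.
have Lxx : 2 <= (L * x) ^+ 2.
  by apply: (le_trans Lx2); rewrite expr2 ler_peMl //; move: Lx2; clear; lra.
have [f [fE fge fle]] : exists f, [/\ fscale R p n = f%:Z,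
    (L * x) ^+ 2 / 2 <= f%:R & f%:R <= (L * x) ^+ 2].
  by rewrite /fscale -LE -xE; eexists; exact: floor_half Lxx.
have f0 : (0 < f)%N.
  by rewrite -(ltr0n R); apply: lt_le_trans fge; move: Lxx; clear; lra.
have fy : f%:R <= y.
  apply: (le_trans fle); apply: le_trans L4y.
  rewrite exprMn (exprD L 2 2) ler_pM2l ?exprn_gt0 ?(lt_le_trans ltr01) //.
  by rewrite lerXn2r ?nnegrE ?(ltW x0) ?(le_trans ler01).
have uL : u <= L by apply: le_trans xL; rewrite -ux; apply: le_trans (expR_ge1Dx _); lra.
have [B [B0 B1 B2]] : exists B, [/\ (0 < B)%N,
    4 * (Gamma gamma n + b) ^+ 2 / s2 <= B%:R &
    B%:R <= 4 * (Gamma gamma n + b) ^+ 2 / s2 + 1].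
  by apply: ex_natS; rewrite divr_ge0 ?(ltW s20) // mulr_ge0 ?sqr_ge0.
have [K [K0 K1 K2']] : exists K, [/\ (0 < K)%N, u / ln (6 / 5) <= K%:R &
    K%:R <= u / ln (6 / 5) + 1].
  by apply: ex_natS; rewrite divr_ge0 ?(ltW l0) // (le_trans ler01).
have K2 : K%:R <= k * u.
  by apply: (le_trans K2'); rewrite kE [leRHS]mulrDl mul1r (mulrC _ u) lerD2l.
have [k0 [_ k01 _]] : exists k0, [/\ (0 < k0)%N,
    Gamma gamma n / (gamma * L) <= k0%:R & k0%:R <= Gamma gamma n / (gamma * L) + 1].
  by apply: ex_natS; apply: divr_ge0; rewrite ?GE; move: L1 gL y16; clear; lra.
have K6 : (5 / 6) ^+ K <= (z ^+ 6)^-1.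
  have -> : 5 / 6 = expR (- ln (6 / 5)) :> R.
    by rewrite expRN lnK ?posrE ?invf_div //; lra.
  rewrite z6 -ux -expRN -expRM_natl ler_expR mulrN lerN2.
  by rewrite -ler_pdivrMr.
have KN : (2 * (K * B) + 1)%:R <= y ^+ 3 :> R.
  have kL : 0 <= k * L by apply: mulr_ge0; apply: le_trans ler01 _.
  apply: (@horizon_le s2 y (Gamma gamma n + b) k L) => //; first by move: L1 gL y16; clear; lra.
  - by rewrite GE; apply/andP; move: L1 gL y16 b0 bL; clear; split; lra.
  - by apply: (le_trans K2); rewrite ler_pM2l // (lt_le_trans ltr01).
  - by rewrite -c0E.
have zL : z ^+ 4 <= L.
  by apply: le_trans xL; rewrite -z6 ler_weXn2l.
have z4 : 1 <= z ^+ 4 by rewrite exprn_ege1.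
have r0 : L <= L * z ^+ 4 by rewrite ler_peMr // (le_trans ler01).
have ry : L * z ^+ 4 <= y.
  by apply: le_trans LLy; rewrite expr2 ler_pM2l // (lt_le_trans ltr01).
(* [h1] and [s] are dictated by [occ_bound_le]; with r = L z^4 and f of order L^2 z^12, both r^2 / f
   and s / r are of order z^(-4). *)
exists f, (y - 8 * L), (5 * L), (L * z ^+ 4), B, K, k0.
split => //.
- by move: L1 gL y16 GE bL; clear => *; split; lra.
- by move: L1 gL y16 GE bL r0 ry; clear => *; split; lra.
- split; first by rewrite (mulrC s2) -ler_pdivrMr.
  by rewrite -ler_pdivrMr //; move: L1 gL; clear; lra.
split.
  have bad : bad_rate b s2 gamma n (y - 8 * L) (5 * L) (L * z ^+ 4) f B K <=
      C3 * (K%:R / z ^+ 4).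
    by rewrite yE LE; apply: badP; rewrite -?LE -?yE // ?z6.
  apply: (le_trans bad); rewrite /Rrate -uE -xE powRN.
  rewrite !powR12_sqrt ?(ltW x0) ?(le_trans ler01 u1) //.
  have -> : Num.sqrt x = z ^+ 3.
    by rewrite -z6 (exprM z 3 2) sqrtr_sqr ger0_norm // exprn_ge0 // ltW.
  have su : 1 <= Num.sqrt u by rewrite -(sqrtr1 R) ler_sqrt //; move: u1; clear; lra.
  (* On this form it remains to compare C3 K, at most C3 k u, with sqrt(u) z; exponential growth of
     [z] in [u] leaves room, so the bound holds with constant 1. *)
  have -> : Num.sqrt u * (z ^+ 3)^-1 = Num.sqrt u * z / z ^+ 4.
    by field; rewrite gt_eqF.
  rewrite mulrA ler_pM2r ?invr_gt0 ?exprn_gt0 //.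
  apply: le_trans (_ : z <= _); last by rewrite ler_peMl // ltW.
  by apply: le_trans uz; rewrite -mulrA ler_wpM2l.
rewrite yE LE; apply: occ_bound_le; rewrite -?LE -?yE //.
by move: L1 gL y16; clear; lra.
Qed.
End Asymptotics.

(** * The increments of the potential *)

Section EnvironmentProcess.
Context d (T : measurableType d) (R : realType) (Q : probability T R).
Variable alpha : int -> {RV Q >-> R}.
Hypothesis alphaI : iid_environment alpha.

Let a01 i w : 0 < alpha i w < 1. Proof. by case: alphaI. Qed.

Lemma measurable_strip (eta : R) i :
  measurable [set w | eta <= alpha i w <= 1 - eta].
Proof.
rewrite (_ : mkset _ = [set w | eta <= alpha i w] `&` [set w | alpha i w <= 1 - eta]).
  by apply: measurableI; [apply: meas_ge|apply: meas_le] => //; exact: measurable_cst.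
by apply/seteqP; split => w /= /andP.
Qed.

Lemma prC0 (A : set T) : measurable A -> Q A = 1%E -> pr Q (~` A) = 0.
Proof. by move=> mA A1; rewrite prC // /pr A1 subrr. Qed.

Lemma prI1 (A B : set T) : measurable A -> measurable B -> Q B = 1%E ->
  pr Q (A `&` B) = pr Q A.
Proof.
move=> mA mB B1; apply/eqP; rewrite eq_le; apply/andP; split.
  by apply: le_pr => //; exact: measurableI.
have mI := measurableI _ _ mA mB.
have := prU Q (measurableC mA) (measurableC mB).
by rewrite -setCI (prC Q mI) (prC Q mA) (prC0 mB B1); lra.
Qed.

(** Halving [eta0] moves strictly below both suprema, where the bounds hold almost surely without
    the suprema being attained; the common law carries them to every site. *)
Lemma strip_ex (eta0 : R) : 0 < eta0 ->
  eta0 <= sup [set x : R | Q [set w | x <= alpha 0 w] = 1%E] ->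
  eta0 <= sup [set x : R | Q [set w | alpha 0 w <= 1 - x] = 1%E] ->
  exists2 eta, 0 < eta & forall i, Q [set w | eta <= alpha i w <= 1 - eta] = 1%E.
Proof.
move=> eta0_gt0 s1 s2; exists (eta0 / 2); first by rewrite divr_gt0.
have adh (E : set R) : eta0 <= sup E -> exists2 x, E x & eta0 / 2 < x.
  (* [sup] takes the default value 0 on a set without supremum, which contradicts 0 < eta0. *)
  move=> sE; have hE : has_sup E.
    by apply: contrapT => /sup_out E0; move: sE; rewrite E0; lra.
  have e2 : 0 < eta0 / 2 by rewrite divr_gt0.
  by have [x Ex xE] := sup_adherent e2 hE; exists x => //; lra.
have [x1 x1E x1P] := adh _ s1; have [x2 x2E x2P] := adh _ s2.
have m1 x : measurable [set w | x <= alpha 0 w].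
  by apply: meas_ge => //; exact: measurable_cst.
have m2 x : measurable [set w | alpha 0 w <= x].
  by apply: meas_le => //; exact: measurable_cst.
have pr1 A B : measurable A -> measurable B -> Q A = 1%E -> A `<=` B -> Q B = 1%E.
  move=> mA mB A1 AB; apply/eqP; rewrite eq_le probability_le1 //= -A1.
  by apply: le_measure; rewrite ?inE.
have q1 : Q [set w | eta0 / 2 <= alpha 0 w] = 1%E.
  by apply: (pr1 _ _ (m1 x1) (m1 _) x1E) => w /=; lra.
have q2 : Q [set w | alpha 0 w <= 1 - eta0 / 2] = 1%E.
  by apply: (pr1 _ _ (m2 (1 - x2)) (m2 _) x2E) => w /=; lra.
move=> i; have [_ _ law] := alphaI.
have mB : measurable (`[eta0 / 2, 1 - eta0 / 2]%classic : set R).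
  exact: measurable_itv.
have pre j : [set w | eta0 / 2 <= alpha j w <= 1 - eta0 / 2] =
    alpha j @^-1` `[eta0 / 2, 1 - eta0 / 2]%classic.
  by apply/seteqP; split => w; rewrite /= in_itv.
rewrite pre (law i _ mB) -pre.
rewrite (prE Q (measurable_strip _ _)) (_ : mkset _ =
    [set w | eta0 / 2 <= alpha 0 w] `&` [set w | alpha 0 w <= 1 - eta0 / 2]).
  by rewrite prI1 // /pr q1.
by apply/seteqP; split => w /= /andP.
Qed.

Variable eta : R.
Hypothesis eta_gt0 : 0 < eta.
Hypothesis strip1 : forall i, Q [set w | eta <= alpha i w <= 1 - eta] = 1%E.

Definition stripped := [set w | forall i, eta <= alpha i w <= 1 - eta].

Lemma eta_lt : eta <= 1 - eta.
Proof.
apply: contrapT => h; have := strip1 0.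
rewrite (_ : mkset _ = set0) ?measure0 => [/esym/eqP|]; first by rewrite onee_eq0.
apply/seteqP; split => w //= /andP[h1 h2]; apply: h; lra.
Qed.

Lemma measurable_stripped : measurable stripped.
Proof.
rewrite (_ : stripped = \bigcap_(k : nat) ([set w | eta <= alpha k%:Z w <= 1 - eta] `&`
   [set w | eta <= alpha (- k%:Z) w <= 1 - eta])).
  by apply: bigcapT_measurable => k; apply: measurableI; exact: measurable_strip.
apply/seteqP; split => w /=; first by move=> h k _; split; exact: h.
by move=> h [k|k]; [have [] := h k I|have [] := h k.+1 I; rewrite -NegzE].
Qed.

Lemma stripped1 : Q stripped = 1%E.
Proof.
rewrite (prE Q measurable_stripped); congr EFin.
have := prC Q measurable_stripped.
suff -> : pr Q (~` stripped) = 0 by lra.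
apply/eqP; rewrite eq_le pr_ge0 andbT.
pose F (k : nat) := ~` [set w | eta <= alpha k%:Z w <= 1 - eta] `|`
   ~` [set w | eta <= alpha (- k%:Z) w <= 1 - eta].
have mF k : measurable (F k).
  by apply: measurableU; apply: measurableC; exact: measurable_strip.
rewrite (_ : ~` stripped = \bigcup_k F k).
  apply: (pr_bigcup (p := fun=> 0)) => // [k|n]; last by rewrite big1.
  apply: le_trans (prU Q _ _) _; try by apply: measurableC; exact: measurable_strip.
  by rewrite !prC0 ?addr0 //; exact: measurable_strip.
apply/seteqP; split => w /=.
  move=> h; apply: contrapT => nF; apply: h => i; apply: contrapT => h; apply: nF.
  case: i h => k h; first by exists k => //; left.
  by exists k.+1 => //; right; rewrite /= -NegzE.
by move=> [k _ [h|h] g]; apply: h; exact: g.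
Qed.

(* Almost surely all [alpha i] lie in [[eta, 1 - eta]]; clipping makes the
   increments bounded everywhere. *)
Definition clip (x : R) := Num.max eta (Num.min x (1 - eta)).
Definition log_odds (x : R) := ln (1 - clip x) - ln (clip x).
Definition increment i w := log_odds (alpha i w).

Lemma clipP x : eta <= clip x <= 1 - eta.
Proof. by rewrite /clip le_max lexx ge_max eta_lt ge_min lexx orbT. Qed.

Lemma clip_id x : eta <= x <= 1 - eta -> clip x = x.
Proof. by rewrite /clip => /andP[h1 h2]; rewrite min_l // max_r. Qed.

Lemma measurable_log_odds : measurable_fun setT log_odds.
Proof.
have mc : measurable_fun setT clip.
  apply: measurable_maxr; first exact: measurable_cst.
  by apply: measurable_minr; [exact: measurable_id|exact: measurable_cst].
apply: measurable_funB; apply: measurableT_comp => //; try exact: measurable_ln.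
by apply: measurable_funB => //; exact: measurable_cst.
Qed.

Lemma increment_eps i w : stripped w -> increment i w = eps (fun j => alpha j w) i.
Proof.
move=> /(_ i) h; have /andP[h1 h2] := a01 i w.
by rewrite /increment /log_odds clip_id // /eps ln_div ?posrE //; lra.
Qed.

Lemma increment_le i w : `|increment i w| <= osc eta.
Proof.
have h := clipP (alpha i w); have c := eta_gt0.
have := @eps_le _ (fun=> clip (alpha i w)) _ c (fun=> h) 0.
have /andP[? ?] := h.
by rewrite /eps ln_div ?posrE //; lra.
Qed.

Lemma measurable_increment i : measurable_fun setT (increment i).
Proof. exact: (measurableT_comp measurable_log_odds). Qed.

Lemma increment_indep : independent_family Q increment.
Proof.
move=> s B us mB; have [_ ind _] := alphaI.
apply: (ind s (fun i => log_odds @^-1` B i)) => // i.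
by rewrite -[X in measurable X]setTI; exact: measurable_log_odds.
Qed.

Lemma increment_bm i : bounded_measurable (increment i).
Proof. by split; [exact: measurable_increment|exists (osc eta) => w; exact: increment_le]. Qed.

(** Both means are integrals of g composed with [log_odds] against the common law of the
    [alpha i]. *)
Lemma mean_increment (g : R -> R) i : measurable_fun setT g ->
  (forall j, bounded_measurable (g \o increment j)) ->
  mean Q (g \o increment i) = mean Q (g \o increment 0).
Proof.
move=> mg bg; have [_ _ law] := alphaI.
have mf : measurable_fun setT (EFin \o g \o log_odds).
  by apply/measurable_EFinP; exact: (measurableT_comp mg measurable_log_odds).
have E j : (\int[Q]_w (g (increment j w))%:E =
    \int[distribution Q (alpha j)]_y (EFin \o g \o log_odds) y)%E.
  by rewrite (integral_distribution mf (bmI Q (bg j))).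
rewrite /mean /Rintegral !E; congr fine.
by apply: eq_measure_integral => A mA _; exact: law.
Qed.

(** Transfers the hypotheses on the true log-odds to the clipped increments. *)
Lemma ae_expectation (f g : T -> R) :
  measurable_fun setT f -> measurable_fun setT g ->
  (forall w, stripped w -> f w = g w) -> expectation Q f = expectation Q g.
Proof.
move=> mf mg fg; rewrite unlock; apply: ae_eq_integral => //.
- exact/measurable_EFinP.
- exact/measurable_EFinP.
exists (~` stripped); split; first exact/measurableC/measurable_stripped.
  have h := prE Q (measurableC measurable_stripped).
  by rewrite (prC0 measurable_stripped stripped1) in h.
by move=> w /= h sw; apply: h => _; rewrite fg.
Qed.

Lemma mean_expectation (f : T -> R) : bounded_measurable f -> expectation Q f = (mean Q f)%:E.
Proof.
move=> bf; rewrite unlock /mean /Rintegral fineK //.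
by have h := bmI Q bf; exact: integrable_fin_num h.
Qed.

Let eps0 w := eps (fun j => alpha j w) 0.

Lemma measurable_eps0 : measurable_fun setT eps0.
Proof.
rewrite (_ : eps0 = fun w => ln (1 - alpha 0 w) - ln (alpha 0 w)).
  apply: measurable_funB; apply: measurableT_comp => //; try exact: measurable_ln.
  by apply: measurable_funB => //; exact: measurable_cst.
by apply/funext => w; have /andP[? ?] := a01 0 w; rewrite /eps0 /eps ln_div ?posrE //; lra.
Qed.

Lemma increment_mean0 i : expectation Q eps0 = 0%E -> mean Q (increment i) = 0.
Proof.
move=> E0; rewrite (@mean_increment id i) //; last exact: increment_bm.
apply: EFin_inj; rewrite -[RHS]/(0%E) -E0 -mean_expectation; last exact: increment_bm.
apply: ae_expectation; [exact: measurable_increment|exact: measurable_eps0|].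
by move=> w sw; rewrite /= increment_eps.
Qed.

Lemma increment_sqr i :
  mean Q (fun w => increment i w ^+ 2) = mean Q (fun w => increment 0 w ^+ 2).
Proof.
apply: (@mean_increment (fun x => x ^+ 2)) => [|j].
  exact: measurable_funX.
by under eq_fun do rewrite expr2; apply: bmM; exact: increment_bm.
Qed.

Lemma increment_var : expectation Q eps0 = 0%E -> (0 < variance Q eps0)%E ->
  0 < mean Q (fun w => increment 0 w ^+ 2).
Proof.
move=> E0; rewrite /variance unlock E0 /= -lte_fin -mean_expectation.
  congr (_ < _)%E; apply: ae_expectation.
  - have := measurable_eps0 => m; apply: measurable_funM; exact: measurable_funB.
  - by apply: measurable_funX; exact: measurable_increment.
  move=> w sw; rewrite (increment_eps _ sw).
  by rewrite -[LHS]/((eps0 w - 0) * (eps0 w - 0)) subr0 expr2.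
by under eq_fun do rewrite expr2; apply: bmM; exact: increment_bm.
Qed.

Lemma stripped_right w i : stripped w ->
  right_path (potential (fun j => alpha j w)) i = right_walk increment i ^~ w.
Proof.
move=> sw; apply/funext; elim=> [|t IH].
  by rewrite /right_walk walk0 /right_path addr0 subrr.
rewrite /right_walk walkS -[walk _ _ _ t w]/(right_walk increment i t w) -IH mul1r.
rewrite (increment_eps _ sw) /right_path /right_index.
rewrite (_ : i + t.+1%:Z = i + t%:Z + 1) ?potentialS; last by clear; lia.
by rewrite addrAC.
Qed.

Lemma stripped_left w i : stripped w ->
  left_path (potential (fun j => alpha j w)) i = left_walk increment i ^~ w.
Proof.
move=> sw; apply/funext; elim=> [|t IH].
  by rewrite /left_walk walk0 /left_path subr0 subrr.
rewrite /left_walk walkS -[walk _ _ _ t w]/(left_walk increment i t w) -IH mulN1r.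
rewrite (increment_eps _ sw) /left_path /left_index.
rewrite (potential_pred _ (i - t%:Z)) (_ : i - t.+1%:Z = i - t%:Z - 1); last by clear; lia.
by ring.
Qed.

End EnvironmentProcess.

(** * The quenched estimate and the theorem *)

Lemma finite_Fset (R : realType) p n m : finite_set (Fset R p n m).
Proof.
apply: (@sub_finite_set _ _ ((fun j : nat => m - fscale R p n + j%:Z) @`
    `I_(`|fscale R p n| * 2).+1)); last by apply: finite_image; exact: finite_II.
rewrite /Fset; set f := fscale R p n => k /= kf; exists `|(k - (m - f))%R|%N => /=.
  by move: kf; clear; lia.
by move: kf; clear; lia.
Qed.

(** Markov's inequality at level f^(- rho/2) turns an expected outside time of at most n / f into
    the failure probability f^(rho/2 - 1). *)
Lemma local_time_Fset (R : realType) (a : int -> R) (eta gamma rho h1 s : R)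
    (p n f N : nat) (l m c : int) d2 (T2 : measurableType d2)
    (P2 : probability T2 R) (X : nat -> T2 -> int) :
  0 < eta -> (forall x, eta <= a x <= 1 - eta) -> walk_in_environment a 0 P2 X ->
  (0 < n)%N -> fscale R p n = f%:Z -> (0 < f)%N -> 0 < h1 ->
  good_potential (Gamma gamma n) h1 s f N (potential a) ->
  basin gamma n (potential a) l m c ->
  occ_bound gamma n h1 s (osc eta) eta N <= n%:R / f%:R ->
  ((1 - 1 / f%:R `^ (1 - rho / 2))%:E <=
    P2 [set u | (1 - 1 / f%:R `^ (rho / 2) <=
      local_time_set R X (Fset R p n m) n u / n%:R)%R])%E.
Proof.
move=> eta0 a_eta wX n0 fE f0 h10 gp bs ob.
have fR : 0 < f%:R :> R by rewrite ltr0n.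
have nR : 0 < n%:R :> R by rewrite ltr0n.
have q0 : 0 < f%:R `^ (rho / 2) :> R by exact: powR_gt0.
have d0 : 0 < 1 / f%:R `^ (rho / 2) :> R by rewrite divr_gt0.
apply: le_trans (local_time_law wX (finite_Fset R p n m) n0 d0).
rewrite lee_fin lerD2l lerN2.
have E : occ a \1_(~` Fset R p n m) n 0 <= n%:R / f%:R.
  apply: le_trans (le_trans (occ_environment eta0 a_eta h10 gp bs) ob).
  rewrite le_eqVlt; apply/orP; left; apply/eqP; congr (occ a _ n 0).
  apply/funext => y; rewrite indicE; congr (nat_of_bool _)%:R.
  by rewrite in_setC /Fset fE; congr (~~ _); apply/idP/idP; rewrite inE.
rewrite ler_pdivrMr ?(mulr_gt0 nR d0) //; apply: (le_trans E).
have -> : f%:R `^ (1 - rho / 2) = f%:R / f%:R `^ (rho / 2) :> R.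
  by rewrite powRB ?powRr1 ?(ltW fR) // (gt_eqF fR) implybT.
by rewrite le_eqVlt; apply/orP; left; apply/eqP; field; rewrite !gt_eqF.
Qed.

Theorem theorem3p1 (R : realType) :
  exists c : R, 0 < c /\
  forall (d1 : measure_display) (Omega1 : measurableType d1)
    (Q : probability Omega1 R) (alpha : int -> {RV Q >-> R}),
  iid_environment alpha ->
  let env : Omega1 -> int -> R := fun w i => alpha i w in
  let eps0 : Omega1 -> R := fun w => eps (env w) 0 in
  expectation Q eps0 = 0%E ->
  (0 < variance Q eps0)%E ->
  (exists eta0 : R, 0 < eta0 < 2^-1 /\
     sup [set x : R | Q [set w | x <= env w 0] = 1%E]
       = sup [set x : R | Q [set w | env w 0 <= 1 - x] = 1%E] /\
     eta0 <= sup [set x : R | Q [set w | x <= env w 0] = 1%E]) ->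
  forall gamma : R, 11 <= gamma ->
  exists c1 : R, 0 < c1 /\
  forall (p : nat) (rho : R), (2 <= p)%N -> 0 < rho < 2 ->
  exists n0 : nat, forall n : nat, (n0 < n)%N ->
  exists G : set Omega1,
    [/\ measurable G,
        ((1 - c * Rrate R p n)%:E <= Q G)%E,
        (forall w, G w -> exists B, basic_valley gamma n (potential (env w)) B)
      & forall (d2 : measure_display) (Omega2 : measurableType d2)
          (X : nat -> Omega2 -> int)
          (P : (int -> R) -> int -> probability Omega2 R),
        quenched_laws X P ->
        ((1 - c1 / (fscale R p n)%:~R `^ (1 - rho / 2))%:E <=
         ereal_inf
           [set P (env v.1) 0%R
              [set u | (1 - 1 / (fscale R p n)%:~R `^ (rho / 2) <=
                 local_time_set R X (Fset R p n (bot v.2)) n u / n%:R)%R]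
           | v in [set v : Omega1 * triplet |
               G v.1 /\
               basic_valley gamma n (potential (env v.1)) v.2]])%E].
Proof.
(* The bad probability is eventually below [Rrate] and the outside time below n / f, so both
   constants can be 1 and only [n0] depends on the law. *)
exists 1; split=> // d1 Omega1 Q alpha iidA env eps0 E0 V0.
move=> [eta0 [/andP[eta00 _] [s12 s1]]] gamma g11; exists 1; split=> // p rho p2 _.
have [|eta eta_gt0 strip1] := strip_ex iidA eta00 s1; first by rewrite -s12.
have b0 : 0 <= osc eta.
  by rewrite subr_ge0 ler_ln ?posrE // ?(lt_le_trans eta_gt0) // (eta_lt strip1).
have s20 := increment_var iidA eta_gt0 strip1 E0 V0.
have [n0 n0P] := asymptotics b0 s20 g11 eta_gt0 p2.
exists n0 => n n0n.
have [f [h1 [s [r [B [K [k0 [[fE f0] [w0 bw wG]]]]]]]]] := n0P _ n0n.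
move=> [/andP[h10 h1G] /andP[s0 sG] /andP[r0 rG]] [HB k0G] [bad occ_le].
have G0 : 0 < Gamma gamma n by lra.
have [E [mE EP goodE]] := good_event (measurable_increment alpha eta)
  (increment_indep iidA eta) (increment_le (alpha := alpha) eta_gt0 strip1)
  (fun i => increment_mean0 iidA eta_gt0 strip1 i E0)
  (increment_sqr iidA eta_gt0 strip1) s20 K w0 bw wG h10 h1G s0 sG r0 rG f0 HB k0G.
have good w : E w -> stripped alpha eta w ->
  [/\ good_potential (Gamma gamma n) h1 s f (K * B) (potential (env w)),
      ~ tie gamma n (potential (env w)) &
      exists V, deep_valley gamma n (potential (env w)) V].
  move=> Ew sw; apply: (goodE w Ew).
  - exact: potential0.
  - by move=> i; exact: stripped_right.
  - by move=> i; exact: stripped_left.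
(* On [stripped], which has full measure, the clipped increments are those of the potential, so
   [good_event] applies to it. *)
exists (E `&` stripped alpha eta); split.
- by apply: measurableI => //; exact: measurable_stripped.
- have ms := measurable_stripped alpha eta.
  rewrite (prE Q (measurableI _ _ mE ms)) lee_fin.
  rewrite (prI1 mE ms (stripped1 strip1)) mul1r.
  by apply: le_trans EP; rewrite lerD2l lerN2.
- move=> w [Ew sw]; have [_ _ [V dV]] := good w Ew sw.
  have [V' sV'] := smallest_deep_ex G0 dV.
  exact: (basic_valley_ex G0 sV').
move=> d2 Omega2 X P ql; apply/ereal_infP => _ [[w V] /= [[Ew sw] bv] <-].
(* Only the bottom of the basic valley matters; it is the bottom of some smallest deep valley, and
   the estimate holds for any such valley. *)
have [[M1 [M2 sdv]] _ _] := bv.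
have [gp nt _] := good w Ew sw.
have wX : walk_in_environment (env w) 0 (P (env w) 0) X.
  by apply: ql => i; have [h _ _] := iidA; exact: h.
have n_gt0 : (0 < n)%N by exact: leq_ltn_trans n0n.
have fr : (fscale R p n)%:~R = f%:R :> R by rewrite fE.
rewrite fr; apply: (local_time_Fset rho eta_gt0 sw wX n_gt0 fE f0 h10 gp _ occ_le).
exact: (smallest_deep_basin w0 G0 (potential0 _) nt sdv).
Qed.
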